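(* For every index $\boldsymbol{k}=(k_1,\dots,k_r)$, every regularization parameter $T\in\mathbb C$ and every $s\in\mathbb C\setminus\mathbb Z$, one has $$\mathcal T_*^T(\boldsymbol{k};s)=c_0(\boldsymbol{k})+c_1(\boldsymbol{k})\,\mathcal T(1;s)+\sum_{j=1}^{r}\sum_{m=0}^{k_j-2}C_{j,m}^{T}(\boldsymbol{k})\,\mathcal T(k_j-m;s)$$ (the inner sum is empty when $k_j=1$), where $$C_{j,m}^{T}(\boldsymbol{k})=\sum_{\substack{a+b=m\\ a,b\geqslant0}}(-1)^{|\boldsymbol{k}_{[1,j)}|+a}\,\zeta_{*,a}^{T}\bigl(\overleftarrow{\boldsymbol{k}_{[1,j)}}\bigr)\,\zeta_{*,b}^{T}\bigl(\boldsymbol{k}_{(j,r]}\bigr),$$ $$c_0(\boldsymbol{k})=\begin{cases}\dfrac{(i\pi)^r}{r!},&\boldsymbol{k}=\{1\}^r,\ 2\mid r,\\ 0,&\text{otherwise},\end{cases}\qquad c_1(\boldsymbol{k})=\begin{cases}(-1)^{(r-1)/2}\dfrac{\pi^{r-1}}{r!},&\boldsymbol{k}=\{1\}^r,\ 2\nmid r,\\ 0,&\text{otherwise}.\end{cases}$$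
   Context: An index is a finite sequence $\boldsymbol{k}=(k_1,\dots,k_r)$ of positive integers, of depth $r$ and weight $|\boldsymbol{k}|=k_1+\cdots+k_r$; the empty index is $\varnothing$ ($r=0$, weight $0$), and $\{1\}^r=(1,\dots,1)$ ($r$ entries). Reversal: $\overleftarrow{\boldsymbol{k}}=(k_r,\dots,k_1)$. Write $\boldsymbol{k}_{[1,j]}=(k_1,\dots,k_j)$, $\boldsymbol{k}_{(j,r]}=(k_{j+1},\dots,k_r)$, $\boldsymbol{k}_{[1,j)}=(k_1,\dots,k_{j-1})$, with $\boldsymbol{k}_{[1,0]}=\boldsymbol{k}_{(r,r]}=\boldsymbol{k}_{[1,1)}=\varnothing$. An index is admissible if it is empty or its last entry is $\geqslant2$. Stuffle regularization. For a nonempty admissible index $\boldsymbol{a}=(a_1,\dots,a_d)$, $\zeta(\boldsymbol{a};s)=\sum_{0<n_1<\cdots<n_d}\prod_{i}(n_i+s)^{-a_i}$, and $\zeta(\varnothing;s)=1$. On the $\mathbb Q$-span $\mathfrak H^1_*$ of all indices, the stuffle product $*$ is bilinear with unit $\varnothing$ and $(a,\boldsymbol{\alpha})*(b,\boldsymbol{\beta})=(a,\boldsymbol{\alpha}*(b,\boldsymbol{\beta}))+(b,(a,\boldsymbol{\alpha})*\boldsymbol{\beta})+(a+b,\boldsymbol{\alpha}*\boldsymbol{\beta})$; $\mathfrak H^0_*$ is the span of admissible indices. It is known that every index of depth $r$ has a unique decomposition $\boldsymbol{k}=\sum_{l=0}^r\boldsymbol{u}_l*(1)^{*l}$ with $\boldsymbol{u}_l\in\mathfrak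 H^0_*$. Define $\zeta_*^X(\boldsymbol{k};s)=\sum_{l=0}^r\zeta(\boldsymbol{u}_l;s)X^l$ (with $\zeta(\cdot;s)$ extended linearly); equivalently, $\zeta_*^X(\cdot;s)$ is the unique stuffle homomorphism extending $\zeta(\cdot;s)$ on admissible indices with $\zeta_*^X(1;s)=X$. Put $\zeta_*^X(\boldsymbol{k})=\zeta_*^X(\boldsymbol{k};0)$ and, for $m\geqslant0$, $$\zeta_{*,m}^X(\boldsymbol{k})=\sum_{\substack{\lambda_1+\cdots+\lambda_r=m\\ \lambda_\nu\geqslant0}}\Bigl(\prod_{\nu=1}^r\tbinom{-k_\nu}{\lambda_\nu}\Bigr)\zeta_*^X(k_1+\lambda_1,\dots,k_r+\lambda_r),\qquad \zeta_{*,m}^X(\varnothing)=\delta_{m,0}.$$ Harmonic number function: $H(s)=\int_0^1\frac{1-t^s}{1-t}\,dt=\psi(1+s)+\gamma=\sum_{n\geqslant1}\bigl(\frac1n-\frac1{n+s}\bigr)$, extended meromorphically to $\mathbb C$. Regularized multitangent function: $$\mathcal T_*^T(\boldsymbol{k};s)=\sum_{j=0}^{r}(-1)^{|\boldsymbol{k}_{[1,j]}|}\zeta_*^{T-H(-s)}(\overleftarrow{\boldsymbol{k}_{[1,j]}};-s)\,\zeta_*^{T-H(s)}(\boldsymbol{k}_{(j,r]};s)+\sum_{j=1}^{r}\frac{(-1)^{|\boldsymbol{k}_{[1,j)}|}}{s^{k_j}}\zeta_*^{T-H(-s)}(\overleftarrow{\boldsymbol{k}_{[1,j)}};-s)\,\zeta_*^{T-H(s)}(\boldsymbol{k}_{(j,r]};s),$$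 with empty-index factors equal to $1$. Monotangent functions: $\mathcal T(k;s)=\sum_{n\in\mathbb Z}(n+s)^{-k}$ for $k\geqslant2$, and $\mathcal T(1;s)=\lim_{N\to\infty}\sum_{-N<n<N}\frac1{n+s}=\pi\cot(\pi s)$. *)

(* Defs.v *)
From HB Require Import structures.
From mathcomp Require Import all_boot all_order all_algebra.
From mathcomp Require Import all_classical all_reals all_analysis.
From mathcomp.real_closed Require Import complex.
From mathcomp.multinomials Require Import freeg.

Set Implicit Arguments.
Unset Strict Implicit.
Unset Printing Implicit Defensive.

Import Order.TTheory GRing.Theory Num.Theory.
Import numFieldNormedType.Exports.

Local Open Scope classical_set_scope.
Local Open Scope ring_scope.

(* The index (k_1, ..., k_r) is the list [:: k_1; ...; k_r], so that the depth,
   the weight and the reversal are [size], [sumn] and [rev]; k_j is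
   [nth 0 k j.-1], and k_[1,j] and k_(j,r] are [take j k] and [drop j k]. *)
Definition is_index (k : seq nat) : bool := all (leq 1) k.

Definition admissible (k : seq nat) : bool :=
  is_index k && ((k == [::]) || (2 <= last 0 k)%N).

(* This is the span of all lists of naturals; the span of the indices is the
   subspace of the elements supported on lists satisfying [is_index]. *)
Notation H1 := {freeg (seq nat) / rat}.

Definition in_H0 (u : H1) : bool := all admissible (dom u).

(* The words of the stuffle product of two words, with multiplicity. *)
Fixpoint stuffle_words (x : seq nat) : seq nat -> seq (seq nat) :=
  match x with
  | [::] => fun y => [:: y]
  | a :: x' =>
      fix stuffle_words_x y :=
        match y with
        | [::] => [:: x]
        | b :: y' =>
               [seq a :: w | w <- stuffle_words x' y]
            ++ [seq b :: w | w <- stuffle_words_x y']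
            ++ [seq (a + b)%N :: w | w <- stuffle_words x' y']
        end
  end.

Definition stuffle (u v : H1) : H1 :=
  fglift (fun x : seq nat =>
    fglift (fun y : seq nat => \sum_(w <- stuffle_words x y) (<< w >> : H1)) v)
  u.

Definition stuffle_exp (u : H1) (l : nat) : H1 :=
  iter l (stuffle u) << [::] >>.

Definition is_stuffle_decomp (k : seq nat) (u : {ffun 'I_(size k).+1 -> H1}) :
    Prop :=
  (forall l, in_H0 (u l)) /\
  << k >> = \sum_l stuffle (u l) (stuffle_exp << [:: 1%N] >> l) :> H1.

(* For an index [k] there is exactly one [u] with [is_stuffle_decomp k u]. *)
Definition stuffle_decomp (k : seq nat) : {ffun 'I_(size k).+1 -> H1} :=
  xget [ffun=> 0] [set u | is_stuffle_decomp u].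

Section Functions.
Variable C : numClosedFieldType.

(* The sum over 0 < n_1 < ... < n_d < N; it is 1 when a is empty. *)
Definition zeta_trunc (a : seq nat) (s : C) (N : nat) : C :=
  \sum_(n : (size a).-tuple 'I_N | path ltn 0 (map val n))
    \prod_(i < size a) ((tnth n i)%:R + s) ^- nth 0%N a i.

Definition zeta (a : seq nat) (s : C) : C := limn (zeta_trunc a s).

Definition zeta_lin (u : H1) (s : C) : C :=
  \sum_(a <- dom u) ratr (coeff a u) * zeta a s.

Definition zeta_reg (X : C) (k : seq nat) (s : C) : C :=
  \sum_(l < (size k).+1) zeta_lin (stuffle_decomp k l) s * X ^+ l.

Definition gbinom (x : C) (n : nat) : C :=
  (\prod_(i < n) (x - i%:R)) / n`!%:R.

(* Bounding each lambda_nu by m loses nothing since the lambda_nu sum to m. *)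
Definition zeta_reg_coef (m : nat) (X : C) (k : seq nat) : C :=
  \sum_(lam : (size k).-tuple 'I_m.+1 |
          (\sum_(i < size k) tnth lam i)%N == m)
    (\prod_(i < size k) gbinom (- (nth 0%N k i)%:R) (tnth lam i)) *
    zeta_reg X [seq (nth 0%N k i + tnth lam i)%N | i : 'I_(size k)] 0.

(* H(s) through its series, which converges for every s in C other than the
   poles -1, -2, ... of the meromorphic function H. *)
Definition harmonic_fun (s : C) : C :=
  limn (fun N => \sum_(1 <= n < N) (n%:R^-1 - (n%:R + s)^-1)).

Definition multitangent_reg (T : C) (k : seq nat) (s : C) : C :=
  let L j := zeta_reg (T - harmonic_fun (- s)) (rev (take j k)) (- s) in
  let R j := zeta_reg (T - harmonic_fun s) (drop j k) s in
  \sum_(0 <= j < (size k).+1) (-1) ^+ sumn (take j k) * L j * R j +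
  \sum_(1 <= j < (size k).+1)
    (-1) ^+ sumn (take j.-1 k) / s ^+ nth 0%N k j.-1 * L j.-1 * R j.

(* For k >= 2 the sum over all integers is the sum of two convergent series;
   for k = 1 only the symmetric partial sums converge. *)
Definition monotangent (k : nat) (s : C) : C :=
  if k == 1%N then
    limn (fun N => \sum_(0 <= n < N) (n%:R + s)^-1 +
                   \sum_(1 <= n < N) (- n%:R + s)^-1)
  else
    limn (fun N => \sum_(0 <= n < N) (n%:R + s) ^- k) +
    limn (fun N => \sum_(1 <= n < N) (- n%:R + s) ^- k).

Definition coef_C (T : C) (k : seq nat) (j m : nat) : C :=
  \sum_(0 <= a < m.+1)
    (-1) ^+ (sumn (take j.-1 k) + a) *
    zeta_reg_coef a T (rev (take j.-1 k)) *
    zeta_reg_coef (m - a) T (drop j k).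

End Functions.

Section Constants.
Variable R : realType.

Definition coef_c0 (k : seq nat) : R[i] :=
  let r := size k in
  if (k == nseq r 1%N) && ~~ odd r then ('i%C * (pi : R)%:C%C) ^+ r / r`!%:R
  else 0.

Definition coef_c1 (k : seq nat) : R[i] :=
  let r := size k in
  if (k == nseq r 1%N) && odd r then
    (-1) ^+ (r.-1)./2 * (pi : R)%:C%C ^+ r.-1 / r`!%:R
  else 0.

End Constants.

(* Main.v *)
Require Import Defs.
From HB Require Import structures.
From mathcomp Require Import all_boot all_order all_algebra.
From mathcomp Require Import all_classical all_reals all_analysis.
From mathcomp.real_closed Require Import complex.
From mathcomp.multinomials Require Import freeg.
From mathcomp Require Import ring lra zify.

Set Implicit Arguments.
Unset Strict Implicit.
Unset Printing Implicit Defensive.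

Import Order.TTheory GRing.Theory Num.Theory.
Import numFieldNormedType.Exports.

Local Open Scope ring_scope.

(**
The regularized multitangent function is the regularization of the divergent
sum over all increasing sequences of integers n_1 < ... < n_r of the product of
the (n_i + s)^-k_i, and the identity is its partial fraction expansion.  The
proof works with the finite sum over -M <= n_1 < ... < n_r <= M and lets M grow;
the harmonic number H_M then plays the part of the parameter T.  All error terms
are of the shape (log M)^p / M, up to a constant.

The truncated sum.  A sum over increasing sequences of points is a
quasi-symmetric function of the points ([qsym]), so it obeys the stuffle product
([qsym_stuffle]) and splits at the point 0 ([qsym_cat]).  Evaluating a stuffle
decomposition (one exists by [index_decomposable]) shows that a truncated zeta
value is [zeta_reg] at X = H_M - H(s) up to a small error ([zeta_reg_asymp]),
hence that the truncated multitangent sum is [multitangent_reg] at T = H_M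
([multitangent_trunc_asymp]).

Partial fractions.  As a rational function of s the truncated sum expands into
its poles ([partial_fractions]).  Its Laurent coefficients at an integer depend
only on the numbers a and b of points of the interval to the left and to the
right of it, and [laurent_intE] writes them through truncated zeta values.  In
pole order q >= 2 the coefficient may be replaced by its value at the centre of
the interval, because it varies slowly while (n + s)^-q is summable
([coef_centre]); that value is close to the sum of the C_{j,m} with k_j - m = q,
taken at T = H_M, and the sum of the (n + s)^-q tends to the monotangent function.

Simple poles.  If k has an entry greater than one, the residues are negligible:
their sum is 0, as the truncated sum is O(s^-2) at infinity, and they vary
slowly, so each of them is close to their average, which is 0 ([residue_small]).

The index {1}^r.  Here the residues are not negligible.  Put
E(x) = prod (1 + x / (n + s)) over the points, the generating series of the
truncated sums for {1}^r, and P(x) = sum 1 / (n + s + x).  Then E' = P E, and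
E'' = V E where V(x) is the sum of 1 / ((m + s + x) (n + s + x)) over the ordered
pairs m <> n.  Partial fractions of V show that its higher coefficients vanish
in the limit and that its constant coefficient becomes independent of s
([pair_series_asymp0], [pair_series_indep]); s = 1/2 and Euler's sum of the
inverse odd squares give the value -pi^2 ([pair_series_asymp]).  So the limits
e_r satisfy r (r - 1) e_r = - pi^2 e_(r-2), which is the recursion of c_0 and c_1.

Conclusion.  Both sides of the theorem are polynomials in T whose difference at
T = H_M tends to 0.  As H_M tends to infinity, they are equal
([poly_identity]).
*)

(** * Quasi-symmetric sums and formal power series *)

Section Qsym.
Variable A : comNzRingType.
Implicit Types (k : seq nat) (ys : seq A).

(** The monomial quasi-symmetric function of the exponents k at the points ys. The
    recursion is on the list of points, so that concatenation, reversal and the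
    stuffle product are inductions that peel off one point. *)
Fixpoint qsym ys k {struct ys} : A :=
  match k, ys with
  | [::], _ => 1
  | _ :: _, [::] => 0
  | x :: k', y :: ys' => qsym ys' k + y ^+ x * qsym ys' k'
  end.

Lemma qsym_nil ys : qsym ys [::] = 1. Proof. by case: ys. Qed.

Lemma qsym_cons y ys x k :
  qsym (y :: ys) (x :: k) = qsym ys (x :: k) + y ^+ x * qsym ys k.
Proof. by []. Qed.

(** An increasing choice of points in ys ++ zs splits at the border. *)
Lemma qsym_cat ys zs k :
  qsym (ys ++ zs) k =
  \sum_(j < (size k).+1) qsym ys (take j k) * qsym zs (drop j k).
Proof.
elim: ys k => [|y ys IH] [|x k].
- by rewrite big_ord1 /= qsym_nil mul1r.
- rewrite big_ord_recl /= mul1r big1 ?addr0 // => i _; exact: mul0r.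
- by rewrite big_ord1 /= !qsym_nil mul1r.
rewrite cat_cons qsym_cons !IH big_ord_recl /= qsym_nil.
rewrite [in RHS]big_ord_recl /= -addrA; congr (_ + _).
rewrite mulr_sumr -big_split /=; apply: eq_bigr => i _.
by rewrite mulrDl mulrA.
Qed.

Lemma qsym_rcons ys y k x :
  qsym (rcons ys y) (rcons k x) = qsym ys (rcons k x) + y ^+ x * qsym ys k.
Proof.
elim: ys k => [|y0 ys IH] [|z k] //=.
- by rewrite mulr0 addr0; case: k => [|a k] //=; rewrite mulr0 !addr0.
- by have /= -> := IH [::]; rewrite !qsym_nil; ring.
have /= -> := IH (z :: k).
have /= -> := IH k; ring.
Qed.

Lemma qsym_rev ys k : qsym (rev ys) (rev k) = qsym ys k.
Proof.
elim: ys k => [|y ys IH] [|x k].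
- by [].
- by rewrite rev_cons; case: (rev k).
- by rewrite !qsym_nil.
by rewrite !rev_cons qsym_rcons -rev_cons !IH.
Qed.

Lemma qsym_scale c ys k :
  qsym [seq c * y | y <- ys] k = c ^+ sumn k * qsym ys k.
Proof.
elim: ys k => [|y ys IH] [|x k] /=; rewrite ?expr0 ?mulr1 ?mulr0 //.
by rewrite !IH /= exprMn exprD; ring.
Qed.

End Qsym.

(** A named copy of the type of functions, so that it can carry the Cauchy product.
    Power series are used as a ring in which partial fractions are expanded near a
    pole, and as generating series of elementary symmetric functions. *)
Definition fps (F : comNzRingType) := nat -> F.

Section Fps.
Variable F : comNzRingType.
Local Notation fps := (fps F).
HB.instance Definition _ := gen_eqMixin fps.
HB.instance Definition _ := gen_choiceMixin fps.
Implicit Types f g h : fps.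

Definition fps_trunc n f : {poly F} := \poly_(i < n) f i.
(** The product is computed on truncations, so that the ring axioms come from those of
    polynomials. *)
Definition fps_mul f g : fps := fun n => (fps_trunc n.+1 f * fps_trunc n.+1 g)`_n.

Lemma fps_mulE f g n : fps_mul f g n = \sum_(i < n.+1) f i * g (n - i)%N.
Proof.
rewrite /fps_mul coefM; apply: eq_bigr => i _.
by rewrite !coef_poly ltn_ord ltnS leq_subr.
Qed.

Lemma fps_mul_trunc N n (p q : {poly F}) f g : (n < N)%N ->
  (forall i, (i < N)%N -> p`_i = f i) -> (forall i, (i < N)%N -> q`_i = g i) ->
  (p * q)`_n = fps_mul f g n.
Proof.
move=> nN pf qg; rewrite fps_mulE coefM; apply: eq_bigr => i _.
by rewrite pf ?qg //; [apply: leq_ltn_trans nN; rewrite leq_subr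
  | apply: leq_ltn_trans nN; rewrite -ltnS].
Qed.

Lemma fps_truncE N f i : (i < N)%N -> (fps_trunc N f)`_i = f i.
Proof. by rewrite coef_poly => ->. Qed.

Let addf f g : fps := fun n => f n + g n.
Let oppf f : fps := fun n => - f n.
Let zerof : fps := fun=> 0.
Let addfA : associative addf. Proof. by move=> *; apply/funext => n; apply: addrA. Qed.
Let addfC : commutative addf. Proof. by move=> *; apply/funext => n; apply: addrC. Qed.
Let add0f : left_id zerof addf. Proof. by move=> *; apply/funext => n; apply: add0r. Qed.
Let addNf : left_inverse zerof oppf addf. Proof. by move=> *; apply/funext => n; apply: addNr. Qed.
HB.instance Definition _ := GRing.isZmodule.Build fps addfA addfC add0f addNf.

Lemma fpsD f g n : (f + g) n = f n + g n. Proof. by []. Qed.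
Lemma fps0 n : (0 : fps) n = 0. Proof. by []. Qed.
Lemma fpsN f n : (- f) n = - f n. Proof. by []. Qed.

Definition fpsC (c : F) : fps := fun n => if n is 0 then c else 0.

Let mulfC : commutative fps_mul.
Proof. by move=> f g; apply/funext => n; rewrite /fps_mul mulrC. Qed.
Let mulfA : associative fps_mul.
Proof.
move=> f g h; apply/funext => n.
have tr u : forall i, (i < n.+1)%N -> (fps_trunc n.+1 u)`_i = u i by move=> i /fps_truncE.
have tr2 u v i : (i < n.+1)%N -> (fps_trunc n.+1 u * fps_trunc n.+1 v)`_i = fps_mul u v i.
  by move=> ni; apply: (fps_mul_trunc ni); apply: tr.
have -> : fps_mul f (fps_mul g h) n =
    (fps_trunc n.+1 f * (fps_trunc n.+1 g * fps_trunc n.+1 h))`_n.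
  by apply/esym/(@fps_mul_trunc n.+1) => // i /[dup] ? /fps_truncE // _; apply: tr2.
rewrite mulrA; apply: (@fps_mul_trunc n.+1) => // i /[dup] ? /fps_truncE // _.
exact: tr2.
Qed.
Let mul1f : left_id (fpsC 1) fps_mul.
Proof.
move=> f; apply/funext => n; rewrite fps_mulE big_ord_recl subn0 mul1r.
by rewrite big1 ?addr0 // => i _; rewrite mul0r.
Qed.
Let mulfDl : left_distributive fps_mul +%R.
Proof.
move=> f g h; apply/funext => n; rewrite fpsD !fps_mulE -big_split /=.
by apply: eq_bigr => i _; rewrite mulrDl.
Qed.
Let onef_neq0 : fpsC 1 != 0.
Proof. by apply/eqP => /(congr1 (fun f : fps => f 0%N)) /eqP; rewrite /= oner_eq0. Qed.
HB.instance Definition _ := GRing.Zmodule_isComNzRing.Build fps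
  mulfA mulfC mul1f mulfDl onef_neq0.

Lemma fpsM f g n : (f * g) n = \sum_(i < n.+1) f i * g (n - i)%N.
Proof. exact: fps_mulE. Qed.
Lemma fps1 n : (1 : fps) n = (n == 0%N)%:R. Proof. by case: n. Qed.
Lemma fps_sum I (r : seq I) (P : pred I) (f : I -> fps) n :
  (\sum_(i <- r | P i) f i) n = \sum_(i <- r | P i) f i n.
Proof. by elim/big_rec2: _ => // i u v _ <-. Qed.

Let fpsC_add : {morph fpsC : a b / a - b}.
Proof. by move=> a b; apply/funext => -[|n] //=; rewrite fpsD fpsN /= subr0. Qed.
HB.instance Definition _ := GRing.isZmodMorphism.Build F fps fpsC fpsC_add.
Lemma fpsCM c f n : (fpsC c * f) n = c * f n.
Proof.
by rewrite fpsM big_ord_recl subn0 big1 ?addr0 // => i _; rewrite mul0r.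
Qed.
Let fpsC_mul : monoid_morphism fpsC.
Proof. by split=> // a b; apply/funext => -[|n]; rewrite fpsCM //= mulr0. Qed.
HB.instance Definition _ := GRing.isMonoidMorphism.Build F fps fpsC fpsC_mul.

Definition fpsX : fps := fun n => (n == 1%N)%:R.
Lemma fpsXM f n : (fpsX * f) n = if n is n'.+1 then f n' else 0.
Proof.
rewrite fpsM; case: n => [|n]; first by rewrite big_ord1 mul0r.
rewrite 2!big_ord_recl /= mul0r add0r mul1r subn1 big1 ?addr0 //.
by move=> i _; rewrite mul0r.
Qed.

Definition fps_deriv f : fps := fun n => f n.+1 *+ n.+1.
Lemma fps_derivD f g : fps_deriv (f + g) = fps_deriv f + fps_deriv g.
Proof. by apply/funext => n; rewrite fpsD /fps_deriv -mulrnDl. Qed.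
Lemma fps_derivM f g : fps_deriv (f * g) = fps_deriv f * g + f * fps_deriv g.
Proof.
apply/funext => n; rewrite fpsD.
have tr u : forall i, (i < n.+2)%N -> (fps_trunc n.+2 u)`_i = u i by move=> i /fps_truncE.
have dtr u i : (i < n.+1)%N -> ((fps_trunc n.+2 u)^`())`_i = fps_deriv u i.
  by move=> ni; rewrite coef_deriv tr.
rewrite {1}/fps_deriv.
have -> : (f * g) n.+1 = (fps_trunc n.+2 f * fps_trunc n.+2 g)`_n.+1.
  by apply/esym/(@fps_mul_trunc n.+2) => //; exact: tr.
rewrite -coef_deriv derivM coefD; congr (_ + _).
  by apply: (@fps_mul_trunc n.+1) => // i; [exact: dtr|move=> ?; apply: tr; apply: ltnW].
by apply: (@fps_mul_trunc n.+1) => // i; [move=> ?; apply: tr; apply: ltnW|exact: dtr].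
Qed.

End Fps.

(** * Laurent coefficients and partial fractions *)

Section PF.
Variable F : fieldType.
Implicit Types (d : F) (k : seq nat) (ns ls rs : seq F).

(** The coefficient of t^i in the expansion of (d + t)^-x. *)
Definition inv_pow_coef x i d : F := (-1) ^+ i * 'C((x + i).-1, i)%:R / d ^+ (x + i).

Lemma inv_pow_coef0 x d : inv_pow_coef x 0 d = d ^- x.
Proof. by rewrite /inv_pow_coef expr0 bin0 addn0 !mul1r. Qed.
Lemma inv_pow_coef0S i d : inv_pow_coef 0 i.+1 d = 0.
Proof. by rewrite /inv_pow_coef add0n bin_small // mulr0 mul0r. Qed.
(** Coefficient i + 1 of the identity (d + t) * (d + t)^-(x+1) = (d + t)^-x. *)
Lemma inv_pow_coefSS x i d : d != 0 ->
  inv_pow_coef x.+1 i.+1 d = d^-1 * (inv_pow_coef x i.+1 d - inv_pow_coef x.+1 i d).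
Proof.
move=> d0; have e0 : d ^+ (x + i) != 0 by rewrite expf_neq0.
rewrite /inv_pow_coef !addSn !addnS /= binS natrD !exprS.
by field; rewrite d0 e0.
Qed.
Lemma inv_pow_coefS0 x d : d != 0 -> inv_pow_coef x.+1 0 d = d^-1 * inv_pow_coef x 0 d.
Proof. by move=> d0; rewrite !inv_pow_coef0 exprS invfM. Qed.

(** The expansion of 1 / (d + t) in powers of t. *)
Definition inv_series d : fps F := fun i => (-1) ^+ i * d ^- i.+1.

Lemma inv_seriesE d : d != 0 -> (fpsC d + fpsX F) * inv_series d = 1.
Proof.
move=> d0; apply/funext => n; rewrite mulrDl fpsD fpsCM fpsXM fps1.
case: n => [|n]; rewrite /inv_series; first by rewrite addr0 mul1r expr1 divff.
have e0 : d ^+ n != 0 by rewrite expf_neq0.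
by rewrite !exprS /=; field; rewrite d0 e0.
Qed.

Lemma inv_series_shift n0 ns : n0 \notin ns ->
  {in ns, forall n, (fpsC n + (fpsX F - fpsC n0)) * inv_series (n - n0) = 1}.
Proof.
move=> n0ns n nns; have -> : fpsC n + (fpsX F - fpsC n0) = fpsC (n - n0) + fpsX F.
  by rewrite raddfB addrA addrAC.
by rewrite inv_seriesE // subr_eq0; apply: contraNneq n0ns => <-.
Qed.

Lemma inv_seriesX d x i : d != 0 -> (inv_series d ^+ x) i = inv_pow_coef x i d.
Proof.
move=> d0; suff -> : inv_series d ^+ x = (fun i => inv_pow_coef x i d) :> fps F by [].
elim: x => [|x IH].
  by rewrite expr0; apply/funext => -[|n]; rewrite fps1 ?inv_pow_coef0 ?inv_pow_coef0S ?expr0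
      ?invr1.
rewrite exprS IH.
have -> : (fun i => inv_pow_coef x i d) = (fpsC d + fpsX F) * (fun i => inv_pow_coef x.+1 i d)
    :> fps F.
  apply/funext => n; rewrite mulrDl fpsD fpsCM fpsXM; case: n => [|n].
    by rewrite inv_pow_coefS0 // mulVKf // addr0.
  by rewrite inv_pow_coefSS // mulVKf // subrK.
by rewrite mulrCA mulrA inv_seriesE // mul1r.
Qed.

(** The part at the pole t = 0 of 1 / (t^(q+1) (t + d)^(x+1)), with b for 1 / t, obeys
    the recurrence coming from 1 / (t (t + d)) = (1 / t - 1 / (t + d)) / d. *)
Lemma polar_rec (A : comNzRingType) (phi : {rmorphism F -> A}) (b : A) d x q :
  d != 0 ->
  \sum_(i < q.+1) phi (inv_pow_coef x.+1 i d) * b ^+ (q.+1 - i) =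
  phi d^-1 * (\sum_(i < q.+1) phi (inv_pow_coef x i d) * b ^+ (q.+1 - i)
              - \sum_(i < q) phi (inv_pow_coef x.+1 i d) * b ^+ (q - i)).
Proof.
move=> d0; rewrite big_ord_recl [in RHS]big_ord_recl -addrA -sumrB mulrDr.
rewrite inv_pow_coefS0 // rmorphM mulrA mulr_sumr.
congr (_ + _); apply: eq_bigr => i _.
by rewrite lift0 inv_pow_coefSS // rmorphM rmorphB subSS; ring.
Qed.

(** Expansion of 1 / ((t + d)^x t^q) at its two poles, with b for t and a for t + d.
    Induction on x + q from 1 / (a b) = (1/b - 1/a) / d. Only inverses of a and b are
    asked for, so that the identity also holds in rings of power series. *)
Lemma two_point (A : comNzRingType) (phi : {rmorphism F -> A}) (a a' b b' : A) d x q :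
  a * a' = 1 -> b * b' = 1 -> a = b + phi d -> d != 0 -> (0 < x + q)%N ->
  a' ^+ x * b' ^+ q =
    \sum_(i < q) phi (inv_pow_coef x i d) * b' ^+ (q - i) +
    \sum_(i < x) phi (inv_pow_coef q i (- d)) * a' ^+ (x - i).
Proof.
move=> aa bb ab d0.
have ab' : a' * b' = phi d^-1 * (b' - a').
  have -> : b' - a' = b' * (a * a') - a' * (b * b') by rewrite aa bb !mulr1.
  have -> : b' * (a * a') - a' * (b * b') = phi d * (a' * b') by rewrite ab; ring.
  by rewrite mulrA -rmorphM mulVf // rmorph1 mul1r.
move: {2}(x + q)%N (leqnn (x + q)) => n; elim: n x q => [|n IH] x q; first by case: (x + q)%N.
case: x => [|x].
  case: q => // q _ _; rewrite big_ord0 addr0 mul1r big_ord_recl inv_pow_coef0 expr0 invr1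
      rmorph1 mul1r subn0.
  by rewrite big1 ?addr0 // => i _; rewrite inv_pow_coef0S rmorph0 mul0r.
case: q => [|q] le _.
  rewrite big_ord0 add0r mulr1 big_ord_recl inv_pow_coef0 expr0 invr1 rmorph1 mul1r subn0.
  by rewrite big1 ?addr0 // => i _; rewrite inv_pow_coef0S rmorph0 mul0r.
have -> : a' ^+ x.+1 * b' ^+ q.+1 = phi d^-1 * (a' ^+ x * b' ^+ q.+1 - a' ^+ x.+1 * b' ^+ q).
  rewrite !exprSr; have -> : a' ^+ x * a' * (b' ^+ q * b') = a' ^+ x * b' ^+ q * (a' * b') by ring.
  by rewrite ab'; ring.
rewrite !IH; try lia.
rewrite !polar_rec ?oppr_eq0 // invrN rmorphN.
by ring.
Qed.

(** The Laurent coefficient of order -q at s = -n of the quasi-symmetric sum in the 1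
    / (m + s), where ls and rs list the m - n for the points m on the left and on the
    right of n. The pole comes from the factor j whose point is n, and the other
    factors are expanded at n. *)
Definition laurent q k ls rs : F :=
  \sum_(j < size k | (q <= nth 0%N k j)%N)
    (qsym (map inv_series ls) (take j k) * qsym (map inv_series rs) (drop j.+1 k)) (nth 0%N k j
        - q)%N.

Lemma laurent_nil q ls rs : laurent q [::] ls rs = 0.
Proof. by rewrite /laurent big_ord0. Qed.

Lemma laurent_nil_left q x k rs : laurent q (x :: k) [::] rs =
  if (q <= x)%N then qsym (map inv_series rs) k (x - q)%N else 0.
Proof.
rewrite /laurent big_mkcond big_ord_recl /= drop0 mul1r big1 ?addr0 // => i _.
by rewrite mul0r if_same.
Qed.

(** A new leftmost point is either left out or takes the first exponent x. In the
    second case its factor has the Taylor coefficients inv_pow_coef x p d at n, which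
    lower the order of the pole by p. *)
Lemma laurent_cons K q x k d ls rs : d != 0 -> (0 < q)%N -> all (leq^~ K) k ->
  laurent q (x :: k) (d :: ls) rs =
  laurent q (x :: k) ls rs + \sum_(p < K) inv_pow_coef x p d * laurent (q + p) k ls rs.
Proof.
move=> d0 q0 kK; rewrite /laurent big_mkcond big_ord_recl /=.
rewrite [in RHS]big_mkcond big_ord_recl /= -addrA ?qsym_nil; congr (_ + _).
under [X in _ = _ + X]eq_bigr => p _ do rewrite big_mkcond mulr_sumr.
rewrite [X in _ = _ + X]exchange_big -big_split /=; apply: eq_bigr => j _;
    rewrite /bump /= add1n /=.
have kj : (nth 0 k j <= K)%N by move/all_nthP: kK => /(_ 0%N j (ltn_ord j)).
set m := nth _ _ _ in kj *; case: ifP => [qm|qm]; last first.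
  by rewrite big1 ?addr0 // => p _; rewrite ifF ?mulr0 //; apply/negP; lia.
rewrite mulrDl fpsD; congr (_ + _).
rewrite -mulrA fpsM.
rewrite (big_ord_widen_cond K (fun=> true) (fun i => (inv_series d ^+ x) i * _ (m - q - i)%N));
    last by lia.
rewrite big_mkcond; apply: eq_bigr => p _; rewrite inv_seriesX //.
have -> : (p < (m - q).+1)%N = (q + p <= m)%N by lia.
by rewrite /= add0n subnDA; case: ifP; rewrite ?mulr0.
Qed.

Lemma laurent_rev q k ls rs : laurent q (rev k) (rev rs) (rev ls) = laurent q k ls rs.
Proof.
rewrite /laurent size_rev (reindex_inj rev_ord_inj) /=; apply: eq_big => [j|j _].
  by rewrite nth_rev ?subnSK // ?subKn //; [case: j => j /= jk; lia|lia].
rewrite nth_rev; last by case: j => j /= jk; lia.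
have -> : (size k - (size k - j.+1).+1 = j)%N by case: j => j /= jk; lia.
rewrite !map_rev take_rev drop_rev !qsym_rev mulrC.
have -> : (size k - (size k - j.+1) = j.+1)%N by case: j => j /= jk; lia.
have -> : (size k - (size k - j.+1).+1 = j)%N by case: j => j /= jk; lia.
by [].
Qed.

(** The point is given by its position, since the order of the points decides which of
    them precede it. *)
Definition laurent_at q k ns i : F :=
  laurent q k [seq m - nth 0 ns i | m <- take i ns] [seq m - nth 0 ns i | m <- drop i.+1 ns].

Lemma laurent_at0 q x k n ns : laurent_at q (x :: k) (n :: ns) 0 =
  if (q <= x)%N then qsym [seq inv_series (m - n) | m <- ns] k (x - q)%N else 0.
Proof. by rewrite /laurent_at /= laurent_nil_left drop0 -map_comp. Qed.

Lemma laurent_atS K q x k n ns i : uniq (n :: ns) -> (0 < q)%N -> all (leq^~ K) k ->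
    (i < size ns)%N ->
  laurent_at q (x :: k) (n :: ns) i.+1 =
  laurent_at q (x :: k) ns i + \sum_(p < K) inv_pow_coef x p (n - nth 0 ns i) * laurent_at (q +
      p) k ns i.
Proof.
move=> /= /andP[nns _] q0 kK ins; rewrite /laurent_at /= (@laurent_cons K) //.
by rewrite subr_eq0; apply: contraNneq nns => ->; apply: mem_nth.
Qed.

Lemma laurent_at_large K q k ns i : (K < q)%N -> all (leq^~ K) k -> laurent_at q k ns i = 0.
Proof.
move=> Kq kK; rewrite /laurent_at /laurent big1 // => j.
have kj : (nth 0 k j <= K)%N by move/all_nthP: kK => /(_ 0%N j (ltn_ord j)).
lia.
Qed.

(** Reindexing by (q - p, p); the pairs that leave the square carry zero. *)
Lemma sum_by_order (A : zmodType) K (G : nat -> nat -> A) :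
  (forall q p, (K <= q + p)%N -> G q p = 0) ->
  \sum_(q < K) \sum_(p < q.+1) G (q - p)%N p = \sum_(q < K) \sum_(p < K) G q p.
Proof.
move=> G0.
transitivity (\sum_(q < K) \sum_(p < K) if (p <= q)%N then G (q - p)%N p else 0).
  apply: eq_bigr => q _; rewrite -big_mkcond /=.
  rewrite (big_ord_widen_cond K (fun=> true) (fun p => G (q - p)%N p)) //.
rewrite exchange_big [RHS]exchange_big /=; apply: eq_bigr => p _.
have pK := ltn_ord p; rewrite -big_mkcond /=.
have -> : \sum_(q < K) G q p = \sum_(0 <= q < K - p) G q p.
  rewrite -(big_mkord xpredT (fun q => G q p)) (@big_cat_nat _ _ _ (K - p)) //=; last by lia.
  rewrite [X in _ + X]big_nat_cond [X in _ + X]big1 ?addr0 // => i.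
  by rewrite andbT => ?; apply: G0; lia.
rewrite -(big_mkord (fun q => p <= q)%N (fun q => G (q - p)%N p)).
rewrite (@big_cat_nat _ _ _ p) //=; last exact: ltnW.
rewrite [X in X + _]big_nat_cond [X in X + _]big1 ?add0r => [|i]; last by lia.
rewrite -{1}[nat_of_ord p]add0n big_addn; apply: congr_big_nat => // i ?; first by lia.
by rewrite addnK.
Qed.

(** Induction on the points. Multiplying the expansion for the other points by the
    factor of the first point n0, [two_point] separates each product. The coefficients
    produced at n0 are identified with those of [laurent_at] through the induction
    hypothesis at s = X - n0 in the ring of power series in X, which is the reason for
    stating the expansion over an arbitrary ring A. *)
Lemma partial_fractions K k ns : uniq ns -> all (fun e => 0 < e <= K)%N k ->
  forall (A : comNzRingType) (phi : {rmorphism F -> A}) (s : A) (iv : F -> A),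
  {in ns, forall n, (phi n + s) * iv n = 1} ->
  qsym (map iv ns) k = (k == [::])%:R +
    \sum_(i < size ns) \sum_(q < K) phi (laurent_at q.+1 k ns i) * iv (nth 0 ns i) ^+ q.+1.
Proof.
elim: ns k => [|n0 ns IH] [|x k] uns kK A phi s iv ivP.
- by rewrite big_ord0 addr0.
- by rewrite big_ord0 addr0.
- by rewrite qsym_nil big1 ?addr0 // => i _; rewrite big1 // => q _;
    rewrite /laurent_at laurent_nil rmorph0 mul0r.
have /andP[n0ns uns'] := uns.
have /andP[/andP[x0 xK] kK'] := kK.
have kK'' : all (leq^~ K) k by apply: sub_all kK' => e /andP[].
have ivP' : {in ns, forall n, (phi n + s) * iv n = 1}.
  by move=> n nns; apply: ivP; rewrite inE nns orbT.
rewrite map_cons qsym_cons (IH _ uns' kK _ _ _ _ ivP') (IH _ uns' kK' _ _ _ _ ivP').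
have nn0 (i : 'I_(size ns)) : n0 - nth 0 ns i != 0.
  by rewrite subr_eq0; apply: contraNneq n0ns => ->; apply: mem_nth.
rewrite !add0r big_ord_recl /=.
under [X in _ = _ + X]eq_bigr => i _.
  under eq_bigr => q _.
    rewrite (laurent_atS _ uns _ kK'') // rmorphD mulrDl.
  over.
  rewrite big_split /=.
over.
rewrite big_split /= [RHS]addrCA; congr (_ + _).
set v0 := iv n0.
pose d (i : 'I_(size ns)) := n0 - nth 0 ns i.
have d0 i : d i != 0 by exact: nn0.
have prodE (i : 'I_(size ns)) :
  v0 ^+ x * \sum_(q < K) phi (laurent_at q.+1 k ns i) * iv (nth 0 ns i) ^+ q.+1 =
  \sum_(q < K) phi (\sum_(p < K) inv_pow_coef x p (d i) * laurent_at (q.+1 + p) k ns i)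
      * iv (nth 0 ns i) ^+ q.+1 +
  \sum_(p < x) phi (\sum_(q < K) laurent_at q.+1 k ns i * inv_pow_coef q.+1 p (- d i)) * v0 ^+
      (x - p).
  transitivity (\sum_(q < K) (phi (laurent_at q.+1 k ns i) *
     (\sum_(p < q.+1) phi (inv_pow_coef x p (d i)) * iv (nth 0 ns i) ^+ (q.+1 - p) +
      \sum_(p < x) phi (inv_pow_coef q.+1 p (- d i)) * v0 ^+ (x - p)))).
    rewrite mulr_sumr; apply: eq_bigr => q _; rewrite mulrCA; congr (_ * _).
    apply: (@two_point A phi (phi n0 + s) v0 (phi (nth 0 ns i) + s)) => //.
    - by apply: ivP; rewrite inE eqxx.
    - by apply: ivP'; apply: mem_nth.
    - by rewrite rmorphB; ring.
    - by lia.
  under eq_bigr => q _ do rewrite mulrDr !mulr_sumr.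
  rewrite big_split /=; congr (_ + _); last first.
    rewrite exchange_big; apply: eq_bigr => p _; rewrite rmorph_sum mulr_suml.
    by apply: eq_bigr => q _; rewrite rmorphM mulrA.
  transitivity (\sum_(q < K) \sum_(p < K) phi (inv_pow_coef x p (d i) * laurent_at (q.+1 +
      p) k ns i)
      * iv (nth 0 ns i) ^+ q.+1); last first.
    by apply: eq_bigr => q _; rewrite rmorph_sum mulr_suml.
  rewrite -(@sum_by_order _ K (fun q p => phi (inv_pow_coef x p (d i) * laurent_at (q.+1 +
      p) k ns i) * iv (nth 0 ns i) ^+ q.+1)).
    apply: eq_bigr => q _; apply: eq_bigr => p _; have pq : (p <= q)%N by rewrite -ltnS.
    rewrite rmorphM -(subSn pq) (subnK (leqW pq)).
    by rewrite mulrCA mulrA.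
  by move=> q p Kqp; rewrite (@laurent_at_large K) // ?mulr0 ?rmorph0 ?mul0r //; rewrite addSn ltnS.
(* The poles at the old points are as claimed; there remains the polar part at n0. *)
rewrite mulrDr mulr_sumr; under [X in _ + X = _]eq_bigr => i _ do rewrite prodE.
rewrite big_split /= addrCA [RHS]addrC; congr (_ + _).
(* The expansion of the other factors at n0, computed from their own partial fractions. *)
have coefE p : (qsym [seq inv_series (m - n0) | m <- ns] k) p =
    ((k == [::]) && (p == 0%N))%:R +
    \sum_(i < size ns) \sum_(q < K) laurent_at q.+1 k ns i * inv_pow_coef q.+1 p (- d i).
  rewrite (IH _ uns' kK' (fps F) (@fpsC F) _ _ (inv_series_shift n0ns)) fpsD; congr (_ + _).
    by case: (k == [::]); [rewrite mulr1n fps1|rewrite mulr0n fps0].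
  rewrite fps_sum; apply: eq_bigr => i _; rewrite fps_sum; apply: eq_bigr => q _.
  rewrite fpsCM inv_seriesX; last by rewrite subr_eq0 eq_sym -subr_eq0; apply: nn0.
  by rewrite -[nth 0 ns i - n0]opprB.
have -> : \sum_(q < K) phi (laurent_at q.+1 (x :: k) (n0 :: ns) 0) * v0 ^+ q.+1 =
  \sum_(p < x) phi (qsym [seq inv_series (m - n0) | m <- ns] k p) * v0 ^+ (x - p).
  transitivity (\sum_(q < x) phi (qsym [seq inv_series (m - n0) | m <- ns] k (x - q.+1)%N) * v0
      ^+ q.+1).
    rewrite [RHS](big_ord_widen_cond K (fun=> true) (fun q => phi (qsym [seq inv_series (m -
        n0) | m <- ns] k (x - q.+1)%N) * v0 ^+ q.+1)) //=.
    rewrite big_mkcond [RHS]big_mkcond; apply: eq_bigr => q _.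
    by rewrite laurent_at0 /=; case: ifP => _; rewrite ?rmorph0 ?mul0r.
  rewrite (reindex_inj rev_ord_inj); apply: eq_bigr => p _ /=.
  by have px := ltn_ord p; rewrite subnSK // subKn // ltnW.
transitivity (v0 ^+ x * (k == [::])%:R + \sum_(p < x) phi
    (\sum_(i < size ns) \sum_(q < K) laurent_at q.+1 k ns i * inv_pow_coef q.+1 p (- d i)) * v0
        ^+ (x - p)).
  congr (_ + _); rewrite exchange_big; apply: eq_bigr => p _.
  by rewrite rmorph_sum mulr_suml.
have -> : v0 ^+ x * (k == [::])%:R =
    \sum_(p < x) phi ((k == [::]) && (p == 0 :> nat))%:R * v0 ^+ (x - p).
  case: x x0 {xK uns kK coefE prodE} => // x _.
  rewrite big_ord_recl subn0 andbT rmorph_nat mulrC big1 ?addr0 // => i _.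
  by rewrite /= andbF rmorph0 mul0r.
rewrite -big_split /=; apply: eq_bigr => p _.
by rewrite coefE rmorphD mulrDl.
Qed.

(** The residues of 1 / ((t + d)^x t^q) cancel, as this function is O(t^-2) at
    infinity. *)
Lemma inv_pow_coef_residue x q d : (0 < x)%N -> (0 < q)%N ->
  inv_pow_coef x q.-1 d + inv_pow_coef q x.-1 (- d) = 0.
Proof.
case: x => // x; case: q => // q _ _; rewrite /inv_pow_coef !addSn /= [(x + q)%N]addnC.
have -> : 'C(q + x, x) = 'C(q + x, q) by rewrite -bin_sub ?leq_addl // addnK.
rewrite -!exprVn invrN (exprNn d^-1); set u := d^-1 ^+ _; set b := _%:R.
have -> : (-1) ^+ x * b * ((-1) ^+ (q + x).+1 * u) = - ((-1) ^+ q * b * u) * ((-1) ^+ (x + x)).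
  by rewrite exprS !exprD; ring.
by rewrite addnn -mul2n exprM sqrrN !expr1n mulr1 addrN.
Qed.

(** For k of weight at least 2 the quasi-symmetric sum is O(s^-2) at infinity, whence
    the vanishing. In the induction the residue at the new point n0 is read off from
    the partial fractions of the other points, and cancels against what n0 adds to
    their residues. *)
Lemma residue_sum K k ns : uniq ns -> all (fun e => 0 < e <= K)%N k -> k != [:: 1%N] ->
  \sum_(i < size ns) laurent_at 1 k ns i = 0.
Proof.
case: k => [|x k].
  by move=> *; rewrite big1 // => i _; rewrite /laurent_at laurent_nil.
move=> uns kK xk1; elim: ns uns => [|n0 ns IH] uns; first by rewrite big_ord0.
have /andP[n0ns uns'] := uns.
have /andP[/andP[x0 xK] kK'] := kK.
have kK'' : all (leq^~ K) k by apply: sub_all kK' => e /andP[].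
pose d (i : 'I_(size ns)) := n0 - nth 0 ns i.
have nn0 (i : 'I_(size ns)) : d i != 0.
  by rewrite subr_eq0; apply: contraNneq n0ns => ->; apply: mem_nth.
rewrite big_ord_recl.
under [X in _ + X]eq_bigr => i _ do rewrite (laurent_atS _ uns _ kK'') //.
rewrite big_split /= IH // add0r laurent_at0 x0.
rewrite (partial_fractions (phi := @fpsC F) uns' kK' (inv_series_shift n0ns)) fpsD.
rewrite -addrA [X in X + _](_ : _ = 0) ?add0r; last first.
  case: (k =P [::]) xk1 => [-> |_ _]; last by rewrite mulr0n fps0.
  by rewrite mulr1n fps1; case: x {kK xK IH} x0 => [|[|x]].
rewrite fps_sum -big_split big1 // => i _; rewrite fps_sum -big_split big1 //= => q _.
rewrite fpsCM inv_seriesX; last by rewrite subr_eq0 eq_sym -subr_eq0; apply: nn0.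
rewrite add1n mulrC -mulrDl -opprB -/(d i) addrC subn1.
by rewrite (@inv_pow_coef_residue x q.+1) // mul0r.
Qed.

End PF.

(** * The stuffle product *)

Lemma stuffle_words_cons a b x y :
  stuffle_words (a :: x) (b :: y) =
    [seq a :: w | w <- stuffle_words x (b :: y)] ++
    [seq b :: w | w <- stuffle_words (a :: x) y] ++
    [seq (a + b)%N :: w | w <- stuffle_words x y].
Proof. by []. Qed.

Lemma stuffle_words_nilr x : stuffle_words x [::] = [:: x].
Proof. by case: x. Qed.

(** Two increasing choices of points merge into one; a point chosen by both receives
    the sum of the exponents. *)
Lemma qsym_stuffle (A : comNzRingType) (ys : seq A) x y :
  \sum_(w <- stuffle_words x y) qsym ys w = qsym ys x * qsym ys y.
Proof.
have nilE u v (zs : seq A) : u == [::] \/ v == [::] ->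
    \sum_(w <- stuffle_words u v) qsym zs w = qsym zs u * qsym zs v.
  by case=> /eqP ->; rewrite ?stuffle_words_nilr big_seq1 qsym_nil ?mul1r ?mulr1.
elim: ys x y => [|y0 ys IH] [|a x] [|b y]; try by apply: nilE; auto.
  by rewrite stuffle_words_cons !big_cat !big_map /= !big1_eq !mul0r !addr0.
have consE c s : \sum_(w <- s) qsym (y0 :: ys) (c :: w) =
    \sum_(w <- s) qsym ys (c :: w) + y0 ^+ c * \sum_(w <- s) qsym ys w.
  by rewrite mulr_sumr -big_split.
have := IH (a :: x) (b :: y); rewrite !qsym_cons !stuffle_words_cons !big_cat !big_map.
rewrite !consE !IH exprD mulrDl !mulrDr => <-.
move: (\sum_(i <- _) _) (\sum_(i <- _) _) (\sum_(i <- _) _) => u v w /=.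
by ring.
Qed.

Section FreegLin.
Variables (M : lmodType rat) (g : seq nat -> M).
HB.instance Definition _ := GRing.isZmodMorphism.Build H1 M (fglift g) (lift_is_additive g).
Lemma fgliftE u : fglift g u = \sum_(x <- dom u) coeff x u *: g x.
Proof.
rewrite -{1}[u]freeg_sumE raddf_sum; apply: eq_bigr => x _; exact: liftU.
Qed.
Lemma fgliftZ c u : fglift g (c *: u) = c *: fglift g u.
Proof.
rewrite -[u]freeg_sumE scaler_sumr !raddf_sum; apply: eq_bigr => x _ /=.
suff -> : c *: << coeff x u *g x >> = << c * coeff x u *g x >> :> H1.
  by rewrite !liftU scalerA.
by apply/eqP/freeg_eqP => y; rewrite coeffZ !coeffU mulrA.
Qed.
Lemma fglift1 x : fglift g << x >> = g x.
Proof. by rewrite liftU scale1r. Qed.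
End FreegLin.

Lemma freegZ (c : rat) (x : seq nat) : c *: << x >> = << c *g x >> :> H1.
Proof. by apply/eqP/freeg_eqP => y; rewrite coeffZ !coeffU mul1r. Qed.

Lemma freeg_span (u : H1) : u = \sum_(x <- dom u) coeff x u *: << x >>.
Proof. by rewrite -{1}[u]freeg_sumE; apply: eq_bigr => x _; rewrite freegZ. Qed.

(** Prefixing a letter, extended linearly: the recursion of the stuffle product
    becomes an identity between linear maps. *)
Definition lcons a : H1 -> H1 := fglift (fun w => << a :: w >>).
HB.instance Definition _ a := GRing.Additive.on (lcons a).
Lemma lconsZ a c u : lcons a (c *: u) = c *: lcons a u.
Proof. exact: fgliftZ. Qed.
Lemma lcons1 a x : lcons a << x >> = << a :: x >>.
Proof. exact: fglift1. Qed.

Definition word_stuffle x y : H1 := \sum_(w <- stuffle_words x y) << w >>.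

Lemma stuffle_lin f : stuffle f = fglift (fun y =>
  fglift (fun x => word_stuffle x y) f).
Proof.
apply/funext => v; rewrite /stuffle [LHS]fgliftE [RHS]fgliftE.
under eq_bigr => x _ do rewrite fgliftE scaler_sumr.
under [RHS]eq_bigr => x _ do rewrite fgliftE scaler_sumr.
rewrite exchange_big; apply: eq_bigr => y _; apply: eq_bigr => x _.
by rewrite !scalerA mulrC.
Qed.

Lemma stuffleDl u1 u2 v : stuffle (u1 + u2) v = stuffle u1 v + stuffle u2 v.
Proof. by rewrite /stuffle raddfD. Qed.
Lemma stuffleDr u v1 v2 : stuffle u (v1 + v2) = stuffle u v1 + stuffle u v2.
Proof. by rewrite stuffle_lin raddfD. Qed.
Lemma stuffleZl c u v : stuffle (c *: u) v = c *: stuffle u v.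
Proof. by rewrite /stuffle fgliftZ. Qed.
Lemma stuffleZr c u v : stuffle u (c *: v) = c *: stuffle u v.
Proof. by rewrite stuffle_lin fgliftZ. Qed.
Lemma stuffle_suml I (r : seq I) F v :
  stuffle (\sum_(i <- r) F i) v = \sum_(i <- r) stuffle (F i) v.
Proof. by rewrite /stuffle raddf_sum. Qed.
Lemma stuffle_sumr I (r : seq I) F u :
  stuffle u (\sum_(i <- r) F i) = \sum_(i <- r) stuffle u (F i).
Proof. by rewrite stuffle_lin raddf_sum. Qed.
Lemma stuffle1 x y : stuffle << x >> << y >> = word_stuffle x y.
Proof. by rewrite /stuffle !fglift1. Qed.
Lemma stuffle_nill v : stuffle << [::] >> v = v.
Proof.
rewrite [v]freeg_span stuffle_sumr; apply: eq_bigr => x _.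
by rewrite stuffleZr stuffle1 /word_stuffle big_seq1.
Qed.
Lemma stuffle_nilr u : stuffle u << [::] >> = u.
Proof.
rewrite [u]freeg_span stuffle_suml; apply: eq_bigr => x _.
by rewrite stuffleZl stuffle1 /word_stuffle stuffle_words_nilr big_seq1.
Qed.
Lemma word_stuffle_cons a b x y :
  word_stuffle (a :: x) (b :: y) =
  lcons a (word_stuffle x (b :: y)) + lcons b (word_stuffle (a :: x) y) + lcons (a +
      b)%N (word_stuffle x y).
Proof.
rewrite {1}/word_stuffle stuffle_words_cons !big_cat !big_map /= addrA.
by congr (_ + _ + _); rewrite /word_stuffle raddf_sum; apply: eq_bigr => w _; rewrite /= lcons1.
Qed.

Lemma stuffle_lcons a b u v : stuffle (lcons a u) (lcons b v) =
  lcons a (stuffle u (lcons b v)) + lcons b (stuffle (lcons a u) v) +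
  lcons (a + b)%N (stuffle u v).
Proof.
rewrite [u]freeg_span !(raddf_sum, stuffle_suml) -!big_split; apply: eq_bigr => x _.
rewrite /= !(lconsZ, stuffleZl) -!scalerDr; congr (_ *: _).
rewrite [v]freeg_span !(raddf_sum, stuffle_sumr) -!big_split; apply: eq_bigr => y _.
rewrite /= !(lconsZ, stuffleZr) -!scalerDr; congr (_ *: _).
by rewrite !lcons1 !stuffle1 word_stuffle_cons.
Qed.

(** Both ways of bracketing a triple product expand into the same seven terms, one for
    each way of consuming first letters, which is what makes associativity an
    induction. *)
Lemma stuffle3r a b c u v w (X := lcons a u) (Y := lcons b v) (Z := lcons c w) :
  stuffle X (stuffle Y Z) =
  lcons a (stuffle u (stuffle Y Z)) + lcons b (stuffle X (stuffle v Z)) +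
  lcons c (stuffle X (stuffle Y w)) + lcons (a + b)%N (stuffle u (stuffle v Z)) +
  lcons (a + c)%N (stuffle u (stuffle Y w)) + lcons (b + c)%N (stuffle X (stuffle v w)) +
  lcons (a + b + c)%N (stuffle u (stuffle v w)).
Proof.
rewrite [stuffle Y Z]stuffle_lcons -/Y -/Z !stuffleDr !stuffle_lcons -/X !raddfD /= addnA.
by apply/eqP/freeg_eqP => t; rewrite !coeffD; ring.
Qed.

Lemma stuffle3l a b c u v w (X := lcons a u) (Y := lcons b v) (Z := lcons c w) :
  stuffle (stuffle X Y) Z =
  lcons a (stuffle (stuffle u Y) Z) + lcons b (stuffle (stuffle X v) Z) +
  lcons c (stuffle (stuffle X Y) w) + lcons (a + b)%N (stuffle (stuffle u v) Z) +
  lcons (a + c)%N (stuffle (stuffle u Y) w) + lcons (b + c)%N (stuffle (stuffle X v) w) +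
  lcons (a + b + c)%N (stuffle (stuffle u v) w).
Proof.
rewrite [stuffle X Y]stuffle_lcons -/X -/Y !stuffleDl !stuffle_lcons -/Z !raddfD /=.
by apply/eqP/freeg_eqP => t; rewrite !coeffD; ring.
Qed.

(** By linearity it suffices to treat three words; both sides then expand alike over
    shorter words. *)
Lemma stuffleA u v w : stuffle u (stuffle v w) = stuffle (stuffle u v) w.
Proof.
rewrite [u]freeg_span !stuffle_suml; apply: eq_bigr => x _.
rewrite !stuffleZl; congr (_ *: _).
rewrite [v]freeg_span !(stuffle_suml, stuffle_sumr); apply: eq_bigr => y _.
rewrite !(stuffleZl, stuffleZr); congr (_ *: _).
rewrite [w]freeg_span !stuffle_sumr; apply: eq_bigr => z _.
rewrite !stuffleZr; congr (_ *: _).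
elim: x y z => [|a x IHx]; first by move=> y z; rewrite !stuffle_nill.
elim=> [|b y IHy] z; first by rewrite stuffle_nill stuffle_nilr.
elim: z => [|c z IHz]; first by rewrite !stuffle_nilr.
rewrite -!lcons1 stuffle3r stuffle3l !lcons1.
by rewrite !IHx !IHy IHz.
Qed.

Lemma stuffle_exp_comm u l : stuffle (stuffle_exp u l) u = stuffle_exp u l.+1.
Proof.
elim: l => [|l IH]; first by rewrite /stuffle_exp /= stuffle_nill stuffle_nilr.
by rewrite {1}/stuffle_exp iterS -/(stuffle_exp u l) -stuffleA IH.
Qed.

(** * Existence and evaluation of stuffle decompositions *)

(** Counted from the front: the letter x adds to the count only if it is a 1 and all
    of w' consists of ones. *)
Fixpoint trailing_ones (w : seq nat) : nat :=
  match w with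
  | [::] => 0%N
  | x :: w' => if (x == 1%N) && (trailing_ones w' == size w') then (trailing_ones w').+1 else
      trailing_ones w'
  end.

Lemma trailing_ones_le w : (trailing_ones w <= size w)%N.
Proof. by elim: w => //= x w IH; case: ifP => _ //; apply: leqW. Qed.

Lemma trailing_ones_rcons1 w : trailing_ones (rcons w 1%N) = (trailing_ones w).+1.
Proof.
by elim: w => //= x w IH; rewrite IH size_rcons eqSS; case: ifP.
Qed.

Lemma trailing_ones_rcons w x : x != 1%N -> trailing_ones (rcons w x) = 0%N.
Proof.
move=> x1; elim: w => [|y w IH] /=; first by rewrite (negbTE x1).
by rewrite IH size_rcons andbF.
Qed.

Lemma trailing_ones_full w : trailing_ones w = size w -> w = nseq (size w) 1%N.
Proof.
elim: w => //= x w IH; case: ifP => [/andP[/eqP-> /eqP e] _|_ e]; first by rewrite -IH.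
by have := trailing_ones_le w; rewrite e ltnn.
Qed.

Lemma trailing_ones0_admissible w : is_index w -> trailing_ones w = 0%N -> admissible w.
Proof.
rewrite /admissible => iw; rewrite iw /=; case/lastP: w iw => // w x iw t0.
rewrite last_rcons orbC; apply/orP; left.
have : (0 < x)%N by move: iw; rewrite /is_index all_rcons => /andP[].
by case: x t0 {iw} => [|[|x]] //; rewrite trailing_ones_rcons1.
Qed.

(** Inserting a 1 into w produces w followed by 1 once for each place inside the final
    block of ones. Every other word is no longer than that one and does not end in
    more ones than w. *)
Lemma stuffle_one w : is_index w -> exists others : seq (seq nat),
  stuffle << w >> << [:: 1%N] >> = (trailing_ones w).+1%:R *: << rcons w 1%N >> +
      \sum_(v <- others) << v >> :> H1
  /\ all (fun v => [&& is_index v, size v <= (size w).+1, size w <= size v & trailing_ones v <=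
      trailing_ones w])%N others.
Proof.
elim: w => [|x w IH] iw.
  by exists [::]; rewrite stuffle_nill big_nil addr0 /= scale1r.
have /andP[x0 iw'] := iw.
have [oth [IHe IHa]] := IH iw'.
have e1 : stuffle << x :: w >> << [:: 1%N] >> =
   (trailing_ones w).+1%:R *: << rcons (x :: w) 1%N >> + \sum_(v <- [seq x :: v | v <- oth]) <<
       v >> +
   << 1%N :: x :: w >> + << x.+1 :: w >> :> H1.
  have -> : << x :: w >> = lcons x << w >> by rewrite lcons1.
  have -> : << [:: 1%N] >> = lcons 1 << [::] >> by rewrite lcons1.
  rewrite stuffle_lcons !lcons1 IHe !stuffle_nilr raddfD /= lconsZ !lcons1 addn1.
  congr (_ + _ + _ + _); rewrite raddf_sum big_map; apply: eq_bigr => v _.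
  by rewrite /= lcons1.
have ttw := trailing_ones_le w.
have a2 : [&& is_index (x.+1 :: w), size (x.+1 :: w) <= (size (x :: w)).+1,
    size (x :: w) <= size (x.+1 :: w) & trailing_ones (x.+1 :: w) <= trailing_ones (x :: w)]%N.
  by rewrite [is_index _]iw' /= leqnSn leqnn eqSS (gtn_eqF x0) /=; case: ifP.
have [/andP[/eqP x1 /eqP tw]|xw] := boolP ((x == 1%N) && (trailing_ones w == size w)).
  have rc : rcons (x :: w) 1%N = 1%N :: x :: w.
    by rewrite x1 (trailing_ones_full tw); elim: (size w) => //= n [->].
  have trw : trailing_ones (x :: w) = (trailing_ones w).+1 by rewrite /= x1 tw !eqxx.
  exists ((x.+1 :: w) :: [seq x :: v | v <- oth]); split.
    rewrite e1 rc trw big_cons -[(trailing_ones w).+2]addn1 natrD scalerDl scale1r.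
    by apply/eqP/freeg_eqP => t; rewrite !coeffD; ring.
  apply/allP => v'; rewrite inE => /orP[/eqP->|/mapP[v /(allP IHa)/and4P[iv s1 s2 tv] ->]] //.
  rewrite trw.
  have -> : is_index (x :: v) by apply/andP; split; [exact: x0|exact: iv].
  rewrite /= !ltnS s1 s2 /=.
  by case: ifP => _; [rewrite ltnS|apply: leqW].
exists ((1%N :: x :: w) :: (x.+1 :: w) :: [seq x :: v | v <- oth]); split.
  rewrite e1 !big_cons /= (negbTE xw).
  by apply/eqP/freeg_eqP => t; rewrite !coeffD; ring.
have trw : trailing_ones (x :: w) = trailing_ones w by rewrite /= (negbTE xw).
have ht1 : trailing_ones [:: 1%N, x & w] = trailing_ones (x :: w).
  have := trw; rewrite /= => ->; rewrite ifF //; apply/negP => /eqP h.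
  by move: ttw; rewrite h ltnn.
apply/allP => v'; rewrite !inE => /or3P[/eqP->|/eqP->|/mapP[v /(allP IHa)/and4P[iv s1 s2 tv]
    ->]] //.
  by rewrite ht1 leqnn [is_index _]iw /= leqnn leqnSn.
rewrite trw.
have -> : is_index (x :: v) by apply/andP; split; [exact: x0|exact: iv].
rewrite /= !ltnS s1 s2 /=; case: ifP => // /andP[/eqP x1 /eqP tvs].
(* Impossible: v, at least as long as w, would be all ones with no more trailing ones than w. *)
by move: xw; rewrite x1 /=; lia.
Qed.

(** Stuffle polynomials in (1) of degree at most n with admissible coefficients. *)
Definition decomposable n (x : H1) : Prop := exists u : nat -> H1,
  (forall l, in_H0 (u l)) /\
  x = \sum_(l < n.+1) stuffle (u l) (stuffle_exp << [:: 1%N] >> l).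

Lemma in_H0_0 : in_H0 0.
Proof. by rewrite /in_H0 dom0. Qed.
Lemma in_H0_D u v : in_H0 u -> in_H0 v -> in_H0 (u + v).
Proof.
move=> /allP hu /allP hv; apply/allP => x /domD_subset.
by rewrite mem_cat => /orP[/hu|/hv].
Qed.
Lemma in_H0_Z c u : in_H0 u -> in_H0 (c *: u).
Proof. by move=> /allP hu; apply/allP => x /domZ_subset /hu. Qed.
Lemma stuffle0l v : stuffle 0 v = 0.
Proof. by rewrite /stuffle raddf0. Qed.
Lemma decomposable0 n : decomposable n 0.
Proof.
exists (fun=> 0); split; first by move=> _; apply: in_H0_0.
by rewrite big1 // => l _; rewrite stuffle0l.
Qed.
Lemma decomposableD n x y : decomposable n x -> decomposable n y -> decomposable n (x + y).
Proof.
move=> [u [hu ->]] [v [hv ->]]; exists (fun l => u l + v l); split.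
  by move=> l; apply: in_H0_D.
by rewrite -big_split; apply: eq_bigr => l _; rewrite stuffleDl.
Qed.
Lemma decomposableZ n c x : decomposable n x -> decomposable n (c *: x).
Proof.
move=> [u [hu ->]]; exists (fun l => c *: u l); split.
  by move=> l; apply: in_H0_Z.
by rewrite scaler_sumr; apply: eq_bigr => l _; rewrite stuffleZl.
Qed.
Lemma decomposable_sum n (s : seq (seq nat)) : (forall v, v \in s -> decomposable n << v >>) ->
  decomposable n (\sum_(v <- s) << v >>).
Proof.
elim: s => [|v s IH] h; first by rewrite big_nil; apply: decomposable0.
rewrite big_cons; apply: decomposableD; first by apply: h; rewrite mem_head.
by apply: IH => w ws; apply: h; rewrite inE ws orbT.
Qed.
Lemma decomposable_leq m n x : (m <= n)%N -> decomposable m x -> decomposable n x.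
Proof.
move=> mn [u [hu ->]]; exists (fun l => if (l <= m)%N then u l else 0); split.
  by move=> l; case: ifP => _; [apply: hu|apply: in_H0_0].
rewrite (big_ord_widen n.+1 (fun l => stuffle (u l) (stuffle_exp << [:: 1%N] >> l))) //.
rewrite big_mkcond; apply: eq_bigr => l _; rewrite ltnS; case: ifP => // _.
by rewrite stuffle0l.
Qed.
(** Multiplication by (1) raises the degree; this is where associativity and
    commutation of the powers of (1) enter. *)
Lemma decomposable_one n x : decomposable n x -> decomposable n.+1 (stuffle x << [:: 1%N] >>).
Proof.
move=> [u [hu ->]]; exists (fun l => if l is l'.+1 then u l' else 0); split.
  by case=> [|l] //; apply: in_H0_0.
rewrite [RHS]big_ord_recl /= stuffle0l add0r stuffle_suml.
by apply: eq_bigr => l _; rewrite -stuffleA stuffle_exp_comm.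
Qed.

(** Induction on the number q of trailing ones. If w ends in q ones, [stuffle_one]
    expresses w followed by 1 through w * (1) and words ending in at most q ones,
    after division by q + 1; this uses rational coefficients. *)
Lemma index_decomposable q k : is_index k -> (trailing_ones k <= q)%N ->
    decomposable (size k) << k >>.
Proof.
elim: q k => [|q IH] k ik tk.
  exists (fun l => if l is 0 then << k >> else 0); split.
    case=> [|l]; last exact: in_H0_0.
    by rewrite /in_H0 domU1 /= andbT trailing_ones0_admissible //; lia.
  rewrite big_ord_recl stuffle_nilr big1 ?addr0 // => l _.
  by rewrite stuffle0l.
have [tq|tq] := leqP (trailing_ones k) q; first exact: IH.
have {tk tq} tk : trailing_ones k = q.+1 by lia.
case/lastP: k ik tk => // k x ik.
have [-> |x1] := eqVneq x 1%N; last by rewrite trailing_ones_rcons.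
rewrite trailing_ones_rcons1 => -[tk].
have {}ik : is_index k by move: ik; rewrite /is_index all_rcons => /andP[].
have [oth [e a]] := stuffle_one ik.
have -> : << rcons k 1%N >> = (trailing_ones k).+1%:R^-1 *:
    (stuffle << k >> << [:: 1%N] >> - \sum_(v <- oth) << v >>) :> H1.
  by rewrite e addrK scalerA mulVf ?scale1r // pnatr_eq0.
rewrite size_rcons; apply: decomposableZ; apply: decomposableD.
  by apply: decomposable_one; apply: IH => //; rewrite tk.
rewrite -scaleN1r; apply: decomposableZ; apply: decomposable_sum => v voth.
have /and4P[iv s1 s2 tv] := allP a _ voth.
by apply: decomposable_leq s1 _; apply: IH => //; rewrite -tk.
Qed.

Lemma stuffle_decompP k : is_index k -> is_stuffle_decomp (stuffle_decomp k).
Proof.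
move=> ik; have [u [hu eu]] := index_decomposable ik (leqnn _).
rewrite /stuffle_decomp; case: xgetP => //= /(_ [ffun l => u (val l)]); case; split.
  by move=> l; rewrite ffunE.
by rewrite eu; apply: eq_bigr => l _; rewrite ffunE.
Qed.

Section Eval.
Variables (C : numFieldType) (f : seq nat -> C).
Definition eval_words (u : H1) : C := \sum_(a <- dom u) ratr (coeff a u) * f a.

Lemma eval_words_sub (D : seq (seq nat)) u : uniq D -> {subset dom u <= D} ->
  eval_words u = \sum_(a <- D) ratr (coeff a u) * f a.
Proof.
move=> uD sD; rewrite (bigID (mem (dom u))) /= [X in _ + X]big1 ?addr0; last first.
  by move=> a /coeff_outdom ->; rewrite rmorph0 mul0r.
rewrite -big_filter; apply: perm_big; apply: uniq_perm; rewrite ?uniq_dom ?filter_uniq //.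
by move=> a; rewrite mem_filter; apply/idP/andP => [h|[]//]; split => //; apply: sD.
Qed.

Lemma eval_wordsD u v : eval_words (u + v) = eval_words u + eval_words v.
Proof.
pose D := undup (dom u ++ dom v).
have uD : uniq D by exact: undup_uniq.
rewrite !(@eval_words_sub D) //.
- by rewrite -big_split; apply: eq_bigr => a _; rewrite coeffD rmorphD mulrDl.
- by move=> a; rewrite mem_undup mem_cat => ->; rewrite orbT.
- by move=> a; rewrite mem_undup mem_cat => ->.
- by move=> a /domD_subset; rewrite mem_undup.
Qed.
Lemma eval_wordsZ c u : eval_words (c *: u) = ratr c * eval_words u.
Proof.
rewrite (eval_words_sub (uniq_dom u) (@domZ_subset _ _ c u)) mulr_sumr.
by apply: eq_bigr => a _; rewrite coeffZ rmorphM mulrA.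
Qed.
Lemma eval_words0 : eval_words 0 = 0.
Proof. by rewrite -(scale0r 0) eval_wordsZ rmorph0 mul0r. Qed.
Lemma eval_words_sum I (r : seq I) F : eval_words (\sum_(i <- r) F i) =
    \sum_(i <- r) eval_words (F i).
Proof. by elim/big_rec2: _ => [|i x y _ <-]; rewrite ?eval_words0 ?eval_wordsD. Qed.
Lemma eval_words1 a : eval_words << a >> = f a.
Proof. by rewrite /eval_words domU1 big_seq1 coeffU eqxx !mul1r rmorph1 mul1r. Qed.

Hypothesis fM : forall x y, \sum_(w <- stuffle_words x y) f w = f x * f y.
(** A word function that respects stuffle on words is multiplicative. *)
Lemma eval_words_stuffle u v : eval_words (stuffle u v) = eval_words u * eval_words v.
Proof.
rewrite [u]freeg_span stuffle_suml !eval_words_sum mulr_suml; apply: eq_bigr => x _.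
rewrite stuffleZl !eval_wordsZ -[RHS]mulrA; congr (_ * _).
rewrite [v]freeg_span stuffle_sumr !eval_words_sum mulr_sumr; apply: eq_bigr => y _.
rewrite stuffleZr !eval_wordsZ [RHS]mulrCA; congr (_ * _).
by rewrite stuffle1 /word_stuffle eval_words_sum !eval_words1 -fM; apply: eq_bigr => w _;
    rewrite eval_words1.
Qed.

Hypothesis f1 : f [::] = 1.
Lemma eval_words_stuffle_exp u l : eval_words (stuffle_exp u l) = eval_words u ^+ l.
Proof.
elim: l => [|l IH]; first by rewrite /stuffle_exp /= eval_words1 expr0.
by rewrite /stuffle_exp iterS -/(stuffle_exp u l) eval_words_stuffle IH exprS.
Qed.

Lemma eval_words_decomp k : is_index k ->
  f k = \sum_(l < (size k).+1) eval_words (stuffle_decomp k l) * f [:: 1%N] ^+ l.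
Proof.
move=> /stuffle_decompP [_ /(congr1 eval_words)]; rewrite eval_words1 => ->.
rewrite eval_words_sum; apply: eq_bigr => l _.
by rewrite eval_words_stuffle eval_words_stuffle_exp eval_words1.
Qed.
End Eval.

(** * Truncated zeta values as quasi-symmetric sums *)

Lemma big_tupleS (R : nmodType) (T : finType) n (P : pred (n.+1.-tuple T)) (F : n.+1.-tuple T
    -> R) :
  \sum_(t | P t) F t = \sum_(x : T) \sum_(t | P (cons_tuple x t)) F (cons_tuple x t).
Proof.
rewrite pair_big_dep /= (reindex (fun p : T * n.-tuple T => cons_tuple p.1 p.2)) //=.
exists (fun t : n.+1.-tuple T => (thead t, [tuple of behead t])) => [[x t]|t] _ /=.
  by congr (_, _); apply: val_inj.
by rewrite [t in RHS]tuple_eta; apply: val_inj.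
Qed.

Lemma qsym_iota (A : comNzRingType) (f : nat -> A) m d x a :
  qsym [seq f n | n <- iota m d] (x :: a) =
  \sum_(m <= n < m + d) f n ^+ x * qsym [seq f j | j <- iota n.+1 (m + d - n.+1)] a.
Proof.
elim: d m => [|d IH] m; first by rewrite addn0 big_geq.
rewrite [iota _ _]/= map_cons qsym_cons IH [RHS]big_ltn; last by lia.
rewrite addrC addnS addSn; congr (_ * qsym [seq f j | j <- iota _ _] _ + _); lia.
Qed.

Section Tuples.
Variable C : numClosedFieldType.
Implicit Types (f : nat -> C) (s : C).

(** Both sides branch over the smallest index. *)
Lemma tuple_sum_qsym f N a m :
  \sum_(n : (size a).-tuple 'I_N | path ltn m (map val n))
    \prod_(i < size a) f (tnth n i) ^+ nth 0%N a i =
  qsym [seq f n | n <- iota m.+1 (N - m.+1)] a.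
Proof.
elim: a m => [|x a IH] m.
  rewrite qsym_nil /= (big_pred1 [tuple]) ?big_ord0 // => t.
  by rewrite tuple0.
rewrite big_tupleS qsym_iota.
transitivity (\sum_(n < N | (m < n)%N) f n ^+ x * qsym [seq f j | j <- iota n.+1 (N - n.+1)] a).
  rewrite [RHS]big_mkcond; apply: eq_bigr => n _.
  case: ifP => mn; last by rewrite big_pred0 // => t /=; rewrite mn.
  rewrite -IH mulr_sumr; apply: eq_big => [t|t _] /=; first by rewrite mn.
  rewrite big_ord_recl tnth0 /=; congr (_ * _); apply: eq_bigr => i _.
  by rewrite tnthS.
have [mN|Nm] := ltnP m.+1 N; last first.
  rewrite big_geq ?big_pred0 //; last by lia.
  by move=> i; have := ltn_ord i; lia.
rewrite subnKC 1?ltnW //.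
rewrite -(big_mkord (fun n => m < n)%N (fun n => f n ^+ x * qsym [seq f j | j <- iota n.+1 (N -
    n.+1)] a)).
rewrite (@big_cat_nat _ _ _ m.+1) //=; last by lia.
rewrite [X in X + _]big_nat_cond big_pred0 ?add0r; last by move=> i; lia.
by rewrite [LHS]big_nat_cond [RHS]big_nat_cond; apply: eq_bigl => i; lia.
Qed.

Definition zeta_pts s N : seq C := [seq (n%:R + s)^-1 | n <- iota 1 N.-1].

Lemma zeta_truncE a s N : zeta_trunc a s N = qsym (zeta_pts s N) a.
Proof.
rewrite /zeta_pts -subn1 -(tuple_sum_qsym (fun n => (n%:R + s)^-1)) /zeta_trunc.
by apply: eq_bigr => n _; apply: eq_bigr => i _; rewrite exprVn.
Qed.

(** The binomial coefficient with upper entry -x, which is also the Taylor coefficient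
    of (1 + t)^-x. *)
Definition neg_binom x i : C := (-1) ^+ i * 'C((x + i).-1, i)%:R.

Lemma gbinomN x i : gbinom (- x%:R : C) i = neg_binom x i.
Proof.
have e : \prod_(j < i) (- x%:R - j%:R) = (-1) ^+ i * 'C((x + i).-1, i)%:R * i`!%:R :> C.
  rewrite -mulrA -natrM bin_ffact.
  elim: i => [|i IH]; first by rewrite big_ord0 mul1r.
  rewrite big_ord_recr /= {}IH addnS /= exprSr.
  suff -> : ((x + i) ^_ i.+1 = ((x + i).-1 ^_ i) * (x + i))%N by rewrite natrM natrD; ring.
  by rewrite ffactnS mulnC.
by rewrite /gbinom e mulfK // pnatr_eq0 -lt0n fact_gt0.
Qed.

Lemma inv_pow_coefE x i (d : C) : inv_pow_coef x i d = neg_binom x i * d^-1 ^+ (x + i).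
Proof. by rewrite /inv_pow_coef exprVn. Qed.

(** The sum over lambda_1 + ... + lambda_r = m in [zeta_reg_coef], by recursion on the
    index and with an arbitrary function G of the shifted index in place of the
    regularized zeta value: the same sum expands truncated zeta values in powers of s. *)
Fixpoint taylor_coef m k (G : seq nat -> C) : C :=
  match k with
  | [::] => (m == 0%N)%:R * G [::]
  | x :: k' => \sum_(i < m.+1) neg_binom x i * taylor_coef (m - i)%N k' (fun w => G ((x +
      i)%N :: w))
  end.

Lemma eq_taylor_coef m k G G' : (forall w, size w = size k -> sumn w = (sumn k + m)%N ->
    is_index k -> is_index w -> G w = G' w) ->
  is_index k -> taylor_coef m k G = taylor_coef m k G'.
Proof.
elim: k m G G' => [|x k IH] m G G' e ik /=.
  by case: eqP => [m0|]; rewrite ?mul0r // e // m0.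
have /andP[x0 ik'] := ik; apply: eq_bigr => i _; congr (_ * _); apply: IH => // w sw tw _ iw.
have im : (i <= m)%N by rewrite -ltnS.
apply: e => //=; [by rewrite sw|by rewrite tw; lia|].
by rewrite iw andbT addn_gt0 x0.
Qed.

Lemma taylor_coefD m k G G' : taylor_coef m k (fun w => G w + G' w) = taylor_coef m k G +
    taylor_coef m k G'.
Proof.
elim: k m G G' => [|x k IH] m G G' /=; first by rewrite mulrDr.
by rewrite -big_split; apply: eq_bigr => i _; rewrite IH mulrDr.
Qed.
Lemma taylor_coefZ m k c G : taylor_coef m k (fun w => c * G w) = c * taylor_coef m k G.
Proof.
elim: k m G => [|x k IH] m G /=; first by rewrite mulrCA.
by rewrite mulr_sumr; apply: eq_bigr => i _; rewrite IH mulrCA.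
Qed.

Lemma taylor_coef0 m k : taylor_coef m k (fun=> 0) = 0.
Proof.
elim: k m => [|x k IH] m /=; first by rewrite mulr0.
by rewrite big1 // => i _; rewrite IH mulr0.
Qed.

(** Expanding each 1 / (d + t)^k_i by the binomial series. *)
Lemma qsym_inv_series_taylor_coef ds k m : (forall d, d \in ds -> d != 0) ->
  qsym [seq inv_series d | d <- ds] k m = taylor_coef m k (fun w => qsym [seq d^-1 | d <- ds] w).
Proof.
elim: ds k m => [|d ds IH] [|x k] m ds0.
- by rewrite /= mulr1 fps1.
- rewrite /= big1 // => i _.
  by rewrite taylor_coef0 mulr0.
- by rewrite /= mulr1 fps1.
have d0 : d != 0 by apply: ds0; rewrite mem_head.
have ds0' d' : d' \in ds -> d' != 0 by move=> h; apply: ds0; rewrite inE h orbT.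
rewrite map_cons qsym_cons fpsD IH // fpsM /= -big_split; apply: eq_bigr => i _ /=.
by rewrite taylor_coefD taylor_coefZ mulrDr inv_seriesX // inv_pow_coefE IH //;
    move: (neg_binom x i) => g; rewrite mulrA.
Qed.

(** The bound B on the entries of lambda is freed from m, so that the induction can
    lower m. *)
Lemma zeta_reg_coef_gen (G : seq nat -> C) B m k : (m <= B)%N ->
  \sum_(lam : (size k).-tuple 'I_B.+1 | (\sum_(i < size k) tnth lam i)%N == m)
    (\prod_(i < size k) gbinom (- (nth 0%N k i)%:R) (tnth lam i)) *
    G [seq (nth 0%N k i + tnth lam i)%N | i : 'I_(size k)] = taylor_coef m k G.
Proof.
elim: k m G => [|x k IH] m G mB.
  rewrite /= big_mkcond (big_pred1 [tuple]); last first.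
    by move=> t; apply/esym/eqP/val_inj; case: t => [[]].
  rewrite !big_ord0 mul1r eq_sym; case: eqP => _; rewrite ?mul1r ?mul0r //.
  by congr G; rewrite /image_mem enumT (size0nil (s := Finite.enum _)) // -enumT size_enum_ord.
rewrite big_tupleS /=.
rewrite (big_ord_widen B.+1 (fun i => neg_binom x i * taylor_coef (m - i)%N k (fun w => G ((x +
    i)%N :: w)))) //.
rewrite [RHS]big_mkcond; apply: eq_bigr => i _; rewrite ltnS.
case: ifP => im; last first.
  apply: big_pred0 => t; rewrite big_ord_recl tnth0; apply/negP => /eqP; lia.
rewrite -IH ?mulr_sumr; last by lia.
apply: eq_big => [t|t _].
  rewrite big_ord_recl tnth0; under eq_bigr => j _ do rewrite tnthS.
  by rewrite -[in RHS](eqn_add2l i) subnKC.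
rewrite big_ord_recl tnth0 /= gbinomN; move: (neg_binom x i) => g; rewrite -mulrA;
    congr (_ * (_ * _)).
  by apply: eq_bigr => j _; rewrite tnthS.
congr G; rewrite /image_mem enum_ordSl /= tnth0; congr (_ :: _).
by rewrite -map_comp; apply: eq_map => j /=; rewrite tnthS.
Qed.

Lemma zeta_reg_coefE m X k : zeta_reg_coef m X k = taylor_coef m k (fun w => zeta_reg X w 0).
Proof. exact: zeta_reg_coef_gen. Qed.

End Tuples.

(** * Moduli of complex numbers and limits *)

Lemma limnE (C : numClosedFieldType) (u : nat -> C) l :
  (forall e, 0 < e -> exists N, forall n, (N <= n)%N -> `|u n - l| < e) ->
  limn u = l.
Proof.
move=> h; apply: cvg_lim; first exact: norm_hausdorff.
apply/cvgrPdist_lt => e /h [N hN]; exists N => //= n /= /hN.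
by rewrite distrC.
Qed.

Section Norm.
Variable R : realType.
Implicit Types (z w : R[i]) (x y : R).

(** The modulus as an element of R: the norm of R[i] takes its values in R[i], which
    is not totally ordered. *)
Definition nrm z : R := complex.Re `|z|.

Lemma nrmE z : `|z| = (nrm z)%:C%C.
Proof. by rewrite /nrm normc_def. Qed.
Lemma nrm_ge0 z : 0 <= nrm z.
Proof. by rewrite -lecR -nrmE normr_ge0. Qed.
Lemma nrmD z w : nrm (z + w) <= nrm z + nrm w.
Proof. by rewrite -lecR rmorphD -!nrmE ler_normD. Qed.
Lemma nrmM z w : nrm (z * w) = nrm z * nrm w.
Proof. by apply: (@complexI R); rewrite rmorphM -!nrmE normrM. Qed.
Lemma nrmN z : nrm (- z) = nrm z.
Proof. by rewrite /nrm normrN. Qed.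
Lemma nrmB z w : nrm (z - w) <= nrm z + nrm w.
Proof. by rewrite -(nrmN w) nrmD. Qed.
Lemma nrmBC z w : nrm (z - w) = nrm (w - z).
Proof. by rewrite -nrmN opprB. Qed.
Lemma nrm0 : nrm 0 = 0.
Proof. by apply: (@complexI R); rewrite -nrmE normr0. Qed.
Lemma nrm1 : nrm 1 = 1.
Proof. by apply: (@complexI R); rewrite -nrmE normr1. Qed.
Lemma nrm_eq0 z : (nrm z == 0) = (z == 0).
Proof. by rewrite -[RHS]normr_eq0 nrmE -(inj_eq (@complexI R)). Qed.
Lemma nrm_gt0 z : (0 < nrm z) = (z != 0).
Proof. by rewrite lt_def nrm_ge0 andbT nrm_eq0. Qed.
Lemma nrmX z n : nrm (z ^+ n) = nrm z ^+ n.
Proof. by elim: n => [|n IH]; rewrite ?expr0 ?nrm1 // !exprS nrmM IH. Qed.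
Lemma nrmV z : nrm z^-1 = (nrm z)^-1.
Proof. by apply: (@complexI R); rewrite fmorphV -!nrmE normfV. Qed.
Lemma nrm_nat n : nrm n%:R = n%:R.
Proof. by apply: (@complexI R); rewrite rmorph_nat -nrmE normr_nat. Qed.
Lemma nrm_real x : nrm x%:C%C = `|x|.
Proof. by apply: (@complexI R); rewrite -nrmE normc_def /= expr0n addr0 sqrtr_sqr. Qed.
Lemma nrm_sign n : nrm ((-1) ^+ n) = 1.
Proof. by rewrite nrmX nrmN nrm1 expr1n. Qed.
Lemma nrm_sum I (r : seq I) (P : pred I) (F : I -> R[i]) :
  nrm (\sum_(i <- r | P i) F i) <= \sum_(i <- r | P i) nrm (F i).
Proof.
elim/big_rec2: _ => [|i x z _ h]; first by rewrite nrm0.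
by apply: le_trans (nrmD _ _) _; rewrite lerD2l.
Qed.
Lemma nrm_dist z w t : nrm (z - w) <= nrm (z - t) + nrm (t - w).
Proof. by rewrite -[z - w](subrKA t) nrmD. Qed.

Lemma limn_complex (u : nat -> R[i]) l :
  (forall e : R, 0 < e -> exists N, forall n, (N <= n)%N -> nrm (u n - l) < e) ->
  limn (u : nat -> (R[i] : numClosedFieldType)) = l.
Proof.
move=> h; apply: limnE => e e0.
have ee : e = (complex.Re e)%:C%C by case: e e0 => a b; rewrite ltcE /= => /andP[/eqP ->].
move: e0; rewrite ee (_ : 0 = (0 : R)%:C%C) // ltcR => /h[N hN]; exists N => n /hN.
by rewrite -ltcR -nrmE.
Qed.

Lemma nrm_Re z : `|complex.Re z| <= nrm z.
Proof. by rewrite -lecR -nrmE normc_ge_Re. Qed.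
Lemma nrm_Im z : `|complex.Im z| <= nrm z.
Proof.
have -> : nrm z = nrm (z * 'i%C) .
  by rewrite nrmM -[LHS]mulr1; congr (_ * _); apply: (@complexI R);
      rewrite -nrmE normc_def /= expr0n add0r expr1n sqrtr1.
suff -> : complex.Im z = - complex.Re (z * 'i%C) by rewrite normrN nrm_Re.
by case: z => a b /=; rewrite mulr0 mulr1 sub0r opprK.
Qed.
Lemma nrm_le_ReIm z : nrm z <= `|complex.Re z| + `|complex.Im z|.
Proof.
rewrite -lecR -nrmE normc_def lecR.
rewrite -[leRHS]ger0_norm ?addr_ge0 // -sqrtr_sqr ler_wsqrtr //.
rewrite sqrrD !real_normK ?num_real //.
have := mulr_ge0 (normr_ge0 (complex.Re z)) (normr_ge0 (complex.Im z)); lra.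
Qed.

(** A sequence that is Cauchy with rate e converges with that same rate; passing to
    the limit keeps track of the error terms. *)
Lemma real_rate (u : nat -> R) (e : nat -> R) :
  (forall d : R, 0 < d -> exists N, forall n, (N <= n)%N -> e n < d) ->
  (forall m n, (m <= n)%N -> `|u n - u m| <= e m) ->
  exists l, forall n, `|u n - l| <= e n.
Proof.
move=> e0 hu.
have cu : cvgn u.
  apply/cauchy_cvgP/cauchy_ballP => d d0.
  have [N hN] := e0 (d / 2) ltac:(lra).
  exists (range (fun n => u (N + n)%N), range (fun n => u (N + n)%N)).
    by split; exists N => //= n /= Nn; exists (n - N)%N => //; rewrite subnKC.
  move=> [x y] /= [[m _ <-] [n _ <-]]; rewrite /ball /=.
  have h k : `|u (N + k)%N - u N| < d / 2.
    by apply: le_lt_trans (hu _ _ (leq_addr _ _)) _; apply: hN.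
  have := h m; have := h n; rewrite !ltr_norml => /andP[a1 a2] /andP[b1 b2].
  by apply/andP; split; lra.
have {cu} [l ul] : exists l : R, forall d, 0 < d -> exists N, forall n, (N <= n)%N ->
    `|u n - l| < d.
  exists (limn u) => d d0; have [N _ hN] := (cvgrPdist_lt _ _).1 cu _ d0.
  by exists N => n /hN; rewrite distrC.
exists l => n.
have [//|lt] := leP `|u n - l| (e n); exfalso.
have [N hN] := ul (`|u n - l| - e n) ltac:(by rewrite subr_gt0).
have := hN (maxn N n) (leq_maxl _ _); have := hu n (maxn N n) (leq_maxr _ _).
have := ler_normD (u n - u (maxn N n)) (u (maxn N n) - l); rewrite subrKA.
by rewrite (distrC (u n) (u (maxn N n))); lra.
Qed.

Lemma complex_rate (u : nat -> R[i]) (e : nat -> R) :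
  (forall d : R, 0 < d -> exists N, forall n, (N <= n)%N -> e n < d) ->
  (forall m n, (m <= n)%N -> nrm (u n - u m) <= e m) ->
  exists l, forall n, nrm (u n - l) <= 2 * e n.
Proof.
move=> e0 hu.
have [a ha] : exists a, forall n, `|complex.Re (u n) - a| <= e n.
  apply: real_rate e0 _ => m n mn; rewrite -raddfB.
  exact: le_trans (nrm_Re _) (hu _ _ mn).
have [b hb] : exists b, forall n, `|complex.Im (u n) - b| <= e n.
  apply: real_rate e0 _ => m n mn; rewrite -raddfB.
  exact: le_trans (nrm_Im _) (hu _ _ mn).
exists (a +i* b)%C => n; apply: le_trans (nrm_le_ReIm _) _.
have := ha n; have := hb n.
by case: (u n) => x y /=; lra.
Qed.

End Norm.

(** * Harmonic numbers as a logarithmic gauge *)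

Section Harmonic.
Variable R : realType.
Implicit Types (M N n m p : nat).

Definition harm M : R := \sum_(i < M) i.+1%:R^-1.
(** One plus the harmonic number: a positive substitute for the logarithm, whose
    powers absorb all constants. *)
Definition lgauge M : R := 1 + harm M.

Lemma harmS M : harm M.+1 = harm M + M.+1%:R^-1.
Proof. by rewrite /harm big_ord_recr. Qed.
Lemma lgaugeS M : lgauge M.+1 = lgauge M + M.+1%:R^-1.
Proof. by rewrite /lgauge harmS addrA. Qed.
Lemma lgauge0 : lgauge 0 = 1.
Proof. by rewrite /lgauge /harm big_ord0 addr0. Qed.
Lemma harm_ge0 M : 0 <= harm M.
Proof. by apply: sumr_ge0 => i _; rewrite invr_ge0. Qed.
Lemma lgauge_ge1 M : 1 <= lgauge M.
Proof. by rewrite /lgauge lerDl harm_ge0. Qed.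
Lemma lgauge_gt0 M : 0 < lgauge M.
Proof. exact: lt_le_trans ltr01 (lgauge_ge1 M). Qed.
Lemma lgauge_ge0 M : 0 <= lgauge M.
Proof. exact: ltW (lgauge_gt0 M). Qed.
Lemma pow_le (x y : R) p : 0 <= x -> x <= y -> x ^+ p <= y ^+ p.
Proof. by move=> x0 xy; apply: lerXn2r => //; rewrite nnegrE // (le_trans x0). Qed.
Lemma lgauge_le m n : (m <= n)%N -> lgauge m <= lgauge n.
Proof.
move=> /subnKC <-; elim: (n - m)%N => [|k IH]; first by rewrite addn0.
by rewrite addnS lgaugeS; apply: le_trans IH _; rewrite lerDl invr_ge0.
Qed.
Lemma lgaugeX_ge1 M p : 1 <= lgauge M ^+ p.
Proof. by rewrite exprn_ege1 // lgauge_ge1. Qed.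
Lemma lgaugeX_ge0 M p : 0 <= lgauge M ^+ p.
Proof. by rewrite exprn_ge0 // lgauge_ge0. Qed.
Lemma lgaugeX_le m n p q : (m <= n)%N -> (p <= q)%N -> lgauge m ^+ p <= lgauge n ^+ q.
Proof.
move=> mn pq; apply: le_trans (_ : lgauge n ^+ p <= _).
  by rewrite pow_le ?lgauge_ge0 ?lgauge_le.
by rewrite ler_weXn2l // lgauge_ge1.
Qed.

(** The M + 1 terms 1/(M+1), ..., 1/(2M+1) add up to at least 1/2. *)
Lemma lgauge_double M : lgauge M + 2^-1 <= lgauge (M.+1 + M).
Proof.
suff h k : (k <= M)%N -> lgauge M + k.+1%:R / (2 * M.+1%:R) <= lgauge (M.+1 + k).
  apply: le_trans (h M (leqnn M)); rewrite lerD2l invfM mulrCA mulfV ?mulr1 //.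
elim: k => [|k IH] kM.
  rewrite addn0 lgaugeS lerD2l div1r invfM ler_piMl ?invr_ge0 //.
  by rewrite invf_le1 // ler1n.
rewrite addnS lgaugeS -[k.+2]addn1 natrD mulrDl addrA lerD ?IH 1?ltnW //.
by rewrite div1r lef_pV2 ?posrE -?natrM ?ltr0n ?ler_nat //; lia.
Qed.

Lemma harm_unbounded (x : R) : exists N, forall n, (N <= n)%N -> x <= harm n.
Proof.
have h k : exists N, k%:R / 2 <= harm N.
  elim: k => [|k [N IH]]; first by exists 0%N; rewrite mul0r harm_ge0.
  exists (N.+1 + N)%N; have := lgauge_double N; rewrite /lgauge.
  by rewrite -[k.+1]addn1 natrD mulrDl div1r; lra.
have [N hN] := h (Num.bound (`|2 * x|)).
exists N => n Nn; apply: le_trans (_ : harm N <= _); last by have := lgauge_le Nn; rewrite lerD2l.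
apply: le_trans hN; rewrite ler_pdivlMr // mulrC ltW //.
exact: le_lt_trans (ler_norm _) (archi_boundP (normr_ge0 _)).
Qed.

(** Logarithmic growth of the harmonic numbers: adding 1/n multiplies the left side by
    exp (1/n), and exp (-1/n) >= 1 - 1/n. *)
Lemma expR_lgauge M : expR (lgauge M) <= expR 2 * M.+1%:R.
Proof.
have h n : expR (lgauge n.+1) <= expR 2 * n.+1%:R.
  elim: n => [|n IH].
    by rewrite lgaugeS lgauge0 invr1 mulr1.
  rewrite lgaugeS expRD; have n0 : 0 < n.+2%:R :> R by rewrite ltr0n.
  have e1 : expR (n.+2%:R^-1) <= n.+2%:R / n.+1%:R :> R.
    have := expR_ge1Dx (- n.+2%:R^-1 : R); rewrite expRN => e1.
    have p0 := expR_gt0 (n.+2%:R^-1 : R).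
    rewrite -[leRHS]invrK -[leLHS]invrK lef_pV2 ?posrE ?invr_gt0 ?divr_gt0 ?invf_div //.
    have -> : n.+1%:R / n.+2%:R = 1 - n.+2%:R^-1 :> R.
      have n2 : n.+2%:R = n.+1%:R + 1 :> R by rewrite -natr1.
      by move: n0; rewrite n2 => n0; field; lra.
    exact: e1.
  apply: le_trans (ler_pM (expR_ge0 _) (expR_ge0 _) IH e1) _.
  by rewrite -mulrA [n.+1%:R * _]mulrC divfK ?pnatr_eq0.
case: M => [|n]; last by apply: le_trans (h n) _; rewrite ler_pM2l ?expR_gt0 // ler_nat.
by rewrite lgauge0 mulr1 ler_expR; lra.
Qed.

(** Powers of the logarithm are negligible against n. The power p + 1 is still O(n) by
    [expR_lgauge], and one factor lgauge n is left over, which is unbounded. *)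
Lemma lgauge_small p (d : R) : 0 < d -> exists N, forall n, (N <= n)%N ->
    lgauge n ^+ p / n.+1%:R < d.
Proof.
move=> d0; set c := p.+1%:R ^+ p.+1 * expR 2 : R.
have c0 : 0 < c by rewrite mulr_gt0 ?expR_gt0 // exprn_gt0 // ltr0n.
have [N hN] := harm_unbounded (c / d).
exists N => n /hN h.
have L0 := lgauge_gt0 n.
have h1 : lgauge n ^+ p.+1 <= c * n.+1%:R.
  have e1 : lgauge n / p.+1%:R <= expR (lgauge n / p.+1%:R).
    by apply: le_trans (expR_ge1Dx _); rewrite lerDr.
  have e2 : expR (lgauge n / p.+1%:R) ^+ p.+1 = expR (lgauge n).
    by rewrite -expRM_natl mulrC divfK // pnatr_eq0.
  have : (lgauge n / p.+1%:R) ^+ p.+1 <= expR 2 * n.+1%:R.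
    apply: le_trans (expR_lgauge n); rewrite -e2 pow_le //.
    by rewrite divr_ge0 // lgauge_ge0.
  rewrite expr_div_n ler_pdivrMr; last by rewrite exprn_gt0 // ltr0n.
  by rewrite /c => /le_trans -> //; rewrite mulrC mulrA.
have h2 : c / d < lgauge n by rewrite /lgauge; lra.
rewrite ltr_pdivrMr ?ltr0n //.
rewrite -(ltr_pM2r L0) -exprSr; apply: le_lt_trans h1 _.
rewrite ltr_pdivrMr // in h2.
by rewrite (_ : _ * lgauge n = lgauge n * d * n.+1%:R) ?ltr_pM2r ?ltr0n //; ring.
Qed.

(** Bernoulli's inequality (1 + t)^-p >= 1 - p t, without division. *)
Lemma bernoulli_bound (t : R) p : 0 <= t -> (1 + t) ^+ p * (1 - p%:R * t) <= 1.
Proof.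
move=> t0; elim: p => [|p IH]; first by rewrite mul1r mul0r subr0.
apply: le_trans IH; rewrite exprSr -mulrA ler_wpM2l ?exprn_ge0 ?addr_ge0 //.
have h1 : 0 <= p%:R * t * t by rewrite !mulr_ge0.
have h2 : 0 <= t * t by rewrite mulr_ge0.
rewrite -[p.+1]addn1 natrD; nra.
Qed.

(** The function x^p / J, with x = lgauge j + 4 p, decreases by a definite part of x^p
    / J^2 at each step. The shift 4 p makes the growth of x^p harmless: it keeps p / x
    below 1/4. *)
Lemma tail_step p j (x := lgauge j + 4 * p%:R) (J := j.+1%:R : R) :
  x ^+ p / (J * (J + 1)) <= 2 * (x ^+ p / J - (x + J^-1) ^+ p / (J + 1)).
Proof.
have J1 : 1 <= J by rewrite /J ler1n.
have x4 : 1 + 4 * p%:R <= x by rewrite /x lerD2r lgauge_ge1.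
have p0 : 0 <= p%:R :> R by [].
have x1 : 1 <= x by lra.
clearbody x J.
have J0 : J != 0 by lra.
have J10 : J + 1 != 0 by lra.
have x0 : x != 0 by lra.
pose t := (x * J)^-1.
have t0 : 0 <= t by rewrite invr_ge0 mulr_ge0; lra.
have pt : p%:R * t <= (4 * J)^-1.
  rewrite /t invfM mulrA invfM ler_wpM2r ?invr_ge0; try lra.
  rewrite ler_pdivrMr; last lra.
  by lra.
have xt : x + J^-1 = x * (1 + t) by rewrite /t; field; rewrite x0 J0.
have b := bernoulli_bound p t0.
have xp : 0 <= x ^+ p by rewrite exprn_ge0; lra.
set y := (1 + t) ^+ p in b *.
have y0 : 0 <= y by rewrite exprn_ge0; lra.
have hy : y * (4 * J - 1) <= 4 * J.
  have : y * (1 - (4 * J)^-1) <= 1.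
    by apply: le_trans b; rewrite ler_wpM2l // lerD2l lerN2.
  have e : y * (1 - (4 * J)^-1) = y * (4 * J - 1) / (4 * J) by field; lra.
  by rewrite e ler_pdivrMr; lra.
rewrite xt exprMn -/y.
have -> : 2 * (x ^+ p / J - x ^+ p * y / (J + 1)) = x ^+ p / (J * (J + 1)) * (2 * (J + 1 - J * y)).
  by field; rewrite J0 J10.
rewrite ler_peMr //; first by rewrite divr_ge0 // mulr_ge0; lra.
have : (J * y) * (4 * J - 1) <= J * (4 * J) by rewrite -mulrA ler_wpM2l; lra.
nra.
Qed.

(** The tail of sum (log j)^p / j^2 is O((log n)^p / n), by telescoping [tail_step]. *)
Lemma tail_bound p : exists2 D, 0 <= D & forall n m,
  \sum_(n <= j < m) lgauge j ^+ p / j.+1%:R ^+ 2 <= D * lgauge n ^+ p / n.+1%:R.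
Proof.
pose f j : R := (lgauge j + 4 * p%:R) ^+ p / j.+1%:R.
have f0 j : 0 <= f j.
  by rewrite divr_ge0 // exprn_ge0 // addr_ge0 ?mulr_ge0 ?lgauge_ge0.
have st j : lgauge j ^+ p / j.+1%:R ^+ 2 <= 4 * (f j - f j.+1).
  have := tail_step p j; rewrite /= (addrAC (lgauge j)) -lgaugeS.
  have J1 : 1 <= j.+1%:R :> R by rewrite ler1n.
  have -> : (j.+1%:R + 1 : R) = j.+2%:R by rewrite -[j.+2]addn1 natrD.
  rewrite -/(f j) -/(f j.+1) => h.
  apply: le_trans (_ : 2 * ((lgauge j + 4 * p%:R) ^+ p / (j.+1%:R * j.+2%:R)) <= _); last first.
    by move: h; move: (_ ^+ p / (_ * _)) (f j) (f j.+1) => u v w; lra.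
  have e1 : lgauge j ^+ p <= (lgauge j + 4 * p%:R) ^+ p.
    by rewrite pow_le ?lgauge_ge0 // lerDl mulr_ge0.
  have e2 : (j.+1%:R ^+ 2)^-1 <= 2 / (j.+1%:R * j.+2%:R) :> R.
    have -> : j.+2%:R = j.+1%:R + 1 :> R by rewrite -natr1.
    move: (j.+1%:R : R) J1 => J J1.
    rewrite ler_pdivlMr ?mulr_gt0 1?mulrC ?ler_pdivrMr ?exprn_gt0; try lra.
    by rewrite expr2; nra.
  rewrite mulrCA ler_pM ?invr_ge0 ?lgaugeX_ge0 ?sqr_ge0 //.
exists (4 * (1 + 4 * p%:R) ^+ p); first by rewrite mulr_ge0 // exprn_ge0 // addr_ge0 // mulr_ge0.
move=> n m.
apply: le_trans (_ : 4 * f n <= _).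
  have [mn|nm] := leqP m n; first by rewrite big_geq // mulr_ge0.
  apply: le_trans (_ : \sum_(n <= j < m) 4 * (f j - f j.+1) <= _).
    by apply: ler_sum => j _; apply: st.
  rewrite -mulr_sumr ler_wpM2l //.
  rewrite -[X in X <= _]opprK -sumrN; under eq_bigr => j _ do rewrite opprB.
  by rewrite telescope_sumr 1?ltnW // opprB lerBlDr lerDl.
rewrite /f -mulrA -[in leRHS]mulrA ler_wpM2l // mulrA ler_wpM2r ?invr_ge0 //.
rewrite -exprMn; apply: pow_le; first by rewrite addr_ge0 ?mulr_ge0 ?lgauge_ge0.
have p0 : 0 <= p%:R :> R by []; have := lgauge_ge1 n; nra.
Qed.

End Harmonic.

(** * Asymptotics up to powers of the logarithm *)

Section Asy.
Variable R : realType.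
Implicit Types (u v w : nat -> R[i]) (k : seq nat) (s : R[i]).
Local Notation lgauge := (@lgauge R).
Local Notation harm := (@harm R).

(** At most polylogarithmic growth. *)
Definition log_bounded u := exists2 D : R, 0 <= D & exists p, forall M, nrm (u M) <=
    D * lgauge M ^+ p.
(** Being O((log M)^p / M) for some p. Such functions form an ideal in the ring of
    polylogarithmically bounded ones, so no power of the logarithm ever has to be
    tracked. *)
Definition log_small u := exists2 D : R, 0 <= D & exists p, forall M,
  nrm (u M) <= D * lgauge M ^+ p / M.+1%:R.
Definition asymp u v := log_small (fun M => u M - v M).

Lemma eq_log_small u v : u =1 v -> log_small u -> log_small v.
Proof. by move=> /funext ->. Qed.

Lemma log_small_le u v : (forall M, nrm (u M) <= nrm (v M)) -> log_small v -> log_small u.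
Proof. by move=> uv [D D0 [p h]]; exists D => //; exists p => M; apply: le_trans (h M). Qed.

Lemma log_bounded_cst (c : R[i]) : log_bounded (fun=> c).
Proof. by exists (nrm c); rewrite ?nrm_ge0 //; exists 0%N => M; rewrite mulr1. Qed.
Lemma log_boundedD u v : log_bounded u -> log_bounded v -> log_bounded (fun M => u M + v M).
Proof.
move=> [D D0 [p hu]] [E E0 [q hv]]; exists (D + E); first exact: addr_ge0.
exists (maxn p q) => M; apply: le_trans (nrmD _ _) _; rewrite mulrDl lerD //.
  by apply: le_trans (hu M) _; rewrite ler_wpM2l // lgaugeX_le // leq_maxl.
by apply: le_trans (hv M) _; rewrite ler_wpM2l // lgaugeX_le // leq_maxr.
Qed.
Lemma log_boundedM u v : log_bounded u -> log_bounded v -> log_bounded (fun M => u M * v M).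
Proof.
move=> [D D0 [p hu]] [E E0 [q hv]]; exists (D * E); first exact: mulr_ge0.
by exists (p + q)%N => M; rewrite nrmM exprD mulrACA ler_pM // nrm_ge0.
Qed.
Lemma log_boundedX u n : log_bounded u -> log_bounded (fun M => u M ^+ n).
Proof.
move=> hu; elim: n => [|n IH]; first exact: log_bounded_cst.
by under eq_fun do rewrite exprS; apply: log_boundedM.
Qed.
Lemma log_bounded_sum I (r : seq I) (P : pred I) (F : I -> nat -> R[i]) :
  (forall i, P i -> log_bounded (F i)) -> log_bounded (fun M => \sum_(i <- r | P i) F i M).
Proof.
move=> h; elim: r => [|i r IH]; first by under eq_fun do rewrite big_nil; apply: log_bounded_cst.
under eq_fun do rewrite big_cons; case Pi: (P i) => //.
by apply: log_boundedD => //; apply: h.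
Qed.

Lemma log_small_log_bounded u : log_small u -> log_bounded u.
Proof.
move=> [D D0 [p h]]; exists D => //; exists p => M; apply: le_trans (h M) _.
by rewrite ler_pdivrMr ?ltr0n // ler_peMr ?ler1n // mulr_ge0 ?lgaugeX_ge0.
Qed.
Lemma log_small0 : log_small (fun=> 0).
Proof. by exists 0 => //; exists 0%N => M; rewrite nrm0 !mul0r. Qed.
Lemma log_smallM u v : log_small u -> log_bounded v -> log_small (fun M => u M * v M).
Proof.
move=> [D D0 [p hu]] [E E0 [q hv]]; exists (D * E); first exact: mulr_ge0.
exists (p + q)%N => M; rewrite nrmM exprD.
apply: le_trans (ler_pM (nrm_ge0 _) (nrm_ge0 _) (hu M) (hv M)) _.
by rewrite le_eqVlt; apply/orP; left; apply/eqP; ring.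
Qed.
Lemma log_smallD u v : log_small u -> log_small v -> log_small (fun M => u M + v M).
Proof.
move=> [D D0 [p hu]] [E E0 [q hv]]; exists (D + E); first exact: addr_ge0.
exists (maxn p q) => M; apply: le_trans (nrmD _ _) _; rewrite !mulrDl lerD //.
  apply: le_trans (hu M) _; rewrite ler_wpM2r ?invr_ge0 //.
  by rewrite ler_wpM2l // lgaugeX_le // leq_maxl.
apply: le_trans (hv M) _; rewrite ler_wpM2r ?invr_ge0 //.
by rewrite ler_wpM2l // lgaugeX_le // leq_maxr.
Qed.
Lemma log_smallN u : log_small u -> log_small (fun M => - u M).
Proof. by apply: log_small_le => M; rewrite nrmN. Qed.
Lemma log_small_sum I (r : seq I) (P : pred I) (F : I -> nat -> R[i]) :
  (forall i, P i -> log_small (F i)) -> log_small (fun M => \sum_(i <- r | P i) F i M).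
Proof.
move=> h; elim: r => [|i r IH]; first by under eq_fun do rewrite big_nil; apply: log_small0.
under eq_fun do rewrite big_cons; case Pi: (P i) => //.
by apply: log_smallD => //; apply: h.
Qed.

Lemma asymp_refl u : asymp u u.
Proof. by apply: eq_log_small log_small0 => M; rewrite subrr. Qed.
Lemma asymp_sym u v : asymp u v -> asymp v u.
Proof. by move=> /log_smallN; apply: eq_log_small => M; rewrite opprB. Qed.
Lemma asymp_trans v u w : asymp u v -> asymp v w -> asymp u w.
Proof. by move=> h1 h2; apply: eq_log_small (log_smallD h1 h2) => M; rewrite subrKA. Qed.
Lemma asympD u u' v v' : asymp u u' -> asymp v v' ->
  asymp (fun M => u M + v M) (fun M => u' M + v' M).
Proof. by move=> h1 h2; apply: eq_log_small (log_smallD h1 h2) => M; ring. Qed.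
Lemma asympN u u' : asymp u u' -> asymp (fun M => - u M) (fun M => - u' M).
Proof. by move=> h1; apply: eq_log_small (log_smallN h1) => M; ring. Qed.
Lemma asympB u u' v v' : asymp u u' -> asymp v v' ->
  asymp (fun M => u M - v M) (fun M => u' M - v' M).
Proof. by move=> h1 h2; apply: asympD => //; apply: asympN. Qed.
Lemma asymp_sum I (r : seq I) (P : pred I) (F G : I -> nat -> R[i]) :
  (forall i, P i -> asymp (F i) (G i)) ->
  asymp (fun M => \sum_(i <- r | P i) F i M) (fun M => \sum_(i <- r | P i) G i M).
Proof. by move=> /(log_small_sum r); apply: eq_log_small => M; rewrite sumrB. Qed.
Lemma log_bounded_asymp u v : asymp u v -> log_bounded v -> log_bounded u.
Proof.
move=> /log_small_log_bounded h1 h2; suff -> : u = (fun M => (u M - v M) + v M) by apply: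
    log_boundedD.
by apply/funext => M; rewrite subrK.
Qed.
Lemma asympM u u' v v' : asymp u u' -> asymp v v' -> log_bounded u' -> log_bounded v' ->
  asymp (fun M => u M * v M) (fun M => u' M * v' M).
Proof.
move=> h1 h2 l1 l2; have l3 := log_bounded_asymp h2 l2.
apply: eq_log_small (log_smallD (log_smallM h1 l3) (log_smallM h2 l1)) => M; ring.
Qed.
Lemma asympX u u' n : asymp u u' -> log_bounded u' -> asymp (fun M => u M ^+ n) (fun M => u' M
    ^+ n).
Proof.
move=> h l; elim: n => [|n IH]; first exact: asymp_refl.
have -> : (fun M => u M ^+ n.+1) = (fun M => u M * u M ^+ n) by apply/funext => M; rewrite exprS.
have -> : (fun M => u' M ^+ n.+1) = (fun M => u' M * u' M ^+ n) by apply/funext => M; rewrite exprS.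
by apply: asympM => //; apply: log_boundedX.
Qed.
Lemma asympZ c u u' : asymp u u' -> asymp (fun M => c * u M) (fun M => c * u' M).
Proof.
move=> h; apply: eq_log_small (log_smallM h (log_bounded_cst c)) => M; ring.
Qed.

Lemma log_small_lim u : log_small u -> forall e : R, 0 < e -> exists N, forall n, (N <= n)%N ->
    nrm (u n) < e.
Proof.
move=> [D D0 [p h]] e e0; have D1 : 0 < D + 1 by lra.
have [N hN] := lgauge_small p (divr_gt0 e0 D1).
exists N => n /hN; rewrite ltr_pdivlMr // => hn; apply: le_lt_trans (h n) _.
apply: le_lt_trans hn.
rewrite (_ : D * _ / _ = lgauge n ^+ p / n.+1%:R * D); last by ring.
by rewrite ler_wpM2l ?divr_ge0 ?lgaugeX_ge0 //; lra.
Qed.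

Lemma limn_asymp u l : asymp (fun M => u M.+1) (fun=> l) ->
  limn (u : nat -> (R[i] : numClosedFieldType)) = l.
Proof.
move=> h; apply: limn_complex => e /(log_small_lim h) [N hN]; exists N.+1 => -[//|n] Nn.
exact: hN.
Qed.

(** Steps of size (log M)^p / M sum up to (log M)^(p+1). *)
Lemma log_bounded_step u : (exists2 D : R, 0 <= D & exists p, forall M,
  nrm (u M.+1 - u M) <= D * lgauge M ^+ p / M.+1%:R) -> log_bounded u.
Proof.
move=> [D D0 [p h]]; exists (nrm (u 0%N) + D); first by rewrite addr_ge0 ?nrm_ge0.
exists p.+1 => M.
apply: le_trans (_ : nrm (u 0%N) + D * lgauge M ^+ p * harm M <= _).
  elim: M => [|M IH]; first by rewrite /harm big_ord0 mulr0 addr0.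
  rewrite -[u M.+1](subrK (u M)) addrC; apply: le_trans (nrmD _ _) _.
  apply: le_trans (lerD IH (h M)) _; rewrite -addrA lerD2l harmS mulrDr.
  have LL : D * lgauge M ^+ p <= D * lgauge M.+1 ^+ p by rewrite ler_wpM2l // lgaugeX_le.
  by rewrite lerD // ler_wpM2r ?invr_ge0 ?harm_ge0.
rewrite mulrDl lerD //; first by rewrite ler_peMr ?nrm_ge0 ?lgaugeX_ge1.
rewrite exprSr mulrA ler_wpM2l ?mulr_ge0 ?lgaugeX_ge0 //.
by rewrite /lgauge lerDr.
Qed.

(** Steps of size (log M)^p / M^2 have small tails, so the sequence has a limit and
    reaches it with a small error. *)
Lemma log_small_cauchy u : (exists2 D : R, 0 <= D & exists p, forall M,
  nrm (u M.+1 - u M) <= D * lgauge M ^+ p / M.+1%:R ^+ 2) -> exists l, asymp u (fun=> l).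
Proof.
move=> [D D0 [p h]]; have [E E0 hE] := tail_bound R p.
have [l hl] : exists l, forall n, nrm (u n - l) <= 2 * (D * (E * lgauge n ^+ p / n.+1%:R)).
  apply: complex_rate.
    move=> d d0; have c0 : 0 < D * E + 1 by have := mulr_ge0 D0 E0; lra.
    have [N hN] := lgauge_small p (divr_gt0 d0 c0).
    exists N => n /hN; rewrite ltr_pdivlMr // => hn; apply: le_lt_trans hn.
    rewrite (_ : D * _ = lgauge n ^+ p / n.+1%:R * (D * E)); last by ring.
    by rewrite ler_wpM2l ?divr_ge0 ?lgaugeX_ge0 //; lra.
  move=> m n mn; apply: le_trans (_ : \sum_(m <= j < n) nrm (u j.+1 - u j) <= _).
    by rewrite -telescope_sumr //; apply: nrm_sum.
  apply: le_trans (_ : D * \sum_(m <= j < n) lgauge j ^+ p / j.+1%:R ^+ 2 <= _).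
    by rewrite mulr_sumr; apply: ler_sum => j _; rewrite mulrA.
  by rewrite ler_wpM2l.
exists l; exists (2 * (D * E)); first by rewrite !mulr_ge0.
by exists p => M; apply: le_trans (hl M) _; rewrite !mulrA.
Qed.

(** A lower bound for |n + s| that is linear in n and uniform over n >= 1; with it,
    sums over the 1 / (n + s) are estimated by sums over the 1 / n. *)
Definition off_poles s := exists2 c : R, 0 < c & forall n, c * n.+1%:R <= nrm (n.+1%:R + s).

Lemma off_poles0 : off_poles 0.
Proof. by exists 1 => // n; rewrite mul1r addr0 nrm_nat. Qed.

(** For n large against |s| one has |n + s| >= n / 2; the finitely many remaining n
    contribute a minimum. *)
Lemma off_polesP s : (forall n : nat, n.+1%:R + s != 0) -> off_poles s.
Proof.
move=> sn.
have h N : exists2 c : R, 0 < c & forall n, (n < N)%N -> c * n.+1%:R <= nrm (n.+1%:R + s).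
  elim: N => [|N [c c0 hc]]; first by exists 1.
  pose d := nrm (N.+1%:R + s) / N.+1%:R.
  have d0 : 0 < d by rewrite divr_gt0 ?nrm_gt0 // ltr0n.
  exists (Num.min c d); first by rewrite lt_min c0.
  move=> n; rewrite ltnS leq_eqVlt => /orP[/eqP->|/hc hn].
    by rewrite -ler_pdivlMr ?ltr0n // ge_min lexx orbT.
  by apply: le_trans hn; rewrite ler_wpM2r // ge_min lexx.
have [c c0 hc] := h (Num.bound (2 * nrm s)).
exists (Num.min c 2^-1); first by rewrite lt_min c0 invr_gt0 ltr0n.
move=> n; have [/hc hn|nN] := ltnP n (Num.bound (2 * nrm s)).
  by apply: le_trans hn; rewrite ler_wpM2r // ge_min lexx.
have b : 2 * nrm s < n.+1%:R.
  apply: lt_le_trans (archi_boundP _) _; first by rewrite mulr_ge0 ?nrm_ge0.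
  by rewrite ler_nat ltnW.
apply: le_trans (_ : 2^-1 * n.+1%:R <= _); first by rewrite ler_wpM2r // ge_min lexx orbT.
have := nrmD (n.+1%:R + s) (- s); rewrite addrK nrmN nrm_nat.
lra.
Qed.

Lemma zeta_ptsS s M : zeta_pts s M.+2 = rcons (zeta_pts s M.+1) (M.+1%:R + s)^-1.
Proof.
have e : iota 1 M.+2.-1 = rcons (iota 1 M) M.+1.
  by rewrite -cats1 (_ : M.+2.-1 = (M + 1)%N) ?iotaD ?add1n ?addn1.
by rewrite /zeta_pts e map_rcons.
Qed.

Lemma off_poles_pt s : off_poles s -> exists2 c : R, 0 < c & forall M x,
  nrm ((M.+1%:R + s)^-1 ^+ x) <= c ^+ x / M.+1%:R ^+ x.
Proof.
move=> [c c0 h]; exists c^-1; first by rewrite invr_gt0.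
move=> M x; rewrite nrmX nrmV -[M.+1%:R ^- x]exprVn -exprMn -invfM.
apply: pow_le; first by rewrite invr_ge0 nrm_ge0.
have cM : 0 < c * M.+1%:R by rewrite mulr_gt0 ?ltr0n.
by rewrite lef_pV2 ?posrE // (lt_le_trans cM).
Qed.

(** Raising the truncation by one adds the terms whose last summation index is the new
    one. *)
Lemma zeta_pts_step s k x : off_poles s -> log_bounded (fun M => qsym (zeta_pts s M.+1) k) ->
  exists2 D : R, 0 <= D & exists p, forall M,
    nrm (qsym (zeta_pts s M.+2) (rcons k x) - qsym (zeta_pts s M.+1) (rcons k x)) <=
      D * lgauge M ^+ p / M.+1%:R ^+ x.
Proof.
move=> /off_poles_pt[c c0 hc] [D D0 [p hD]].
exists (c ^+ x * D); first by rewrite mulr_ge0 // exprn_ge0 // ltW.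
exists p => M; rewrite zeta_ptsS qsym_rcons [X in nrm X]addrC addKr nrmM.
apply: le_trans (ler_pM (nrm_ge0 _) (nrm_ge0 _) (hc M x) (hD M)) _.
by rewrite le_eqVlt; apply/orP; left; apply/eqP; ring.
Qed.

Lemma zeta_pts_log_bounded s k : off_poles s -> is_index k ->
    log_bounded (fun M => qsym (zeta_pts s M.+1) k).
Proof.
move=> fs; elim/last_ind: k => [|k x IH] ik.
  by under eq_fun do rewrite qsym_nil; apply: log_bounded_cst.
move: ik; rewrite /is_index all_rcons => /andP[x0 /IH hk].
have [E E0 [r hE]] := zeta_pts_step x fs hk.
apply: log_bounded_step; exists E => //; exists r => M; apply: le_trans (hE M) _.
rewrite ler_wpM2l ?mulr_ge0 ?lgaugeX_ge0 //.
by rewrite lef_pV2 ?posrE ?exprn_gt0 ?ltr0n // ler_eXnr // ler1n.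
Qed.

End Asy.

(** * Regularized zeta values at harmonic numbers *)

Section ZetaReg.
Variable R : realType.
Implicit Types (u v w : nat -> R[i]) (k : seq nat) (s : R[i]).
Local Notation lgauge := (@lgauge R).
Local Notation harm := (@harm R).

(** A last exponent >= 2 makes the steps summable. *)
Lemma zeta_asymp s a : off_poles s -> admissible a ->
  asymp (fun M => qsym (zeta_pts s M.+1) a) (fun=> zeta a s).
Proof.
move=> fs /andP[ia la].
have [l hl] : exists l, asymp (fun M => qsym (zeta_pts s M.+1) a) (fun=> l).
  case/lastP: a ia la => [|a x].
    by move=> _ _; exists 1; apply: eq_log_small (asymp_refl (fun=> 1)) => M; rewrite qsym_nil.
  rewrite last_rcons /is_index all_rcons => /andP[x0 ia] la.
  have {}la : (2 <= x)%N by case: a la {ia} => [|? ?]; rewrite /= ?eqE.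
  have [D D0 [p hD]] := zeta_pts_step x fs (zeta_pts_log_bounded fs ia).
  apply: log_small_cauchy; exists D => //; exists p => M; apply: le_trans (hD M) _.
  rewrite ler_wpM2l ?mulr_ge0 ?lgaugeX_ge0 //.
  by rewrite lef_pV2 ?posrE ?exprn_gt0 ?ltr0n // ler_weXn2l // ler1n.
suff -> : zeta a s = l by [].
apply: limn_asymp; apply: eq_log_small hl => M.
by rewrite zeta_truncE.
Qed.

Lemma eval_words_asymp s (U : H1) : off_poles s -> in_H0 U ->
  asymp (fun M => eval_words (qsym (zeta_pts s M.+1)) U) (fun=> zeta_lin U s).
Proof.
move=> fs /allP hu; rewrite /eval_words /zeta_lin.
under eq_fun do rewrite big_seq; rewrite big_seq.
apply: asymp_sum => a au; apply: asympZ; apply: zeta_asymp => //; exact: hu.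
Qed.

Definition harmC M : R[i] := (harm M)%:C%C.

Lemma harmC_log_bounded : log_bounded harmC.
Proof.
exists 1 => //; exists 1%N => M; rewrite /harmC nrm_real mul1r expr1 ger0_norm ?harm_ge0 //.
by rewrite /lgauge lerDr.
Qed.

Lemma harmCE M : harmC M = \sum_(i < M) i.+1%:R^-1.
Proof.
by rewrite /harmC /harm rmorph_sum; apply: eq_bigr => i _; rewrite /= fmorphV rmorph_nat.
Qed.

Lemma zeta_pts1 s M : qsym (zeta_pts s M.+1) [:: 1%N] = \sum_(i < M) (i.+1%:R + s)^-1.
Proof.
elim: M => [|M IH]; first by rewrite big_ord0.
by rewrite zeta_ptsS -[[:: 1%N]]/(rcons [::] 1%N) qsym_rcons IH qsym_nil expr1 mulr1 big_ord_recr.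
Qed.

(** The case k = (1): the truncated harmonic sum is H_M minus the partial sums of the
    series of H(s). *)
Lemma harmonic_asymp s : off_poles s ->
  asymp (fun M => qsym (zeta_pts s M.+1) [:: 1%N]) (fun M => harmC M - harmonic_fun s).
Proof.
move=> fs.
have [c c0 hc] := off_poles_pt fs.
pose u M := \sum_(1 <= n < M.+1) (n%:R^-1 - (n%:R + s)^-1) : R[i].
have uE M : u M = harmC M - qsym (zeta_pts s M.+1) [:: 1%N].
  rewrite /u big_add1 big_mkord zeta_pts1 harmCE -sumrB //.
have [l hl] : exists l, asymp u (fun=> l).
  apply: log_small_cauchy; exists (c * nrm s); first by rewrite mulr_ge0 ?nrm_ge0 // ltW.
  exists 0%N => M; rewrite /u big_nat_recr //= [X in nrm X]addrC addKr mulr1.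
  have n0 : M.+1%:R + s != 0.
    have [d d0 hd] := fs; rewrite -nrm_gt0; apply: lt_le_trans (hd M).
    by rewrite mulr_gt0 // ltr0n.
  have m0 : M.+1%:R != 0 :> R[i] by rewrite pnatr_eq0.
  have -> : M.+1%:R^-1 - (M.+1%:R + s)^-1 = s * M.+1%:R^-1 * (M.+1%:R + s)^-1.
    by move: n0 m0; move: (M.+1%:R : R[i]) => m n0 m0; field; rewrite m0 n0.
  rewrite !nrmM nrmV nrm_nat; have := hc M 1%N; rewrite !expr1 => h.
  rewrite expr2 invfM (mulrC c) -!mulrA; apply: ler_wpM2l; first exact: nrm_ge0.
  by rewrite mulrCA; apply: ler_wpM2l; rewrite ?invr_ge0.
have -> : harmonic_fun s = l by apply: limn_asymp.
apply: eq_log_small (log_smallN hl) => M; rewrite uE; ring.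
Qed.

(** The truncated sums are a stuffle homomorphism, so they respect the decomposition
    of k. Its admissible parts converge, and the truncated sum of (1) is H_M - H(s) by
    [harmonic_asymp]. *)
Lemma zeta_reg_asymp s k : off_poles s -> is_index k ->
  asymp (fun M => qsym (zeta_pts s M.+1) k) (fun M => zeta_reg (harmC M - harmonic_fun s) k s).
Proof.
move=> fs ik.
have [hu _] := stuffle_decompP ik.
have -> : (fun M => qsym (zeta_pts s M.+1) k) = (fun M =>
   \sum_(l < (size k).+1) eval_words (qsym (zeta_pts s M.+1)) (stuffle_decomp k l) *
      qsym (zeta_pts s M.+1) [:: 1%N] ^+ l).
  apply/funext => M; apply: eval_words_decomp => //; last exact: qsym_nil.
  exact: qsym_stuffle.
have lX : log_bounded (fun M => harmC M - harmonic_fun s).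
  by apply: log_boundedD; [exact: harmC_log_bounded|exact: log_bounded_cst].
apply: asymp_sum => l _; apply: asympM.
- exact: eval_words_asymp.
- by apply: asympX => //; apply: harmonic_asymp.
- exact: log_bounded_cst.
- exact: log_boundedX.
Qed.

Lemma zeta_reg_log_bounded s k : log_bounded (fun M => zeta_reg (harmC M - harmonic_fun s) k s).
Proof.
have lX : log_bounded (fun M => harmC M - harmonic_fun s).
  by apply: log_boundedD; [exact: harmC_log_bounded|exact: log_bounded_cst].
by apply: log_bounded_sum => l _; apply: log_boundedM; [exact: log_bounded_cst|exact: log_boundedX].
Qed.

Lemma harmonic0 : harmonic_fun 0 = 0 :> R[i].
Proof.
apply: limn_asymp; apply: eq_log_small (@log_small0 R) => M.
by rewrite big1 ?subr0 // => n _; rewrite addr0 subrr.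
Qed.

Definition zreg_poly (k : seq nat) s : {poly R[i]} :=
  \sum_(l < (size k).+1) (zeta_lin (stuffle_decomp k l) s)%:P * 'X ^+ l.
Lemma zreg_polyE X k s : (zreg_poly k s).[X] = zeta_reg X k s.
Proof.
rewrite /zreg_poly horner_sum; apply: eq_bigr => l _.
by rewrite !hornerE.
Qed.

(** Either constant, or p X + c where p is bounded below by induction and X = H_M is
    unbounded. *)
Lemma poly_away (p : {poly R[i]}) : p != 0 ->
  exists2 d : R, 0 < d & exists N, forall M, (N <= M)%N -> d <= nrm p.[harmC M].
Proof.
elim/poly_ind: p => [|p c IH]; first by rewrite eqxx.
have [-> |/IH [d d0 [N hN]] _] := eqVneq p 0.
  rewrite mul0r add0r polyC_eq0 => c0; exists (nrm c); first by rewrite nrm_gt0.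
  by exists 0%N => M _; rewrite hornerC.
(* H_M >= (1 + |c|) / d gives |p(H_M) H_M| >= 1 + |c|. *)
exists 1 => //; have [N' hN'] := harm_unbounded ((1 + nrm c) / d).
exists (maxn N N') => M; rewrite geq_max => /andP[/hN h1 /hN' h2].
rewrite !hornerE -[X in nrm X]addr0.
have := nrmB (p.[harmC M] * harmC M + c) c; rewrite addrK nrmM addr0 => h3.
have h4 : nrm (harmC M) = harm M by rewrite nrm_real ger0_norm ?harm_ge0.
move: h2; rewrite ler_pdivrMr // => h2.
have h5 : harm M * d <= nrm p.[harmC M] * nrm (harmC M).
  by rewrite h4 mulrC ler_wpM2r // harm_ge0.
lra.
Qed.

Lemma poly_asymp0 (p : {poly R[i]}) : log_small (fun M => p.[harmC M]) -> p = 0.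
Proof.
move=> h; apply/eqP/negPn/negP => /poly_away [d d0 [N hN]].
have [N' hN'] := log_small_lim h d0.
have := hN _ (leq_maxl N N'); rewrite leNgt => /negP; apply.
by apply: hN'; rewrite leq_maxr.
Qed.

End ZetaReg.

(** * Laurent coefficients on an interval of integers *)

Section Laurent.
Variable R : realType.
Implicit Types (k : seq nat) (a b q M T : nat).
Local Notation C := R[i].
Local Notation lgauge := (@lgauge R).
Local Notation harm := (@harm R).
Local Notation nrm := (@nrm R).

Definition right_diffs b : seq C := [seq j.+1%:R | j <- iota 0 b].
(** In increasing order, as the points lie on the line. *)
Definition left_diffs a : seq C := [seq - j.+1%:R | j <- rev (iota 0 a)].

Lemma iotaSr m n : iota m n.+1 = rcons (iota m n) (m + n)%N.
Proof. by rewrite -addn1 iotaD cats1. Qed.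
Lemma right_diffsS b : right_diffs b.+1 = rcons (right_diffs b) b.+1%:R.
Proof. by rewrite /right_diffs iotaSr map_rcons. Qed.
Lemma left_diffsS a : left_diffs a.+1 = - a.+1%:R :: left_diffs a.
Proof. by rewrite /left_diffs iotaSr rev_rcons. Qed.

(** On an interval of integers the Laurent coefficient at a point depends only on the
    numbers a and b of points on its left and on its right. *)
Definition laurent_int q k a b : C := laurent q k (left_diffs a) (right_diffs b).

Lemma laurent_int_left K q x k a b : (0 < q)%N -> all (leq^~ K) k ->
  laurent_int q (x :: k) a.+1 b =
  laurent_int q (x :: k) a b + \sum_(p < K) inv_pow_coef x p (- a.+1%:R) * laurent_int (q +
      p)%N k a b.
Proof.
by move=> q0 kK; rewrite /laurent_int left_diffsS (@laurent_cons _ K) // oppr_eq0 pnatr_eq0.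
Qed.

Lemma laurent_int_right K q x k a b : (0 < q)%N -> all (leq^~ K) k ->
  laurent_int q (rcons k x) a b.+1 =
  laurent_int q (rcons k x) a b + \sum_(p < K) inv_pow_coef x p (b.+1%:R) * laurent_int (q +
      p)%N k a b.
Proof.
move=> q0 kK; rewrite /laurent_int right_diffsS -laurent_rev rev_rcons rev_rcons (@laurent_cons
    _ K) ?pnatr_eq0 ?all_rev //.
rewrite -rev_rcons laurent_rev; congr (_ + _); apply: eq_bigr => p _.
by rewrite laurent_rev.
Qed.

(** The coefficient of s^m in the truncated zeta value of k at s. *)
Definition zeta_taylor m k M : C := taylor_coef m k (qsym (zeta_pts 0 M.+1)).

Lemma zeta_pts0E M : zeta_pts (0 : C) M.+1 = [seq d^-1 | d <- right_diffs M].
Proof.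
rewrite /zeta_pts /right_diffs -map_comp -[iota 1 _]/(iota (1 + 0) M) iotaDl -map_comp.
by apply: eq_map => j /=; rewrite addr0 add1n.
Qed.

Lemma right_diffs_inv_series m k b : qsym [seq inv_series d | d <- right_diffs b] k m =
    zeta_taylor m k b.
Proof.
rewrite qsym_inv_series_taylor_coef /zeta_taylor ?zeta_pts0E // => d /mapP[j _ ->];
    by rewrite pnatr_eq0.
Qed.

Lemma left_diffs_inv_series m k a : is_index k ->
  qsym [seq inv_series d | d <- left_diffs a] k m = (-1) ^+ (sumn k + m) * zeta_taylor m (rev k) a.
Proof.
move=> ik; rewrite -qsym_rev -map_rev qsym_inv_series_taylor_coef; last first.
  by move=> d; rewrite mem_rev => /mapP[j _ ->]; rewrite oppr_eq0 pnatr_eq0.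
rewrite /zeta_taylor -taylor_coefZ; apply: eq_taylor_coef; last by rewrite /is_index all_rev.
move=> w _ sw _ _; rewrite -[in RHS](revK k) sumn_rev -sw -qsym_scale zeta_pts0E.
congr (qsym _ w); rewrite /left_diffs /right_diffs -map_rev revK -!map_comp.
by apply: eq_map => j /=; rewrite invrN mulN1r.
Qed.

Lemma taylor_coef_log_bounded m k (G : seq nat -> nat -> C) :
  (forall w, is_index w -> log_bounded (G w)) -> is_index k ->
  log_bounded (fun M => taylor_coef m k (fun w => G w M)).
Proof.
elim: k m G => [|x k IH] m G hG ik /=; first by apply: log_boundedM;
    [exact: log_bounded_cst|exact: hG].
have /andP[x0 ik'] := ik.
apply: log_bounded_sum => i _; apply: log_boundedM; first exact: log_bounded_cst.
apply: (IH _ (fun w => G ((x + i)%N :: w))) => // w iw; apply: hG.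
by rewrite /is_index /= addn_gt0 x0.
Qed.

Lemma taylor_coef_asymp m k (G H : seq nat -> nat -> C) :
  (forall w, is_index w -> asymp (G w) (H w)) -> is_index k ->
  asymp (fun M => taylor_coef m k (fun w => G w M)) (fun M => taylor_coef m k (fun w => H w M)).
Proof.
elim: k m G H => [|x k IH] m G H hG ik /=; first by apply: asympZ; exact: hG.
have /andP[x0 ik'] := ik.
apply: asymp_sum => i _; apply: asympZ.
apply: (IH _ (fun w => G ((x + i)%N :: w)) (fun w => H ((x + i)%N :: w))) => // w iw; apply: hG.
by rewrite /is_index /= addn_gt0 x0.
Qed.

Lemma zeta_taylor_log_bounded m k : is_index k -> log_bounded (zeta_taylor m k).
Proof.
move=> ik; apply: (taylor_coef_log_bounded _ (G := fun w M => qsym (zeta_pts 0 M.+1) w)) => // w iw.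
by apply: zeta_pts_log_bounded => //; apply: off_poles0.
Qed.

Lemma zeta_taylor_asymp m k : is_index k -> asymp (zeta_taylor m k) (fun M => zeta_reg_coef m
    (harmC R M) k).
Proof.
move=> ik; under [X in asymp _ X]eq_fun do rewrite zeta_reg_coefE.
apply: (taylor_coef_asymp _ (G := fun w M => qsym (zeta_pts 0 M.+1) w)) => // w iw.
have := zeta_reg_asymp (off_poles0 R) iw.
by under [X in asymp _ X]eq_fun do rewrite harmonic0 subr0.
Qed.

Lemma zeta_reg_coef_log_bounded m k : is_index k -> log_bounded (fun M => zeta_reg_coef m
    (harmC R M) k).
Proof. by move=> ik; apply: log_bounded_asymp (asymp_sym (zeta_taylor_asymp m ik))
    (zeta_taylor_log_bounded m ik). Qed.

Definition log_bounded2 (u : nat -> nat -> C) := exists2 D : R, 0 <= D & exists p, forall a b,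
  nrm (u a b) <= D * lgauge (a + b)%N ^+ p.

Lemma log_bounded2_cst c : log_bounded2 (fun _ _ => c).
Proof. by exists (nrm c); rewrite ?nrm_ge0 //; exists 0%N => a b; rewrite mulr1. Qed.
Lemma log_bounded2D u v : log_bounded2 u -> log_bounded2 v -> log_bounded2 (fun a b => u a b +
    v a b).
Proof.
move=> [D D0 [p hu]] [E E0 [q hv]]; exists (D + E); first exact: addr_ge0.
exists (maxn p q) => a b; apply: le_trans (nrmD _ _) _; rewrite mulrDl lerD //.
  by apply: le_trans (hu a b) _; rewrite ler_wpM2l // lgaugeX_le // leq_maxl.
by apply: le_trans (hv a b) _; rewrite ler_wpM2l // lgaugeX_le // leq_maxr.
Qed.
Lemma log_bounded2M u v : log_bounded2 u -> log_bounded2 v ->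
    log_bounded2 (fun a b => u a b * v a b).
Proof.
move=> [D D0 [p hu]] [E E0 [q hv]]; exists (D * E); first exact: mulr_ge0.
by exists (p + q)%N => a b; rewrite nrmM exprD mulrACA ler_pM // nrm_ge0.
Qed.
Lemma log_bounded2_sum I (r : seq I) (P : pred I) (F : I -> nat -> nat -> C) :
  (forall i, P i -> log_bounded2 (F i)) -> log_bounded2 (fun a b => \sum_(i <- r | P i) F i a b).
Proof.
move=> h; elim: r => [|i r IH].
  by have [D D0 [p hD]] := log_bounded2_cst 0; exists D => //; exists p => a b; rewrite big_nil.
have [D D0 [p hD]] : log_bounded2 (fun a b => (if P i then F i a b else 0) + \sum_(i <- r | P
    i) F i a b).
  by apply: log_bounded2D => //; case Pi: (P i); [exact: h|exact: log_bounded2_cst].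
by exists D => //; exists p => a b; rewrite big_cons; case: ifP (hD a b) => //; rewrite add0r.
Qed.
Lemma log_bounded2_l u : log_bounded u -> log_bounded2 (fun a _ => u a).
Proof.
move=> [D D0 [p h]]; exists D => //; exists p => a b; apply: le_trans (h a) _.
by rewrite ler_wpM2l // lgaugeX_le // leq_addr.
Qed.
Lemma log_bounded2_r u : log_bounded u -> log_bounded2 (fun _ b => u b).
Proof.
move=> [D D0 [p h]]; exists D => //; exists p => a b; apply: le_trans (h b) _.
by rewrite ler_wpM2l // lgaugeX_le // leq_addl.
Qed.

Lemma is_index_take j k : is_index k -> is_index (take j k).
Proof. by rewrite /is_index => /allP h; apply/allP => x /mem_take /h. Qed.
Lemma is_index_drop j k : is_index k -> is_index (drop j k).
Proof. by rewrite /is_index => /allP h; apply/allP => x /mem_drop /h. Qed.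
Lemma is_index_rev k : is_index (rev k) = is_index k.
Proof. exact: all_rev. Qed.

(** Reflection of the points on the left turns their sums into truncated zeta values
    of reversed indices. With zeta_reg_coef in place of zeta_taylor the inner sum is
    C_{j,m} for m = k_j - q, where j is counted from 0. *)
Lemma laurent_intE q k a b : is_index k -> laurent_int q k a b =
  \sum_(j < size k | (q <= nth 0%N k j)%N) \sum_(i < (nth 0%N k j - q).+1)
    (-1) ^+ (sumn (take j k) + i) * zeta_taylor i (rev (take j k)) a *
    zeta_taylor (nth 0%N k j - q - i)%N (drop j.+1 k) b.
Proof.
move=> ik; apply: eq_bigr => j _; rewrite fpsM; apply: eq_bigr => i _.
by rewrite left_diffs_inv_series ?is_index_take // right_diffs_inv_series.
Qed.

Lemma laurent_int_log_bounded2 q k : is_index k -> log_bounded2 (laurent_int q k).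
Proof.
move=> ik; have [D D0 [p h]] : log_bounded2 (fun a b =>
  \sum_(j < size k | (q <= nth 0%N k j)%N) \sum_(i < (nth 0%N k j - q).+1)
    (-1) ^+ (sumn (take j k) + i) * zeta_taylor i (rev (take j k)) a *
    zeta_taylor (nth 0%N k j - q - i)%N (drop j.+1 k) b).
  apply: log_bounded2_sum => j _; apply: log_bounded2_sum => i _; apply: log_bounded2M;
      first apply: log_bounded2M.
  - exact: log_bounded2_cst.
  - by apply: log_bounded2_l; apply: zeta_taylor_log_bounded; rewrite is_index_rev is_index_take.
  - by apply: log_bounded2_r; apply: zeta_taylor_log_bounded; rewrite is_index_drop.
by exists D => //; exists p => a b; rewrite laurent_intE.
Qed.

Lemma laurent_int_unif q k K : is_index k -> exists2 D : R, 0 <= D & exists p, forall i a b,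
    (i < K)%N ->
  nrm (laurent_int (q + i)%N k a b) <= D * lgauge (a + b)%N ^+ p.
Proof.
move=> ik; elim: K => [|K [D D0 [p h]]]; first by exists 0 => //; exists 0%N.
have [E E0 [r hE]] := laurent_int_log_bounded2 (q + K)%N ik.
exists (D + E); first exact: addr_ge0.
exists (maxn p r) => i a b; rewrite ltnS leq_eqVlt => /orP[/eqP->|/h hi].
  apply: le_trans (hE a b) _; rewrite ler_pM ?lgaugeX_ge0 ?lgaugeX_le ?leq_maxr //; lra.
apply: le_trans (hi a b) _; rewrite ler_pM ?lgaugeX_ge0 ?lgaugeX_le ?leq_maxl //; lra.
Qed.

(** The leading term has the factor 1/m only if x = 1 and p = 0; all other terms gain
    1/m^2. So a better bound E e on V 0 alone is enough for an improvement. *)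
Lemma inv_pow_coef_sum_bound K x (d : C) (V : nat -> C) (E e m : R) :
  (0 < x)%N -> 0 <= E -> 0 <= e -> 1 <= m -> nrm d = m ->
  (forall p, (p < K)%N -> nrm (V p) <= E) -> (x = 1%N -> nrm (V 0%N) <= E * e) ->
  nrm (\sum_(p < K) inv_pow_coef x p d * V p) <=
    (\sum_(p < K) 'C((x + p).-1, p)%:R) * E * (e / m + (m ^+ 2)^-1).
Proof.
move=> x0 E0 e0 m1 dm hV hV0.
have m0 : 0 < m by lra.
apply: le_trans (nrm_sum _ _ _) _; rewrite !mulr_suml; apply: ler_sum => p _.
rewrite nrmM /inv_pow_coef !nrmM nrm_sign mul1r nrm_nat nrmV nrmX dm -!mulrA.
rewrite ler_wpM2l //.
have em : 0 <= e / m by rewrite divr_ge0 // ltW.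
have m2 : 0 <= (m ^+ 2)^-1 by rewrite invr_ge0 exprn_ge0 // ltW.
have [/andP[/eqP x1 /eqP p0]|xp] := boolP ((x == 1%N) && (p == 0 :> nat)).
  rewrite p0 x1 expr1; apply: le_trans (_ : m^-1 * (E * e) <= _).
    by rewrite ler_wpM2l ?invr_ge0 ?(ltW m0) // hV0.
  rewrite mulrC -mulrA ler_wpM2l //; lra.
apply: le_trans (_ : (m ^+ 2)^-1 * E <= _).
  apply: ler_pM; rewrite ?invr_ge0 ?nrm_ge0 ?exprn_ge0 ?(ltW m0) ?hV //.
  rewrite lef_pV2 ?posrE ?exprn_gt0 // ler_weXn2l //.
  by move: xp; case: (nat_of_ord p) => [|?]; case: (x) x0 => [|[|?]].
rewrite mulrC ler_wpM2l //; lra.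
Qed.

Lemma nrm_opp_nat n : nrm (- n%:R) = n%:R.
Proof. by rewrite nrmN nrm_nat. Qed.

(** Shifted by one, so that it is defined at 0. *)
Definition recip n : R := n.+1%:R^-1.
Lemma recip_ge0 n : 0 <= recip n. Proof. by rewrite invr_ge0. Qed.
Lemma recip_le1 n : recip n <= 1. Proof. by rewrite invf_le1 // ler1n. Qed.
Lemma recip_le m n : (m <= n)%N -> recip n <= recip m.
Proof. by move=> mn; rewrite lef_pV2 ?posrE ?ltr0n // ler_nat. Qed.
Lemma recip_nat m n : (m <= n.+1)%N -> m%:R * recip n <= 1.
Proof. by move=> mn; rewrite ler_pdivrMr ?ltr0n // mul1r ler_nat. Qed.

Lemma index_le_sumn k : is_index k -> all (fun e => 0 < e <= sumn k)%N k.
Proof.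
move=> ik; apply/allP => e ek; apply/andP; split; first exact: (allP ik).
by elim: k ek {ik} => //= z s IH; rewrite inE => /orP[/eqP->|/IH]; lia.
Qed.

Lemma index_leq_sumn k : is_index k -> all (leq^~ (sumn k)) k.
Proof. by move=> /index_le_sumn; apply: sub_all => e /andP[]. Qed.

(** Adding a point at distance a + 1 on the left changes the coefficients by a sum
    with factors 1/(a+1)^x, x >= 1 being the first exponent; likewise on the right
    with the last exponent. *)
Lemma laurent_int_step q k : (0 < q)%N -> is_index k -> exists2 D : R, 0 <= D & exists p,
    forall a b,
  nrm (laurent_int q k a.+1 b - laurent_int q k a b) <= D * lgauge (a + b)%N ^+ p * recip a /\
  nrm (laurent_int q k a b.+1 - laurent_int q k a b) <= D * lgauge (a + b)%N ^+ p * recip b.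
Proof.
move=> q0; case: k => [|x k] ik.
  by exists 0 => //; exists 0%N => a b; rewrite /laurent_int !laurent_nil subrr nrm0 !mul0r.
have [k2 [y ek]] : exists k2 y, x :: k = rcons k2 y by rewrite lastI; eexists; eexists.
pose K := sumn (x :: k).
have aK : all (leq^~ K) (x :: k) by exact: index_leq_sumn.
have /andP[x0 ik1] := ik; have /andP[_ aK1] := aK.
have /andP[y0 ik2] : (0 < y)%N && is_index k2 by move: ik; rewrite ek /is_index all_rcons.
have aK2 : all (leq^~ K) k2 by move: aK; rewrite ek all_rcons => /andP[].
have [D1 D10 [p1 h1]] := laurent_int_unif q K ik1.
have [D2 D20 [p2 h2]] := laurent_int_unif q K ik2.
pose Cx z : R := \sum_(p < K) 'C((z + p).-1, p)%:R.
have Cx0 z : 0 <= Cx z by apply: sumr_ge0.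
exists (2 * Cx x * D1 + 2 * Cx y * D2); first by rewrite addr_ge0 // !mulr_ge0.
exists (maxn p1 p2) => a b.
have bnd z (V : nat -> C) d n E : (0 < z)%N -> 0 <= E -> nrm d = n.+1%:R ->
    (forall p, (p < K)%N -> nrm (V p) <= E) ->
    nrm (\sum_(p < K) inv_pow_coef z p d * V p) <= 2 * Cx z * E * recip n.
  move=> z0 E0 hd hV.
  have K0 : (0 < K)%N by rewrite /K /= addn_gt0 x0.
  apply: le_trans (@inv_pow_coef_sum_bound K z d V E 1 n.+1%:R z0 E0 ler01 _ hd hV _) _.
  - by rewrite ler1n.
  - by move=> _; rewrite mulr1 hV.
  rewrite -/(Cx z) (_ : 2 * _ * _ * _ = Cx z * E * (recip n + recip n)); last by ring.
  rewrite ler_wpM2l ?mulr_ge0 // mul1r lerD2l expr2 invfM -/(recip n).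
  by rewrite ler_piMr ?recip_ge0 ?recip_le1.
have L1 : lgauge (a + b)%N ^+ p1 <= lgauge (a + b)%N ^+ maxn p1 p2 by rewrite lgaugeX_le //
    leq_maxl.
have L2 : lgauge (a + b)%N ^+ p2 <= lgauge (a + b)%N ^+ maxn p1 p2 by rewrite lgaugeX_le //
    leq_maxr.
split.
  rewrite (@laurent_int_left K) // [X in nrm X]addrC addKr.
  apply: le_trans (bnd x _ _ a (D1 * lgauge (a + b)%N ^+ p1) x0 _ (nrm_opp_nat _) (fun p => h1
      p a b)) _.
    by rewrite mulr_ge0 ?lgaugeX_ge0.
  rewrite ler_wpM2r ?recip_ge0 // mulrA ler_pM ?mulr_ge0 ?lgaugeX_ge0 // lerDl !mulr_ge0 //.
rewrite ek (@laurent_int_right K) // [X in nrm X]addrC addKr.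
apply: le_trans (bnd y _ _ b (D2 * lgauge (a + b)%N ^+ p2) y0 _ (nrm_nat _ _) (fun p => h2 p a
    b)) _.
  by rewrite mulr_ge0 ?lgaugeX_ge0.
rewrite ler_wpM2r ?recip_ge0 // mulrA ler_pM ?mulr_ge0 ?lgaugeX_ge0 // lerDr !mulr_ge0 //.
Qed.

End Laurent.

(** * Residues with vanishing sum are small *)

Section Average.
Variable R : realType.
Implicit Types (k : seq nat) (a b q M T : nat).
Local Notation C := R[i].
Local Notation lgauge := (@lgauge R).
Local Notation harm := (@harm R).
Local Notation nrm := (@nrm R).
Local Notation recip := (@recip R).

Lemma nrm_telescope (v : nat -> C) m n : (m <= n)%N ->
  nrm (v n - v m) <= \sum_(m <= j < n) nrm (v j.+1 - v j).
Proof. by move=> mn; rewrite -telescope_sumr //; apply: nrm_sum. Qed.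

Lemma recip_tail : exists2 D : R, 0 <= D & forall m n, \sum_(m <= j < n) recip j * recip j <=
    D * recip m.
Proof.
have [D D0 h] := tail_bound R 0; exists D => // m n.
apply: le_trans (_ : \sum_(m <= j < n) lgauge j ^+ 0 / j.+1%:R ^+ 2 <= _).
  by apply: ler_sum => j _; rewrite expr0 mul1r -expr2 -exprVn.
by apply: le_trans (h m n) _; rewrite expr0 mulr1.
Qed.

(** The path from (m0, m1), close to the diagonal, first lowers the second coordinate
    to b and then raises the first one. The terms of order 1/j^2 on the first part
    have tail O(1/b); each of the others is O(1 / (m0 b)), and there are at most m0 +
    1 of them on either part. *)
Lemma path_bound (w : nat -> nat -> C) (E D : R) m0 m1 b :
  0 <= E -> (m1 <= m0.+1)%N -> (b <= m1)%N ->
  (forall m n, \sum_(m <= j < n) recip j * recip j <= D * recip m) ->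
  (forall a c, (a + c < m0 + m1)%N -> nrm (w a.+1 c - w a c) <= E * (recip a * recip c +
      recip a * recip a)) ->
  (forall a c, (a + c < m0 + m1)%N -> nrm (w a c.+1 - w a c) <= E * (recip a * recip c +
      recip c * recip c)) ->
  nrm (w (m0 + (m1 - b))%N b - w m0 m1) <= E * (4 + D) * recip b.
Proof.
move=> E0 m10 bm hD h1 h2.
have s1 : nrm (w m0 m1 - w m0 b) <= E * ((1 + D) * recip b).
  apply: le_trans (nrm_telescope _ bm) _.
  apply: le_trans (_ : \sum_(b <= j < m1) E * (recip m0 * recip b + recip j * recip j) <= _).
    apply: ler_sum_nat => j /andP[bj jm]; apply: le_trans (h2 _ _ _) _; first by lia.
    by rewrite ler_wpM2l // lerD2r ler_wpM2l ?recip_ge0 // recip_le.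
  rewrite -mulr_sumr ler_wpM2l // big_split /= mulrDl lerD //.
  rewrite big_const_nat iter_addr_0 -mulr_natl mulrA mul1r ler_piMl ?recip_ge0 // recip_nat //; lia.
have ivb : recip m0 <= 2 * recip b.
  rewrite /recip -[2]invrK -invfM lef_pV2 ?posrE ?mulr_gt0 ?invr_gt0 ?ltr0n //.
  by rewrite mulrC ler_pdivrMr // -natrM ler_nat; lia.
have s2 : nrm (w (m0 + (m1 - b))%N b - w m0 b) <= E * (3 * recip b).
  apply: le_trans (nrm_telescope (fun a => w a b) (leq_addr _ _)) _.
  apply: le_trans (_ : \sum_(m0 <= j < m0 + (m1 - b)) E * (recip m0 * recip b +
      recip m0 * recip m0) <= _).
    apply: ler_sum_nat => j /andP[bj jm]; apply: le_trans (h1 _ _ _) _; first by lia.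
    rewrite ler_wpM2l //; have := recip_le R bj; have := recip_ge0 R j; have := recip_ge0 R m0;
        have := recip_ge0 R b.
    by move: (recip m0) (recip b) (recip j) => x y z; nra.
  rewrite big_const_nat iter_addr_0 addKn -[leLHS]mulr_natl mulrCA ler_wpM2l //.
  rewrite -mulrDr mulrA; apply: le_trans (_ : 1 * (recip b + recip m0) <= _); last by lra.
  by rewrite ler_wpM2r ?addr_ge0 ?recip_ge0 // recip_nat //; lia.
apply: le_trans (nrm_dist _ _ (w m0 b)) _; rewrite (nrmBC (w m0 b)).
by apply: le_trans (lerD s2 s1) _; rewrite -mulrDr -mulrA ler_wpM2l //; lra.
Qed.

Lemma sum_recip n : \sum_(i < n) recip i = harm n.
Proof. by []. Qed.
Lemma sum_recip_rev n : \sum_(i < n.+1) recip (n - i)%N = harm n.+1.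
Proof.
rewrite -sum_recip (reindex_inj rev_ord_inj); apply: eq_bigr => i _ /=.
by rewrite subSS subKn // -ltnS.
Qed.

Lemma harm_lgauge n : harm n.+1 <= lgauge n.
Proof. by rewrite harmS /lgauge addrC lerD2r; apply: recip_le1. Qed.

(** Along a diagonal a + c = T all values are close to the central one by
    [path_bound], and up to powers of the gauge the errors add up to O(log T). As the
    values themselves add up to 0, the central one is O(log T / T), which bounds all
    of them. *)
Lemma average_zero_bound (w : nat -> nat -> C) (B : R) p : 0 <= B ->
  (forall a c, nrm (w a.+1 c - w a c) <= B * lgauge (a + c)%N ^+ p * (recip a * recip c +
      recip a * recip a)) ->
  (forall a c, nrm (w a c.+1 - w a c) <= B * lgauge (a + c)%N ^+ p * (recip a * recip c +
      recip c * recip c)) ->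
  (forall T, \sum_(i < T.+1) w i (T - i)%N = 0) ->
  exists2 D : R, 0 <= D & forall a b, nrm (w a b) <= D * lgauge (a + b)%N ^+ p.+1 * (recip a +
      recip b).
Proof.
move=> B0 h1 h2 hs; have [D0 D00 hD] := recip_tail.
pose G := B * (4 + D0); have G0 : 0 <= G by rewrite mulr_ge0 // addr_ge0.
exists (3 * G); first by rewrite mulr_ge0.
move=> a b; set T := (a + b)%N.
pose m0 := T./2; pose m1 := (T - m0)%N.
have m01 : (m0 + m1 = T)%N by rewrite /m1 /m0; lia.
have m10 : (m1 <= m0.+1)%N by rewrite /m1 /m0; lia.
have m00 : (m0 <= m1)%N by rewrite /m1 /m0; lia.
pose E := B * lgauge T ^+ p; have E0 : 0 <= E by rewrite mulr_ge0 ?lgaugeX_ge0.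
have mono a' c : (a' + c < T)%N -> B * lgauge (a' + c)%N ^+ p <= E.
  by move=> h; rewrite ler_wpM2l // lgaugeX_le // ltnW.
have pos a' c d : 0 <= recip a' * recip c + recip d * recip d by rewrite addr_ge0 ?mulr_ge0
    ?recip_ge0.
have centre i : (i <= T)%N -> nrm (w i (T - i)%N - w m0 m1) <= G * lgauge T ^+ p * (recip i +
    recip (T - i)%N).
  move=> iT; have [im|im] := leqP m0 i.
    have bm : (T - i <= m1)%N by rewrite /m1; lia.
    have := @path_bound w E D0 m0 m1 (T - i)%N E0 m10 bm hD.
    rewrite (_ : m0 + (m1 - (T - i)) = i)%N; last by lia.
    move=> /(_ _ _) h; apply: le_trans (h _ _) _.
    - move=> a' c l; apply: le_trans (h1 _ _) _; rewrite ler_wpM2r // mono //; lia.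
    - move=> a' c l; apply: le_trans (h2 _ _) _; rewrite ler_wpM2r // mono //; lia.
    rewrite (_ : G * _ * _ = E * (4 + D0) * (recip i + recip (T - i)%N));
        last by rewrite /G /E; ring.
    by rewrite ler_wpM2l ?mulr_ge0 ?lgaugeX_ge0 ?addr_ge0 // lerDr recip_ge0.
  have bm : (i <= m0)%N by lia.
  have := @path_bound (fun x y => w y x) E D0 m1 m0 i E0 (leqW m00) bm hD.
  rewrite (_ : m1 + (m0 - i) = T - i)%N; last by lia.
  move=> /(_ _ _) h; apply: le_trans (h _ _) _.
  - move=> a' c l; apply: le_trans (h2 _ _) _; rewrite [recip c * _]mulrC ler_wpM2r // mono //; lia.
  - move=> a' c l; apply: le_trans (h1 _ _) _; rewrite [recip c * recip a']mulrC ler_wpM2r //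
      mono //; lia.
  rewrite (_ : G * _ * _ = E * (4 + D0) * (recip i + recip (T - i)%N)); last by rewrite /G /E; ring.
  by rewrite ler_wpM2l ?mulr_ge0 ?lgaugeX_ge0 ?addr_ge0 // lerDl recip_ge0.
(* The T + 1 values on the diagonal add up to 0, so the central one is minus the mean deviation. *)
have cen : nrm (w m0 m1) <= 2 * G * lgauge T ^+ p.+1 * recip T.
  rewrite /recip ler_pdivlMr ?ltr0n // -[X in _ * X](nrm_nat R) -nrmM mulr_natr.
  have -> : w m0 m1 *+ T.+1 = - \sum_(i < T.+1) (w i (T - i)%N - w m0 m1).
    by rewrite sumrB hs sub0r opprK sumr_const card_ord.
  rewrite nrmN; apply: le_trans (nrm_sum _ _ _) _.
  apply: le_trans (_ : \sum_(i < T.+1) G * lgauge T ^+ p * (recip i + recip (T - i)%N) <= _).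
    by apply: ler_sum => i _; apply: centre; rewrite -ltnS.
  rewrite -mulr_sumr big_split /= sum_recip sum_recip_rev.
  rewrite (_ : 2 * G * _ = G * lgauge T ^+ p * (2 * lgauge T)); last by rewrite exprS; ring.
  by rewrite ler_wpM2l ?mulr_ge0 ?lgaugeX_ge0 //; have := harm_lgauge T; lra.
have := centre a (leq_addr _ _); rewrite addKn => c1.
rewrite -[w a b](subrK (w m0 m1)); apply: le_trans (nrmD _ _) _.
apply: le_trans (lerD c1 cen) _.
have LL : lgauge T ^+ p <= lgauge T ^+ p.+1 by rewrite lgaugeX_le.
have L0 := lgaugeX_ge0 R T p.+1.
rewrite (_ : 3 * G * _ * _ = G * lgauge T ^+ p.+1 * (recip a + recip b) + 2 * G * lgauge T ^+
    p.+1 * (recip a + recip b)); last by ring.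
apply: lerD.
  by rewrite ler_wpM2r ?addr_ge0 ?recip_ge0 // ler_wpM2l.
apply: ler_wpM2l; first by apply: mulr_ge0 => //; apply: mulr_ge0.
by apply: le_trans (recip_le R (leq_addr b a)) _; rewrite lerDl recip_ge0.
Qed.

Definition nats T : seq C := [seq i%:R | i <- iota 0 T].

Lemma size_nats T : size (nats T) = T.
Proof. by rewrite size_map size_iota. Qed.
Lemma nth_nats T i : (i < T)%N -> nth 0 (nats T) i = i%:R.
Proof. by move=> iT; rewrite (nth_map 0%N) ?size_iota // nth_iota. Qed.
Lemma uniq_nats T : uniq (nats T).
Proof.
rewrite map_inj_uniq ?iota_uniq // => i j /eqP; rewrite eqr_nat => /eqP //.
Qed.

Lemma laurent_at_nats q k T i : (i <= T)%N -> laurent_at q k (nats T.+1) i =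
    laurent_int R q k i (T - i)%N.
Proof.
move=> iT; rewrite /laurent_at /laurent_int nth_nats //; congr (laurent q k _ _).
  rewrite /nats /left_diffs -map_take take_iota -map_comp (minn_idPl _); last by lia.
  apply: (@eq_from_nth _ 0); first by rewrite !size_map size_rev.
  move=> j; rewrite size_map size_iota => ji.
  rewrite !(nth_map 0%N) ?size_rev ?size_iota //= nth_rev ?size_iota // !nth_iota ?add0n //;
      last by lia.
  by rewrite -opprB -natrB 1?ltnW //; congr (- _%:R); lia.
rewrite /nats /right_diffs -map_drop drop_iota -map_comp.
apply: (@eq_from_nth _ 0); first by rewrite !size_map !size_iota; lia.
move=> j; rewrite size_map size_iota => ji.
rewrite !(nth_map 0%N) ?size_iota //=.
have ji2 : (j < T.+1 - i.+1)%N by [].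
rewrite !nth_iota //.
by rewrite add0n -natrB; [congr (_%:R); lia|lia].
Qed.

Lemma residue_sum_int k T : is_index k -> k != [:: 1%N] ->
  \sum_(i < T.+1) laurent_int R 1 k i (T - i)%N = 0.
Proof.
move=> ik k1.
have := @residue_sum C (sumn k) k (nats T.+1) (uniq_nats _) (index_le_sumn ik) k1.
rewrite size_nats => h; rewrite -[RHS]h.
by apply: eq_bigr => i _; rewrite laurent_at_nats // -ltnS.
Qed.

Lemma le_sum4 (x y z t : R) : 0 <= x -> 0 <= y -> 0 <= z -> 0 <= t ->
  [/\ x <= x + y + z + t, y <= x + y + z + t, z <= x + y + z + t & t <= x + y + z + t].
Proof. by move=> *; split; lra. Qed.

Lemma leq_sum4 (m n p q : nat) :
  [/\ m <= m + n + p + q, n <= m + n + p + q, p <= m + n + p + q & q <= m + n + p + q]%N.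
Proof. by split; lia. Qed.

(** Induction on the depth. When a point is added on the left, the residue changes by
    Laurent coefficients of the index without its first entry x. Up to logarithms, if
    x >= 2 the change is O(1/a^2); if x = 1 the shorter index is again not made of
    ones, and its residue, small by induction, supplies the missing factor. The same
    holds on the right. Now [average_zero_bound] applies, since the residues add up to
    0. *)
Lemma residue_small k : is_index k -> k != nseq (size k) 1%N ->
  exists2 D : R, 0 <= D & exists p, forall a b,
    nrm (laurent_int R 1 k a b) <= D * lgauge (a + b)%N ^+ p * (recip a + recip b).
Proof.
move: {2}(size k) (leqnn (size k)) => n; elim: n k => [|n IH] k.
  by rewrite leqn0 => /nilP ->.
case: k => [//|x k] sk ik k1.
have [k2 [y ek]] : exists k2 y, x :: k = rcons k2 y by rewrite lastI; eexists; eexists.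
have sk2 : size k2 = size k by have := congr1 size ek; rewrite size_rcons /= => -[].
pose K := sumn (x :: k).
have aK : all (leq^~ K) (x :: k) by exact: index_leq_sumn.
have /andP[x0 ik1] := ik; have /andP[_ aK1] := aK.
have /andP[y0 ik2] : (0 < y)%N && is_index k2 by move: ik; rewrite ek /is_index all_rcons.
have aK2 : all (leq^~ K) k2 by move: aK; rewrite ek all_rcons => /andP[].
have [D1 D10 [p1 h1]] := laurent_int_unif R 1 K ik1.
have [D2 D20 [p2 h2]] := laurent_int_unif R 1 K ik2.
have [E1 E10 [r1 g1]] : exists2 D : R, 0 <= D & exists p, forall a b, x = 1%N ->
    nrm (laurent_int R 1 k a b) <= D * lgauge (a + b)%N ^+ p * (recip a + recip b).
  have [x1|x1] := eqVneq x 1%N; last by exists 0 => //; exists 0%N => a b /eqP; rewrite (negbTE x1).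
  have kn : k != nseq (size k) 1%N by apply: contra k1 => /eqP {1}->; rewrite x1.
  have [D D0 [p h]] := IH k sk ik1 kn; by exists D => //; exists p.
have [E2 E20 [r2 g2]] : exists2 D : R, 0 <= D & exists p, forall a b, y = 1%N ->
    nrm (laurent_int R 1 k2 a b) <= D * lgauge (a + b)%N ^+ p * (recip a + recip b).
  have [y1|y1] := eqVneq y 1%N; last by exists 0 => //; exists 0%N => a b /eqP; rewrite (negbTE y1).
  have kn : k2 != nseq (size k2) 1%N.
    apply: contra k1 => /eqP e; rewrite ek e y1 size_rcons size_nseq.
    by apply/eqP; elim: (size k2) => //= m ->.
  have [|D D0 [p h]] := IH k2 _ ik2 kn; first by rewrite sk2.
  by exists D => //; exists p.
pose Cx z : R := \sum_(p < K) 'C((z + p).-1, p)%:R.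
have Cx0 z : 0 <= Cx z by apply: sumr_ge0.
pose P := (p1 + p2 + r1 + r2)%N.
pose D := D1 + D2 + E1 + E2.
have D0 : 0 <= D by rewrite /D !addr_ge0.
have [D1D D2D E1D E2D] : [/\ D1 <= D, D2 <= D, E1 <= D & E2 <= D] by exact: le_sum4.
have [P1 P2 P3 P4] : [/\ p1 <= P, p2 <= P, r1 <= P & r2 <= P]%N by exact: leq_sum4.
clearbody D P.
have bnd z (V : nat -> C) (d : C) m l L : (0 < z)%N -> 0 <= L -> nrm d = m.+1%:R ->
    (forall p, (p < K)%N -> nrm (V p) <= D * L) ->
    (z = 1%N -> nrm (V 0%N) <= D * L * (recip l + recip m)) ->
    nrm (\sum_(p < K) inv_pow_coef z p d * V p) <=
      2 * Cx z * D * L * (recip l * recip m + recip m * recip m).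
  move=> z0 L0 hd hV hV0.
  apply: le_trans (@inv_pow_coef_sum_bound R K z d V (D * L) (recip l + recip m) m.+1%:R z0 _ _
      _ hd hV hV0) _.
  - by rewrite mulr_ge0.
  - by rewrite addr_ge0 ?recip_ge0.
  - by rewrite ler1n.
  rewrite -/(Cx z) (_ : 2 * _ * _ * _ * _ = Cx z * (D * L) * (2 * (recip l * recip m +
      recip m * recip m))); last by ring.
  rewrite ler_wpM2l ?mulr_ge0 // expr2 invfM -/(recip m).
  have := mulr_ge0 (recip_ge0 R l) (recip_ge0 R m); lra.
have LP (F : R) q T : 0 <= F -> F <= D -> (q <= P)%N -> F * lgauge T ^+ q <= D * lgauge T ^+ P.
  by move=> F0 FD qP; rewrite ler_pM ?lgaugeX_ge0 ?lgaugeX_le.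
suff [DD DD0 hDD] : exists2 DD : R, 0 <= DD & forall a b,
    nrm (laurent_int R 1 (x :: k) a b) <= DD * lgauge (a + b)%N ^+ P.+1 * (recip a + recip b).
  by exists DD => //; exists P.+1.
apply: (@average_zero_bound (laurent_int R 1 (x :: k)) (2 * Cx x * D + 2 * Cx y * D) P).
- by rewrite addr_ge0 ?mulr_ge0.
- move=> a c; rewrite (@laurent_int_left _ K) // [X in nrm X]addrC addKr [recip a * recip c]mulrC.
  apply: le_trans (bnd x (fun p => laurent_int R (1 + p)%N k a c) _ a c (lgauge (a +
      c)%N ^+ P) x0 _ (nrm_opp_nat _ _) _ _) _.
  + exact: lgaugeX_ge0.
  + move=> p pK; apply: le_trans (h1 p a c pK) _; exact: LP.
  + move=> x1; apply: le_trans (g1 a c x1) _; rewrite [recip c + _]addrC ler_wpM2r ?addr_ge0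
      ?recip_ge0 //.
    exact: LP.
  rewrite ler_wpM2r ?addr_ge0 ?mulr_ge0 ?recip_ge0 // ler_wpM2r ?lgaugeX_ge0 // lerDl !mulr_ge0 //.
- move=> a c; rewrite ek (@laurent_int_right _ K) // [X in nrm X]addrC addKr.
  apply: le_trans (bnd y (fun p => laurent_int R (1 + p)%N k2 a c) _ c a (lgauge (a +
      c)%N ^+ P) y0 _ (nrm_nat _ _) _ _) _.
  + exact: lgaugeX_ge0.
  + move=> p pK; apply: le_trans (h2 p a c pK) _; exact: LP.
  + move=> y1; apply: le_trans (g2 a c y1) _; rewrite ler_wpM2r ?addr_ge0 ?recip_ge0 //.
    exact: LP.
  rewrite ler_wpM2r ?addr_ge0 ?mulr_ge0 ?recip_ge0 // ler_wpM2r ?lgaugeX_ge0 // lerDr !mulr_ge0 //.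
- move=> T; apply: residue_sum_int => //.
  by apply: contra k1 => /eqP ->.
Qed.

End Average.

(** * Truncated multitangent sums *)

Section Multitangent.
Variable R : realType.
Local Notation C := R[i].
Local Notation lgauge := (@lgauge R).
Local Notation harm := (@harm R).
Local Notation nrm := (@nrm R).
Local Notation recip := (@recip R).
Local Notation laurent_int := (@laurent_int R).
Implicit Types (k : seq nat) (a b q M T : nat) (s : C).

Lemma sum_centre (V : nmodType) M (F : nat -> V) :
  \sum_(i < (M + M).+1) F i = F M + \sum_(n < M) (F (M - n.+1)%N + F (M + n.+1)%N).
Proof.
rewrite big_split /= -(big_mkord xpredT F) (@big_cat_nat _ _ _ M) //=; last by lia.
rewrite big_mkord (reindex_inj rev_ord_inj) /= addrCA; congr (_ + _).
rewrite big_ltn; last by lia.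
congr (_ + _); rewrite -{1}[M.+1]add0n big_addn subSS addnK big_mkord.
by apply: eq_bigr => n _; rewrite !addnS addnC.
Qed.

Definition noninteger s := forall n : int, s <> n%:~R.

Lemma nonintegerN s : noninteger s -> noninteger (- s).
Proof. by move=> h n e; apply: (h (- n)); rewrite mulrNz -e opprK. Qed.

Lemma noninteger_neq0 s (n : nat) : noninteger s -> (n%:R + s != 0) /\ (- n%:R + s != 0).
Proof.
move=> h; split; apply/eqP => e.
  by apply: (h (- n%:Z)); rewrite mulrNz -pmulrn -[s](addKr n%:R) e addr0.
by apply: (h n%:Z); rewrite -pmulrn -[s](addNKr n%:R) e addr0.
Qed.

Lemma off_poles_noninteger s : noninteger s -> off_poles s.
Proof. by move=> h; apply: off_polesP => n; have [] := noninteger_neq0 n.+1 h. Qed.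

Lemma pt_bound s : noninteger s -> exists2 c : R, 0 <= c & forall j,
  nrm (j%:R + s)^-1 <= c * recip j /\ nrm (- j%:R + s)^-1 <= c * recip j.
Proof.
move=> h.
have recip2 j : recip j <= 2 * recip j.+1.
  rewrite /recip -[2]invrK -invfM lef_pV2 ?posrE ?mulr_gt0 ?invr_gt0 ?ltr0n //.
  by rewrite mulrC ler_pdivrMr // -natrM ler_nat; lia.
have one t : noninteger t -> exists2 c : R, 0 <= c & forall j, nrm (j%:R + t)^-1 <= c * recip j.
  move=> ht; have [c c0 hc] := off_poles_pt (off_poles_noninteger ht).
  exists (2 * c + nrm t^-1); first by rewrite addr_ge0 ?mulr_ge0 ?nrm_ge0 // ltW.
  case=> [|j]; first by rewrite add0r /recip invr1 mulr1 lerDr mulr_ge0 // ltW.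
  have := hc j 1%N; rewrite !expr1 -/(recip j) => h1; apply: le_trans h1 _.
  have h2 := recip2 j; have h3 := mulr_ge0 (nrm_ge0 t^-1) (recip_ge0 R j.+1).
  have h4 : c * recip j <= c * (2 * recip j.+1) by rewrite ler_wpM2l // ltW.
  by rewrite mulrDl; lra.
have [c c0 hc] := one _ h; have [d d0 hd] := one _ (nonintegerN h).
exists (c + d); first exact: addr_ge0.
move=> j; split.
  by apply: le_trans (hc j) _; rewrite ler_wpM2r ?recip_ge0 // lerDl.
have -> : - j%:R + s = - (j%:R - s) by ring.
rewrite invrN nrmN; apply: le_trans (hd j) _.
by rewrite ler_wpM2r ?recip_ge0 // lerDr.
Qed.

Lemma shift_neq0 s T M m : noninteger s -> m \in nats R T -> m + (s - M%:R) != 0.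
Proof.
move=> hs /mapP[j _ ->]; apply/negP => /eqP e0; apply: (hs (M%:Z - j%:Z)).
rewrite mulrzBr -!pmulrn; move/(congr1 (fun z => z + (M%:R - j%:R))): e0.
by rewrite add0r => <-; ring.
Qed.

(** The interval -M <= n <= M is written as m - M with 0 <= m <= 2M, so that the
    results on intervals starting at 0 apply, with s - M in place of s. *)
Definition multitangent_pts s M : seq C := [seq (m + (s - M%:R))^-1 | m <- nats R (M + M).+1].
Definition multitangent_trunc s k M : C := qsym (multitangent_pts s M) k.

Lemma multitangent_ptsE s M : multitangent_pts s M = rev [seq -1 * y | y <- zeta_pts (- s)
    M.+1] ++ s^-1 :: zeta_pts s M.+1.
Proof.
rewrite /multitangent_pts /nats -map_comp -addnS iotaD map_cat add0n /=; congr (_ ++ _ :: _).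
- rewrite /zeta_pts -map_comp -[iota 1 _]/(iota (1 + 0) M) iotaDl -map_comp -map_rev.
  apply: (@eq_from_nth _ 0); first by rewrite !size_map size_rev.
  move=> j; rewrite size_map size_iota => jM.
  rewrite !(nth_map 0%N) ?size_rev ?size_iota //= nth_rev ?size_iota // !nth_iota ?add0n //;
      last by lia.
  rewrite mulN1r -invrN; congr (_^-1).
  by rewrite add1n subnSK // natrB ?(ltnW jM) -?natr1; [ring|lia].
- by rewrite addrC subrK.
rewrite /zeta_pts -[M.+1]addn1 iotaDl -!map_comp addn1 /=.
by apply: eq_map => j /=; rewrite !natrD; congr (_^-1); ring.
Qed.

(** Splitting the increasing sequences at 0, and according to whether 0 occurs in
    them, gives the two sums in the definition of the regularized multitangent
    function; the negative points are reflected. *)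
Lemma multitangent_trunc_asymp s k : noninteger s -> is_index k ->
  asymp (multitangent_trunc s k) (fun M => multitangent_reg (harmC R M) k s).
Proof.
move=> hs ik.
have fs := off_poles_noninteger hs; have fs' := off_poles_noninteger (nonintegerN hs).
pose L j M := qsym (zeta_pts (- s) M.+1) (rev (take j k)).
pose Q j M := qsym (zeta_pts s M.+1) (drop j k).
have -> : multitangent_trunc s k = (fun M => \sum_(0 <= j < (size k).+1) (-1) ^+ sumn (take j
    k) * L j M * Q j M +
  \sum_(1 <= j < (size k).+1)
    (-1) ^+ sumn (take j.-1 k) / s ^+ nth 0%N k j.-1 * L j.-1 M * Q j M).
  apply/funext => M; rewrite /multitangent_trunc multitangent_ptsE qsym_cat big_mkord.
  have E1 j : qsym (rev [seq -1 * y | y <- zeta_pts (- s) M.+1]) (take j k) =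
      (-1) ^+ sumn (take j k) * L j M.
    by rewrite -{1}(revK (take j k)) qsym_rev qsym_scale sumn_rev.
  under eq_bigr => j _ do rewrite E1.
  rewrite big_add1 /= big_mkord big_ord_recr [X in _ = X + _]big_ord_recr /=.
  rewrite addrAC -big_split /=; congr (_ + _); last first.
    by rewrite /Q drop_size qsym_nil.
  apply: eq_bigr => j _; rewrite (drop_nth 0%N (ltn_ord j)) -(drop_nth 0%N (ltn_ord j)).
  by rewrite exprVn /Q; ring.
have LB j : log_bounded (fun M => zeta_reg (harmC R M - harmonic_fun (- s)) (rev (take j k)) (- s)).
  exact: zeta_reg_log_bounded.
have QB j : log_bounded (fun M => zeta_reg (harmC R M - harmonic_fun s) (drop j k) s).
  exact: zeta_reg_log_bounded.
have LA j : asymp (L j) (fun M => zeta_reg (harmC R M - harmonic_fun (- s)) (rev (take j k)) (- s)).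
  by apply: zeta_reg_asymp => //; rewrite is_index_rev is_index_take.
have QA j : asymp (Q j) (fun M => zeta_reg (harmC R M - harmonic_fun s) (drop j k) s).
  by apply: zeta_reg_asymp => //; rewrite is_index_drop.
apply: asympD; apply: asymp_sum => j _; apply: asympM => //.
- exact: asympZ.
- by apply: log_boundedM => //; exact: log_bounded_cst.
- exact: asympZ.
- by apply: log_boundedM => //; exact: log_bounded_cst.
Qed.

Lemma multitangent_trunc_pf s k K M : noninteger s -> all (fun e => 0 < e <= K)%N k ->
  multitangent_trunc s k M = (k == [::])%:R + \sum_(i < (M + M).+1) \sum_(q < K)
    laurent_int q.+1 k i (M + M - i)%N * (i%:R + (s - M%:R))^-1 ^+ q.+1.
Proof.
move=> hs kK.
have := @partial_fractions C K k (nats R (M + M).+1) (uniq_nats _ _) kK C idfun (s - M%:R)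
  (fun m => (m + (s - M%:R))^-1).
rewrite /multitangent_trunc /multitangent_pts size_nats => -> /=; last first.
  by move=> m mT; rewrite mulfV // (shift_neq0 M hs mT).
congr (_ + _); apply: eq_bigr => i _; apply: eq_bigr => q _.
by rewrite laurent_at_nats ?nth_nats // -ltnS.
Qed.

(** The bounds carry a factor for the distance to the boundary of the interval and one
    for the distance to its centre; 1 / ((M - n) (n + 1)) splits into partial
    fractions and the sum over n is O(log M / M). *)
Lemma convolution_bound M (F : nat -> C) (E : R) : 0 <= E ->
  nrm (F M) <= E * recip M ->
  (forall n, (n < M)%N -> nrm (F (M - n.+1)%N) <= E * (recip (M - n.+1)%N * recip n)) ->
  (forall n, (n < M)%N -> nrm (F (M + n.+1)%N) <= E * (recip (M - n.+1)%N * recip n)) ->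
  nrm (\sum_(i < (M + M).+1) F i) <= 4 * E * lgauge M * recip M.
Proof.
move=> E0 h0 h1 h2; rewrite sum_centre.
apply: le_trans (nrmD _ _) _.
apply: le_trans (_ : E * recip M + \sum_(n < M) 2 * E * (recip M * (recip (M - n.+1)%N +
    recip n)) <= _).
  apply: lerD => //; apply: le_trans (nrm_sum _ _ _) _; apply: ler_sum => n _.
  have nM := ltn_ord n.
  apply: le_trans (nrmD _ _) _; apply: le_trans (lerD (h1 _ nM) (h2 _ nM)) _.
  rewrite (_ : recip M * _ = recip (M - n.+1)%N * recip n); first by lra.
  rewrite /recip subnSK //.
  have -> : M.+1%:R = (M - n)%:R + n.+1%:R :> R by rewrite -natrD; congr (_%:R); lia.
  have p1 : 0 < (M - n)%:R :> R by rewrite ltr0n subn_gt0.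
  have p2 : 0 < n.+1%:R :> R by rewrite ltr0n.
  by move: ((M - n)%:R : R) (n.+1%:R : R) p1 p2 => x y x0 y0; field; lra.
rewrite -!mulr_sumr big_split /= sum_recip.
have -> : \sum_(n < M) recip (M - n.+1)%N = harm M.
  rewrite -sum_recip (reindex_inj rev_ord_inj); apply: eq_bigr => n _ /=.
  by rewrite subnSK // subKn // ltnW.
rewrite (_ : 4 * E * lgauge M * recip M = E * recip M * (4 + 4 * harm M));
    last by rewrite /lgauge; ring.
rewrite (_ : _ + _ = E * recip M * (1 + 4 * harm M)); last by ring.
by rewrite ler_wpM2l ?mulr_ge0 ?recip_ge0 //; have := harm_ge0 R M; lra.
Qed.

Lemma lgauge_add M : lgauge (M + M)%N <= 2 * lgauge M.
Proof.
suff h n : (n <= M)%N -> lgauge (M + n)%N <= lgauge M + n%:R * recip M.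
  apply: le_trans (h M (leqnn M)) _.
  by have := recip_nat R (leqnSn M); have := lgauge_ge1 R M; lra.
elim: n => [|n IH] nM; first by rewrite addn0 mul0r addr0.
rewrite addnS lgaugeS -[n.+1%:R]natr1 mulrDl mul1r addrA; apply: lerD; first by apply: IH;
    exact: ltnW.
by apply: recip_le; rewrite leq_addr.
Qed.

(** From the centre to the point at distance n each of the 2 n steps has size at most
    E / (M - n + 1). *)
Lemma path_bound1 (w : nat -> nat -> C) (E : R) M n : 0 <= E -> (n <= M)%N ->
  (forall a c, (a + c < M + M)%N -> nrm (w a.+1 c - w a c) <= E * recip a) ->
  (forall a c, (a + c < M + M)%N -> nrm (w a c.+1 - w a c) <= E * recip c) ->
  nrm (w (M + n)%N (M - n)%N - w M M) <= 2 * n%:R * E * recip (M - n)%N.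
Proof.
move=> E0 nM h1 h2.
have s1 : nrm (w M M - w M (M - n)%N) <= n%:R * (E * recip (M - n)%N).
  apply: le_trans (nrm_telescope _ (leq_subr _ _)) _.
  apply: le_trans (_ : \sum_(M - n <= j < M) E * recip (M - n)%N <= _).
    apply: ler_sum_nat => j /andP[bj jm]; apply: le_trans (h2 _ _ _) _; first by lia.
    by rewrite ler_wpM2l // recip_le.
  by rewrite big_const_nat iter_addr_0 subKn // mulr_natl.
have s2 : nrm (w (M + n)%N (M - n)%N - w M (M - n)%N) <= n%:R * (E * recip (M - n)%N).
  apply: le_trans (nrm_telescope (fun a => w a (M - n)%N) (leq_addr _ _)) _.
  apply: le_trans (_ : \sum_(M <= j < M + n) E * recip (M - n)%N <= _).
    apply: ler_sum_nat => j /andP[bj jm]; apply: le_trans (h1 _ _ _) _; first by lia.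
    by rewrite ler_wpM2l // recip_le //; lia.
  by rewrite big_const_nat iter_addr_0 addKn mulr_natl.
apply: le_trans (nrm_dist _ _ (w M (M - n)%N)) _; rewrite (nrmBC (w M (M - n)%N)).
apply: le_trans (lerD s2 s1) _; lra.
Qed.

Definition power_sum s q M : C := \sum_(i < (M + M).+1) (i%:R + (s - M%:R))^-1 ^+ q.

Lemma centre_pt s M n : (n <= M)%N ->
  (M - n)%:R + (s - M%:R) = - n%:R + s /\ (M + n)%:R + (s - M%:R) = n%:R + s.
Proof. by move=> nM; rewrite natrB // natrD; split; ring. Qed.

Lemma log_small_lgauge2 (u : nat -> C) : (exists2 D : R, 0 <= D & exists p, forall M,
  nrm (u M) <= D * lgauge (M + M)%N ^+ p * lgauge M * recip M) -> log_small u.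
Proof.
move=> [D D0 [p h]]; exists (D * 2 ^+ p); first by rewrite mulr_ge0 // exprn_ge0.
exists p.+1 => M; apply: le_trans (h M) _; rewrite ler_wpM2r ?recip_ge0 //.
rewrite exprSr mulrA ler_wpM2r ?lgauge_ge0 // -mulrA ler_wpM2l // -exprMn.
by apply: pow_le; rewrite ?lgauge_ge0 ?lgauge_add.
Qed.

(** At distance n from the centre w differs from its central value by O(n/(M-n)) up to
    logarithms, while g is O(1/n^2); the products are summed by [convolution_bound]. *)
Lemma coef_centre_gen (w : nat -> nat -> C) (g : nat -> nat -> C) :
  (exists2 D : R, 0 <= D & exists p, forall a b,
    nrm (w a.+1 b - w a b) <= D * lgauge (a + b)%N ^+ p * recip a /\
    nrm (w a b.+1 - w a b) <= D * lgauge (a + b)%N ^+ p * recip b) ->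
  (exists2 c : R, 0 <= c & forall M n, (n < M)%N ->
    nrm (g M (M - n.+1)%N) <= c * (recip n.+1 * recip n.+1) /\
    nrm (g M (M + n.+1)%N) <= c * (recip n.+1 * recip n.+1)) ->
  asymp (fun M => \sum_(i < (M + M).+1) w i (M + M - i)%N * g M i)
      (fun M => w M M * \sum_(i < (M + M).+1) g M i).
Proof.
move=> [D D0 [p h]] [c c0 hc].
apply: log_small_lgauge2; exists (8 * D * c); first by rewrite !mulr_ge0.
exists p => M; rewrite mulr_sumr -sumrB.
under eq_bigr => i _ do rewrite -mulrBl.
pose E := D * lgauge (M + M)%N ^+ p; have E0 : 0 <= E by rewrite mulr_ge0 ?lgaugeX_ge0.
have mono a b : (a + b < M + M)%N -> D * lgauge (a + b)%N ^+ p <= E.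
  by move=> l; rewrite ler_wpM2l // lgaugeX_le // ltnW.
rewrite (_ : 8 * D * c * _ * _ * _ = 4 * (2 * E * c) * lgauge M * recip M); last by rewrite /E;
    ring.
clearbody E; pose F i := (w i (M + M - i)%N - w M M) * g M i.
have h1 a b : (a + b < M + M)%N -> nrm (w a.+1 b - w a b) <= E * recip a.
  by move=> l; apply: le_trans (h a b).1 _; rewrite ler_wpM2r ?recip_ge0 ?mono.
have h2 a b : (a + b < M + M)%N -> nrm (w a b.+1 - w a b) <= E * recip b.
  by move=> l; apply: le_trans (h a b).2 _; rewrite ler_wpM2r ?recip_ge0 ?mono.
have h1' a b : (a + b < M + M)%N -> nrm (w b.+1 a - w b a) <= E * recip b.
  by rewrite addnC; apply: h1.
have h2' a b : (a + b < M + M)%N -> nrm (w b a.+1 - w b a) <= E * recip a.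
  by rewrite addnC; apply: h2.
have ivq n y : nrm y <= c * (recip n.+1 * recip n.+1) -> n.+1%:R * nrm y <= c * recip n.
  move=> hy; apply: le_trans (_ : n.+1%:R * (c * (recip n.+1 * recip n.+1)) <= _).
    by rewrite ler_wpM2l.
  rewrite mulrCA ler_wpM2l // mulrA; apply: le_trans (_ : 1 * recip n.+1 <= _).
    by rewrite ler_wpM2r ?recip_ge0 // recip_nat //; lia.
  by rewrite mul1r recip_le.
apply: (@convolution_bound M F).
- by rewrite !mulr_ge0.
- by rewrite /F addnK subrr mul0r nrm0 !mulr_ge0 ?recip_ge0.
- move=> n nM; rewrite /F nrmM.
  rewrite (_ : M + M - (M - n.+1) = M + n.+1)%N; last by lia.
  have cor := @path_bound1 (fun a b => w b a) E M n.+1 E0 nM h2' h1'.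
  apply: le_trans (ler_wpM2r (nrm_ge0 _) cor) _.
  have := ivq _ _ (hc M n nM).1; move: (nrm _) (recip _) (recip_ge0 R (M - n.+1)%N) => x y y0 hx.
  rewrite (_ : _ * x = 2 * E * y * (n.+1%:R * x)); last by ring.
  rewrite (_ : 2 * E * c * _ = 2 * E * y * (c * recip n)); last by ring.
  by rewrite ler_wpM2l // !mulr_ge0.
- move=> n nM; rewrite /F nrmM.
  rewrite (_ : M + M - (M + n.+1) = M - n.+1)%N; last by lia.
  apply: le_trans (ler_wpM2r (nrm_ge0 _) (@path_bound1 w E M n.+1 E0 nM h1 h2)) _.
  have := ivq _ _ (hc M n nM).2; move: (nrm _) (recip _) (recip_ge0 R (M - n.+1)%N) => x y y0 hx.
  rewrite (_ : _ * x = 2 * E * y * (n.+1%:R * x)); last by ring.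
  rewrite (_ : 2 * E * c * _ = 2 * E * y * (c * recip n)); last by ring.
  by rewrite ler_wpM2l // !mulr_ge0.
Qed.

Lemma coef_centre s (w : nat -> nat -> C) q : noninteger s -> (2 <= q)%N ->
  (exists2 D : R, 0 <= D & exists p, forall a b,
    nrm (w a.+1 b - w a b) <= D * lgauge (a + b)%N ^+ p * recip a /\
    nrm (w a b.+1 - w a b) <= D * lgauge (a + b)%N ^+ p * recip b) ->
  asymp (fun M => \sum_(i < (M + M).+1) w i (M + M - i)%N * (i%:R + (s - M%:R))^-1 ^+ q)
      (fun M => w M M * power_sum s q M).
Proof.
move=> hs q2 hw; have [c c0 hc] := pt_bound hs.
apply: (@coef_centre_gen w (fun M i => (i%:R + (s - M%:R))^-1 ^+ q)) => //.
exists (c ^+ q); first by rewrite exprn_ge0.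
have st n y : nrm y <= c * recip n -> nrm (y ^+ q) <= c ^+ q * (recip n * recip n).
  move=> hy; rewrite nrmX; apply: le_trans (_ : (c * recip n) ^+ q <= _).
    by apply: pow_le => //; exact: nrm_ge0.
  rewrite exprMn ler_wpM2l ?exprn_ge0 // -expr2.
  by rewrite ler_wiXn2l // ?recip_ge0 ?recip_le1.
move=> M n nM; rewrite (centre_pt s nM).1 (centre_pt s nM).2.
by split; apply: st; have [] := hc n.+1.
Qed.

(** At distance n from the centre the coefficient is O(1 / (M - n)) up to logarithms
    and the pole contributes O(1 / n); [convolution_bound] sums the products. *)
Lemma residue_part s (w : nat -> nat -> C) : noninteger s ->
  (exists2 D : R, 0 <= D & exists p, forall a b,
    nrm (w a b) <= D * lgauge (a + b)%N ^+ p * (recip a + recip b)) ->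
  log_small (fun M => \sum_(i < (M + M).+1) w i (M + M - i)%N * (i%:R + (s - M%:R))^-1).
Proof.
move=> hs [D D0 [p h]]; have [c c0 hc] := pt_bound hs.
apply: log_small_lgauge2; exists (8 * D * c); first by rewrite !mulr_ge0.
exists p => M.
pose E := D * lgauge (M + M)%N ^+ p; have E0 : 0 <= E by rewrite mulr_ge0 ?lgaugeX_ge0.
rewrite (_ : 8 * D * c * _ * _ * _ = 4 * (2 * E * c) * lgauge M * recip M); last by rewrite /E;
    ring.
pose F i := w i (M + M - i)%N * (i%:R + (s - M%:R))^-1.
have hE i : (i <= M + M)%N -> nrm (w i (M + M - i)%N) <= E * (recip i + recip (M + M - i)%N).
  by move=> iM; apply: le_trans (h _ _) _; rewrite subnKC.
clearbody E.
have hw i l : (i <= M + M)%N -> (l <= i)%N -> (l <= M + M - i)%N -> nrm (w i (M + M - i)%N) <=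
    2 * E * recip l.
  move=> iM li li'; apply: le_trans (hE _ iM) _.
  have := recip_le R li; have := recip_le R li' => x y.
  by rewrite [2 * E]mulrC -mulrA ler_wpM2l //; lra.
apply: (@convolution_bound M F).
- by rewrite !mulr_ge0.
- rewrite /F nrmM; have := (centre_pt s (leq0n M)).2; rewrite addn0 add0r => ->.
  rewrite [leRHS]mulrAC ler_pM ?nrm_ge0 ?hw ?leq_addl ?addnK //.
  by have := (hc 0%N).1; rewrite add0r /recip invr1 mulr1.
- move=> n nM; rewrite /F (centre_pt s nM).1 nrmM.
  rewrite (_ : 2 * E * c * _ = 2 * E * recip (M - n.+1)%N * (c * recip n)); last by ring.
  rewrite ler_pM ?nrm_ge0 ?hw //; try lia.
  by apply: le_trans (hc n.+1).2 _; rewrite ler_wpM2l // recip_le.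
- move=> n nM; rewrite /F (centre_pt s nM).2 nrmM.
  rewrite (_ : 2 * E * c * _ = 2 * E * recip (M - n.+1)%N * (c * recip n)); last by ring.
  rewrite ler_pM ?nrm_ge0 ?hw //; try lia.
  by apply: le_trans (hc n.+1).1 _; rewrite ler_wpM2l // recip_le.
Qed.

End Multitangent.

(** * Indices with an entry greater than one *)

Section Final.
Variable R : realType.
Local Notation C := R[i].
Local Notation lgauge := (@lgauge R).
Local Notation nrm := (@nrm R).
Local Notation recip := (@recip R).
Local Notation laurent_int := (@laurent_int R).
Implicit Types (k : seq nat) (a b q M T : nat) (s : C).

Lemma power_sum_split s q M : power_sum s q M =
  \sum_(0 <= n < M.+1) (n%:R + s) ^- q + \sum_(1 <= n < M.+1) (- n%:R + s) ^- q.
Proof.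
rewrite /power_sum (sum_centre M (fun i => (i%:R + (s - M%:R))^-1 ^+ q)).
rewrite big_add1 big_mkord big_mkord big_ord_recl -addrA; congr (_ + _).
  by rewrite exprVn add0r addrC subrK.
rewrite -big_split /=; apply: eq_bigr => n _.
by rewrite !(centre_pt s (ltn_ord n)).1 !(centre_pt s (ltn_ord n)).2 !exprVn addrC.
Qed.

(** For q >= 2 the two halves converge separately. For q = 1 the terms for n and -n
    are paired, and 1/(s+n) + 1/(s-n) = 2 s / ((s+n) (s-n)). *)
Lemma power_sum_asymp s q : noninteger s -> (0 < q)%N ->
    asymp (power_sum s q) (fun=> monotangent q s).
Proof.
move=> hs q0; have [c c0 hc] := pt_bound hs.
pose u M := \sum_(0 <= n < M.+1) (n%:R + s) ^- q.
pose v M := \sum_(1 <= n < M.+1) (- n%:R + s) ^- q.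
have recip2 M : recip M.+1 <= recip M by apply: recip_le.
have [q1|q1] := eqVneq q 1%N.
  pose w M := u M + v M.
  have [l hl] : exists l, asymp w (fun=> l).
    apply: log_small_cauchy; exists (2 * nrm s * c ^+ 2);
        first by rewrite !mulr_ge0 ?nrm_ge0 ?exprn_ge0.
    exists 0%N => M; rewrite mulr1.
    have [n1 n2] := noninteger_neq0 M.+1 hs.
    have -> : w M.+1 - w M = (2 * s) * (M.+1%:R + s)^-1 * (- M.+1%:R + s)^-1.
      rewrite /w /u /v q1 ?expr1 big_nat_recr //= (@big_nat_recr _ _ _ M.+1) //=.
      rewrite ?expr1 (_ : _ - _ = (M.+1%:R + s)^-1 + (- M.+1%:R + s)^-1); last by ring.
      by move: n1 n2; move: (M.+1%:R : C) => m n1 n2; field; rewrite n1 n2.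
    have [h1 h2] := hc M.+1.
    rewrite !nrmM nrm_nat -!mulrA ler_wpM2l // ler_wpM2l ?nrm_ge0 //.
    apply: le_trans (ler_pM (nrm_ge0 _) (nrm_ge0 _) h1 h2) _.
    rewrite [leRHS]mulrA mulrACA -!expr2 ler_wpM2l ?exprn_ge0 // -exprVn; apply: pow_le;
        first exact: recip_ge0.
    exact: recip2.
  have -> : monotangent q s = l.
    rewrite /monotangent q1 eqxx; apply: limn_asymp; apply: eq_log_small hl => M.
    by rewrite /w /u /v q1.
  by apply: eq_log_small hl => M; rewrite power_sum_split.
have q2 : (2 <= q)%N by case: (q) q0 q1 => [|[|]].
have st (y : C) M : nrm y^-1 <= c * recip M.+1 -> nrm (y ^- q) <= c ^+ q * lgauge M ^+ 0 /
    M.+1%:R ^+ 2.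
  move=> hy; rewrite -[y ^- q]exprVn nrmX mulr1; apply: le_trans (_ : (c * recip M.+1) ^+ q <= _).
    by apply: pow_le => //; exact: nrm_ge0.
  rewrite exprMn ler_wpM2l ?exprn_ge0 // -exprVn; apply: le_trans (_ : recip M ^+ q <= _).
    by apply: pow_le => //; exact: recip_ge0.
  by rewrite ler_wiXn2l // ?recip_ge0 ?recip_le1.
have [l hl] : exists l, asymp u (fun=> l).
  apply: log_small_cauchy; exists (c ^+ q); first by rewrite exprn_ge0.
  exists 0%N => M; rewrite /u big_nat_recr //= [X in nrm X]addrC addKr.
  by apply: st; have [] := hc M.+1.
have [l' hl'] : exists l, asymp v (fun=> l).
  apply: log_small_cauchy; exists (c ^+ q); first by rewrite exprn_ge0.
  exists 0%N => M; rewrite /v big_nat_recr //= [X in nrm X]addrC addKr.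
  by apply: st; have [] := hc M.+1.
have -> : monotangent q s = l + l'.
  rewrite /monotangent (negbTE q1); congr (_ + _); exact: limn_asymp.
by apply: eq_log_small (asympD hl hl') => M; rewrite power_sum_split.
Qed.

(** The total coefficient of the monotangent function of order q. *)
Definition pole_coef (X : C) k q : C :=
  \sum_(j < size k | (q <= nth 0%N k j)%N) coef_C X k j.+1 (nth 0%N k j - q)%N.

Lemma coef_C_log_bounded k j m : is_index k -> log_bounded (fun M => coef_C (harmC R M) k j m).
Proof.
move=> ik; apply: log_bounded_sum => a _; apply: log_boundedM; first apply: log_boundedM.
- exact: log_bounded_cst.
- by apply: zeta_reg_coef_log_bounded; rewrite is_index_rev is_index_take.
- by apply: zeta_reg_coef_log_bounded; rewrite is_index_drop.
Qed.

Lemma laurent_int_centre_asymp k q : is_index k ->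
  asymp (fun M => laurent_int q k M M) (fun M => pole_coef (harmC R M) k q).
Proof.
move=> ik; under eq_fun do rewrite laurent_intE //.
apply: asymp_sum => j _; rewrite /coef_C; under [X in asymp _ X]eq_fun do rewrite big_mkord.
apply: asymp_sum => i _.
have ir : is_index (rev (take j k)) by rewrite is_index_rev is_index_take.
have id : is_index (drop j.+1 k) by rewrite is_index_drop.
apply: asympM.
- by apply: asympZ; apply: zeta_taylor_asymp.
- exact: zeta_taylor_asymp.
- by apply: log_boundedM; [exact: log_bounded_cst|apply: zeta_reg_coef_log_bounded].
- exact: zeta_reg_coef_log_bounded.
Qed.

Lemma main_sumE (X : C) k s K : all (fun e => 0 < e <= K)%N k ->
  \sum_(1 <= j < (size k).+1)
      \sum_(0 <= m < (nth 0%N k j.-1).-1)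
        coef_C X k j m * monotangent (nth 0%N k j.-1 - m) s =
  \sum_(1 <= q < K) pole_coef X k q.+1 * monotangent q.+1 s.
Proof.
move=> kK; rewrite big_add1 big_mkord /=.
under [RHS]eq_bigr => q _ do rewrite /pole_coef mulr_suml big_mkcond.
rewrite exchange_big /=; apply: eq_bigr => j _.
have /andP[e0 eK] : (0 < nth 0%N k j <= K)%N by move/all_nthP: kK => /(_ 0%N j (ltn_ord j)).
set e := nth _ _ _ in e0 eK *.
rewrite -big_mkcond (@big_cat_nat _ _ _ e) //=.
rewrite [X in _ = _ + X]big_nat_cond [X in _ = _ + X]big_pred0 ?addr0; last by move=> i; lia.
transitivity (\sum_(1 <= q < e) coef_C X k j.+1 (e - q.+1)%N * monotangent q.+1 s); last first.
  by rewrite [LHS]big_nat_cond [RHS]big_nat_cond; apply: eq_bigl => q; lia.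
rewrite big_add1 [RHS]big_nat_rev /= add0n !big_mkord; apply: eq_bigr => q _.
have qe := ltn_ord q.
congr (coef_C _ _ _ _ * monotangent _ _); lia.
Qed.

(** The partial fractions, with the simple poles dropped and the coefficients of the
    others replaced by their central values. *)
Lemma multitangent_trunc_main s k K : noninteger s -> is_index k -> all (fun e => 0 < e <= K)%N k ->
  k != nseq (size k) 1%N ->
  asymp (multitangent_trunc s k) (fun M => \sum_(1 <= q < K) pole_coef (harmC R M) k q.+1 *
      monotangent q.+1 s).
Proof.
move=> hs ik kK k1.
have k0 : (k == [::]) = false by apply: contraNF k1 => /eqP ->.
pose F q M := \sum_(i < (M + M).+1) laurent_int q.+1 k i (M + M - i)%N * (i%:R + (s - M%:R))^-1
    ^+ q.+1.
have K0 : (0 < K)%N by move: k0 kK; case: (k) => //= x l _ /andP[]; lia.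
have e : multitangent_trunc s k = (fun M => F 0%N M + \sum_(1 <= q < K) F q M).
  apply/funext => M; rewrite (@multitangent_trunc_pf R s k K) // k0 add0r exchange_big /=.
  by rewrite -(big_mkord xpredT (fun q => F q M)) big_ltn.
have F0 : asymp (F 0%N) (fun=> 0).
  have := residue_part hs (residue_small R ik k1); apply: eq_log_small => M.
  by rewrite subr0; apply: eq_bigr => i _; rewrite expr1.
rewrite e; apply: (@asymp_trans _ (fun M => 0 + \sum_(1 <= q < K) F q M)).
  by apply: asympD => //; exact: asymp_refl.
under eq_fun do rewrite add0r big_nat_cond; under [X in asymp _ X]eq_fun do rewrite big_nat_cond.
apply: asymp_sum => q /andP[/andP[q1 _] _].
apply: (@asymp_trans _ (fun M => laurent_int q.+1 k M M * power_sum s q.+1 M)).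
  by apply: coef_centre => //; apply: laurent_int_step.
apply: asympM.
- exact: laurent_int_centre_asymp.
- exact: power_sum_asymp.
- by apply: log_bounded_sum => j _; exact: coef_C_log_bounded.
- exact: log_bounded_cst.
Qed.

Definition is_poly (f : C -> C) := exists p : {poly C}, forall X, f X = p.[X].

Lemma is_poly_cst c : is_poly (fun=> c).
Proof. by exists c%:P => X; rewrite hornerC. Qed.
Lemma is_polyD f g : is_poly f -> is_poly g -> is_poly (fun X => f X + g X).
Proof. by move=> [p hp] [q hq]; exists (p + q) => X; rewrite hornerD hp hq. Qed.
Lemma is_polyM f g : is_poly f -> is_poly g -> is_poly (fun X => f X * g X).
Proof. by move=> [p hp] [q hq]; exists (p * q) => X; rewrite hornerM hp hq. Qed.
Lemma is_poly_sum I (r : seq I) (P : pred I) (F : I -> C -> C) :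
  (forall i, is_poly (F i)) -> is_poly (fun X => \sum_(i <- r | P i) F i X).
Proof.
move=> h; elim: r => [|i r [p hp]]; first by exists 0 => X; rewrite big_nil horner0.
have [q hq] := h i; case Pi: (P i).
  by exists (q + p) => X; rewrite big_cons Pi hornerD hp hq.
by exists p => X; rewrite big_cons Pi hp.
Qed.
Lemma is_poly_zeta_reg c k s : is_poly (fun X => zeta_reg (X - c) k s).
Proof.
exists (zreg_poly k s \Po ('X - c%:P)) => X.
by rewrite horner_comp !hornerE zreg_polyE.
Qed.
Lemma is_poly_multitangent k s : is_poly (fun X => multitangent_reg X k s).
Proof.
apply: is_polyD; apply: is_poly_sum => j; apply: is_polyM; try apply: is_polyM;
  try exact: is_poly_cst; exact: is_poly_zeta_reg.
Qed.
Lemma is_poly_taylor_coef m k (G : seq nat -> C -> C) : (forall w, is_poly (G w)) ->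
  is_poly (fun X => taylor_coef m k (fun w => G w X)).
Proof.
elim: k m G => [|x k IH] m G hG /=; first by apply: is_polyM; [exact: is_poly_cst|exact: hG].
apply: is_poly_sum => i; apply: is_polyM; first exact: is_poly_cst.
exact: (IH _ (fun w => G ((x + i)%N :: w))).
Qed.
Lemma is_poly_zeta_reg_coef m k : is_poly (fun X => zeta_reg_coef m X k).
Proof.
have [p hp] : is_poly (fun X => taylor_coef m k (fun w => zeta_reg (X - 0) w 0)).
  by apply: (is_poly_taylor_coef _ _ (G := fun w X => zeta_reg (X - 0) w 0)) => w;
      exact: is_poly_zeta_reg.
by exists p => X; rewrite -hp subr0 zeta_reg_coefE.
Qed.
Lemma is_poly_coef_C k j m : is_poly (fun X => coef_C X k j m).
Proof.
apply: is_poly_sum => a; apply: is_polyM; first apply: is_polyM;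
  try exact: is_poly_cst; exact: is_poly_zeta_reg_coef.
Qed.

(** The harmonic numbers are unbounded, so a polynomial that is small at all of them
    is 0. *)
Lemma poly_identity (f g : C -> C) : is_poly f -> is_poly g ->
  asymp (fun M => f (harmC R M)) (fun M => g (harmC R M)) -> f =1 g.
Proof.
move=> [p hp] [q hq] h X; apply/eqP; rewrite -subr_eq0 hp hq -hornerN -hornerD.
rewrite (@poly_asymp0 R (p - q)) ?horner0 //.
by apply: eq_log_small h => M; rewrite hornerD hornerN hp hq.
Qed.

Lemma theorem_not_ones k (T s : C) : noninteger s -> is_index k -> k != nseq (size k) 1%N ->
  multitangent_reg T k s =
    \sum_(1 <= j < (size k).+1)
      \sum_(0 <= m < (nth 0%N k j.-1).-1)
        coef_C T k j m * monotangent (nth 0%N k j.-1 - m) s.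
Proof.
move=> hs ik k1; pose f X := multitangent_reg X k s.
pose g X := \sum_(1 <= j < (size k).+1)
      \sum_(0 <= m < (nth 0%N k j.-1).-1)
        coef_C X k j m * monotangent (nth 0%N k j.-1 - m) s.
apply: (@poly_identity f g).
- exact: is_poly_multitangent.
- apply: is_poly_sum => j; apply: is_poly_sum => m; apply: is_polyM; last exact: is_poly_cst.
  exact: is_poly_coef_C.
apply: asymp_trans (asymp_sym (multitangent_trunc_asymp hs ik)) _.
have := multitangent_trunc_main hs ik (index_le_sumn ik) k1; apply: eq_log_small => M.
by rewrite /g (main_sumE _ _ (index_le_sumn ik)).
Qed.

End Final.

(** * Elementary symmetric functions of the inverse shifted integers *)

Section Elem.
Variable F : fieldType.
Implicit Types (ms : seq F).

(** The generating series of the elementary symmetric functions of the 1/m, that is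
    the product of the 1 + X/m. *)
Definition elem_sym ms : fps F := fun r => qsym [seq m^-1 | m <- ms] (nseq r 1%N).

Lemma elem_sym_cons m ms : elem_sym (m :: ms) = (1 + fpsC m^-1 * fpsX F) * elem_sym ms.
Proof.
apply/funext => r; rewrite mulrDl mul1r -mulrA fpsD fpsCM fpsXM /elem_sym.
case: r => [|r]; first by rewrite /= qsym_nil mulr0 addr0.
by rewrite /= expr1.
Qed.

Lemma fps_derivC (c : F) : fps_deriv (fpsC c) = 0.
Proof. by apply/funext => -[|n]; rewrite /fps_deriv /= mul0rn. Qed.
Lemma fps_derivX : fps_deriv (fpsX F) = 1.
Proof. by apply/funext => -[|n]; rewrite /fps_deriv /fpsX fps1 //= mul0rn. Qed.
Lemma deriv_lin (y : F) : fps_deriv (1 + fpsC y * fpsX F) = fpsC y.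
Proof.
rewrite fps_derivD fps_derivM fps_derivX fps_derivC mul0r add0r mulr1.
by rewrite -[1]/(fpsC 1) fps_derivC add0r.
Qed.

Lemma inv_series_lin m : m != 0 -> inv_series m * (1 + fpsC m^-1 * fpsX F) = fpsC m^-1.
Proof.
move=> m0; have -> : 1 + fpsC m^-1 * fpsX F = fpsC m^-1 * (fpsC m + fpsX F).
  by rewrite mulrDr -rmorphM mulVf // rmorph1.
by rewrite mulrCA [inv_series m * _]mulrC inv_seriesE // mulr1.
Qed.

(** Logarithmic derivative of the product: each factor contributes (1/m) / (1 + X/m) =
    1 / (m + X). *)
Lemma elem_sym_deriv ms : (forall m, m \in ms -> m != 0) ->
  fps_deriv (elem_sym ms) = qsym [seq inv_series m | m <- ms] [:: 1%N] * elem_sym ms.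
Proof.
elim: ms => [_|m ms IH ms0].
  rewrite /= mul0r; apply/funext => n; rewrite /fps_deriv /elem_sym /= mul0rn //.
have m0 : m != 0 by apply: ms0; rewrite mem_head.
rewrite elem_sym_cons fps_derivM deriv_lin IH; last by move=> x h; apply: ms0; rewrite inE h orbT.
rewrite map_cons qsym_cons expr1 qsym_nil mulr1.
set E := elem_sym ms; set P := qsym _ [:: 1%N]; have e := inv_series_lin m0.
have -> : (P + inv_series m) * ((1 + fpsC m^-1 * fpsX F) * E) =
   P * (1 + fpsC m^-1 * fpsX F) * E + (inv_series m * (1 + fpsC m^-1 * fpsX F)) * E by ring.
rewrite e; ring.
Qed.

(** If E' = P E, then E'' = (P^2 + P') E, and P^2 + P' is the sum of P's products over
    ordered pairs of distinct points. Peeling off one point proves this without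
    dividing by E. *)
Lemma elem_sym_deriv2 ms : (forall m, m \in ms -> m != 0) ->
  fps_deriv (fps_deriv (elem_sym ms)) = (qsym [seq inv_series m | m <- ms] [:: 1;
      1]%N *+ 2) * elem_sym ms.
Proof.
elim: ms => [_|m ms IH ms0].
  rewrite /= mul0rn mul0r; apply/funext => n; rewrite /fps_deriv /elem_sym /= !mul0rn //.
have m0 : m != 0 by apply: ms0; rewrite mem_head.
have ms0' x : x \in ms -> x != 0 by move=> h; apply: ms0; rewrite inE h orbT.
rewrite elem_sym_cons fps_derivM deriv_lin fps_derivD !fps_derivM fps_derivC deriv_lin mul0r
    add0r IH //.
rewrite map_cons qsym_cons expr1 elem_sym_deriv //.
have e := inv_series_lin m0.
set E := elem_sym ms; set P := qsym _ [:: 1%N]; set Q := qsym _ [:: 1; 1]%N.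
have -> : ((Q + inv_series m * P) *+ 2) * ((1 + fpsC m^-1 * fpsX F) * E) =
   (Q *+ 2) * (1 + fpsC m^-1 * fpsX F) * E + (inv_series m * (1 + fpsC m^-1 * fpsX F)) * P * E
       *+ 2 by ring.
rewrite e; ring.
Qed.

Lemma elem_sym_rec ms r : (forall m, m \in ms -> m != 0) ->
  elem_sym ms r.+2 *+ (r.+2 * r.+1) =
  \sum_(q < r.+1) (qsym [seq inv_series m | m <- ms] [:: 1; 1]%N q *+ 2) * elem_sym ms (r - q)%N.
Proof.
move=> ms0; have := congr1 (fun f : fps F => f r) (elem_sym_deriv2 ms0).
rewrite fpsM /fps_deriv mulrnA => ->; apply: eq_bigr => q _.
by rewrite mulr2n fpsD -mulr2n.
Qed.
End Elem.

Section Ones.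
Variable R : realType.
Local Notation C := R[i].
Local Notation nrm := (@nrm R).
Local Notation recip := (@recip R).
Local Notation laurent_int := (@laurent_int R).
Implicit Types (k : seq nat) (a b q M T : nat) (s : C).

Definition shifted_pts s M : seq C := [seq m + (s - M%:R) | m <- nats R (M + M).+1].

Lemma shifted_pts_neq0 s M : noninteger s -> forall z, z \in shifted_pts s M -> z != 0.
Proof. by move=> hs z /mapP[m mT ->]; apply: shift_neq0 hs mT. Qed.

Lemma elem_sym_multitangent_trunc s M r : elem_sym (shifted_pts s M) r =
    multitangent_trunc s (nseq r 1%N) M.
Proof. by rewrite /elem_sym /multitangent_trunc /multitangent_pts /shifted_pts -map_comp. Qed.

(** The sum of 1 / ((m + s + X) (n + s + X)) over the ordered pairs m <> n. *)
Definition pair_series s q M : C := qsym [seq inv_series z | z <- shifted_pts s M] [:: 1;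
    1]%N q *+ 2.

(** Partial fractions for the index (1, 1), taken in the ring of power series: only
    simple poles occur there, and X enters through 1 / (n + s + X). *)
Lemma pair_seriesE s q M : noninteger s -> pair_series s q M = 2 * (-1) ^+ q *
  \sum_(i < (M + M).+1) laurent_int 1 [:: 1; 1]%N i (M + M - i)%N * (i%:R + (s - M%:R))^-1 ^+ q.+1.
Proof.
move=> hs; rewrite /pair_series /shifted_pts -map_comp.
rewrite (@partial_fractions C 1 [:: 1; 1]%N (nats R (M + M).+1) (uniq_nats _ _) _ (fps C) (@fpsC C)
  (fpsX C + fpsC (s - M%:R)) (fun m => inv_series (m + (s - M%:R)))) //; last first.
  move=> m mn; have := shifted_pts_neq0 hs (map_f (fun m => m + (s - M%:R)) mn) => /inv_seriesE.
  by rewrite rmorphD /= => <-; ring.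
rewrite add0r size_nats fps_sum -[LHS]mulr_natl -[RHS]mulrA; congr (_ * _).
rewrite mulr_sumr; apply: eq_bigr => i _; rewrite big_ord1 fpsCM expr1.
have iM : (i < (M + M).+1)%N by [].
by rewrite laurent_at_nats // nth_nats // /inv_series exprVn mulrCA.
Qed.

(** By symmetry: the residue for (1, 1) is the sum of 1/(m - n) over all m <> n, which
    vanishes at the centre of the interval. *)
Lemma laurent_int11 M : laurent_int 1 [:: 1; 1]%N M M = 0.
Proof.
rewrite laurent_intE // big_mkcond 2!big_ord_recl big_ord0 /= !big_ord1 /=.
by rewrite /zeta_taylor /= !qsym_nil ?subnn; ring.
Qed.

(** The higher coefficients carry poles of order >= 2, and so only see the central
    residue, which is 0. *)
Lemma pair_series_asymp0 s q : noninteger s -> asymp (pair_series s q.+1) (fun=> 0).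
Proof.
move=> hs; have := @coef_centre R s (laurent_int 1 [:: 1; 1]%N) q.+2 hs isT (laurent_int_step R
    _ _).
move=> /(_ isT isT) /(asympZ (2 * (-1) ^+ q.+1)); apply: eq_log_small => M.
by rewrite pair_seriesE // laurent_int11 mul0r mulr0.
Qed.

(** The difference of 1/(n+s) and 1/(n+t) decays like 1/n^2, so here too only the
    central residue 0 matters. *)
Lemma pair_series_indep s t : noninteger s -> noninteger t ->
    asymp (pair_series s 0) (pair_series t 0).
Proof.
move=> hs ht; have [c c0 hc] := pt_bound hs; have [d d0 hd] := pt_bound ht.
have := @coef_centre_gen R (laurent_int 1 [:: 1; 1]%N)
  (fun M i => (i%:R + (s - M%:R))^-1 * (i%:R + (t - M%:R))^-1) (laurent_int_step R _ _) _.
move=> /(_ isT isT) h.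
have {}h : asymp (fun M => \sum_(i < (M + M).+1) laurent_int 1 [:: 1; 1]%N i (M + M - i)%N *
    ((i%:R + (s - M%:R))^-1 * (i%:R + (t - M%:R))^-1)) (fun=> 0).
  apply: asymp_trans (h _) _; last by apply: eq_log_small (log_small0 R) => M;
      rewrite laurent_int11 mul0r subrr.
  exists (c * d); first exact: mulr_ge0.
  move=> M n nM; rewrite !(centre_pt _ nM).1 !(centre_pt _ nM).2 !nrmM.
  have [c1 c2] := hc n.+1; have [d1 d2] := hd n.+1.
  by rewrite mulrACA; split; rewrite ler_pM ?nrm_ge0.
have := asympZ (2 * (t - s)) h; apply: eq_log_small => M.
rewrite !pair_seriesE // !expr0 !mulr1 mulr0 subr0 -mulrBr -[LHS]mulrA; congr (_ * _).
rewrite mulr_sumr -sumrB; apply: eq_bigr => i _.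
have mz t' : i%:R + (t' - M%:R) \in shifted_pts t' M.
  apply/mapP; exists i%:R => //; apply/mapP; exists (nat_of_ord i) => //.
  by rewrite mem_iota add0n ltn_ord.
have z1 := shifted_pts_neq0 hs (mz s); have z2 := shifted_pts_neq0 ht (mz t).
rewrite !expr1 mulrCA -mulrBr; congr (_ * _).
by move: z1 z2; move: (i%:R : C) (M%:R : C) => x y z1 z2; field; rewrite z1 z2.
Qed.

Lemma multitangent_trunc_single s q M : multitangent_trunc s [:: q] M = power_sum s q M.
Proof.
rewrite /multitangent_trunc /multitangent_pts /power_sum /nats -map_comp.
have -> : forall (f : nat -> C) l, qsym [seq f i | i <- l] [:: q] = \sum_(i <- l) f i ^+ q.
  move=> f; elim=> [|i l IH]; first by rewrite big_nil.
  by rewrite map_cons qsym_cons IH qsym_nil mulr1 big_cons addrC.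
by rewrite -(big_mkord xpredT (fun i => (i%:R + (s - M%:R))^-1 ^+ q)) /index_iota subn0.
Qed.

(** At X = 0 this is the identity 2 e_2 = p_1^2 - p_2. *)
Lemma pair_series_power_sum s M : noninteger s -> pair_series s 0 M =
    power_sum s 1 M ^+ 2 - power_sum s 2 M.
Proof.
move=> hs.
have e k : qsym [seq inv_series z | z <- shifted_pts s M] k 0%N = multitangent_trunc s k M.
  have h : {morph (fun f : fps C => f 0%N) : f g / f * g >-> f * g}.
    by move=> f g; rewrite fpsM big_ord1.
  have hX (f : fps C) n : (f ^+ n) 0%N = f 0%N ^+ n.
    by elim: n => [|n IH]; rewrite ?expr0 // !exprS h IH.
  rewrite /multitangent_trunc /multitangent_pts /shifted_pts -map_comp;
      elim: (nats _ _) k => [|m l IH] [|x k] //.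
  rewrite !map_cons !qsym_cons fpsD IH h IH hX; congr (_ + _ ^+ _ * _).
  by rewrite /inv_series /= mul1r expr1.
have -> : pair_series s 0 M = multitangent_trunc s [:: 1; 1]%N M *+ 2 by rewrite /pair_series e.
have := qsym_stuffle (multitangent_pts s M) [:: 1%N] [:: 1%N].
rewrite -[stuffle_words _ _]/[:: [:: 1; 1]; [:: 1; 1]; [:: 2]]%N !big_cons big_nil.
rewrite -!multitangent_trunc_single expr2 /multitangent_trunc => <-; ring.
Qed.

Definition one_half : C := 2^-1.

Lemma noninteger_half : noninteger one_half.
Proof.
move=> n e.
have : (2 * n)%:~R = 1%:~R :> C by rewrite intrM -e /one_half mulfV ?pnatr_eq0.
by move/eqP; rewrite eqr_int => /eqP; lia.
Qed.

(** The points n + 1/2 and -(n + 1) + 1/2 are opposite, so that the points of a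
    symmetric interval cancel in pairs, up to one. *)
Lemma half_pt (n : nat) : n%:R + one_half = (n.*2.+1)%:R / 2 /\ - n.+1%:R + one_half =
    - (n.*2.+1)%:R / 2.
Proof.
have t0 : 2 != 0 :> C by rewrite pnatr_eq0.
by rewrite /one_half -!natr1 -mul2n natrM; split; field.
Qed.

(** All terms cancel in pairs but the last one. *)
Lemma power_sum_half1 : asymp (power_sum one_half 1) (fun=> 0).
Proof.
have e M : power_sum one_half 1 M = 2 / (M.*2.+1)%:R.
  rewrite power_sum_split big_nat_recr //= big_add1 /= addrAC -big_split /= big1 ?add0r.
    by rewrite expr1 (half_pt _).1 invfM invrK mulrC.
  by move=> n _; rewrite !expr1 (half_pt n).1 (half_pt n).2 mulNr invrN addrN.
exists 2 => //; exists 0%N => M; rewrite subr0 e nrmM nrmV !nrm_nat mulr1.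
by rewrite ler_wpM2l // lef_pV2 ?posrE ?ltr0n // ler_nat; lia.
Qed.

Definition odd_sum n : R := \sum_(i < n) (i.*2.+1%:R ^+ 2)^-1.

Lemma power_sum_half2 M : power_sum one_half 2 M = (4 * (odd_sum M.+1 + odd_sum M))%:C%C.
Proof.
rewrite power_sum_split !big_add1 !big_mkord /=.
have e (n : nat) : (((n.*2.+1)%:R / 2) ^+ 2)^-1 = (4 * (n.*2.+1%:R ^+ 2)^-1 : R)%:C%C.
  rewrite rmorphM fmorphV rmorphXn !rmorph_nat expr_div_n invf_div.
  by congr (_ / _); rewrite -natrX.
have -> : \sum_(n < M.+1) (n%:R + one_half) ^- 2 = (4 * odd_sum M.+1)%:C%C.
  rewrite /odd_sum mulr_sumr rmorph_sum; apply: eq_bigr => n _.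
  by rewrite (half_pt n).1 e.
rewrite mulrDr rmorphD /=; congr (_ + _).
rewrite /odd_sum mulr_sumr rmorph_sum; apply: eq_bigr => n _.
by rewrite (half_pt n).2 mulNr sqrrN e.
Qed.

End Ones.

(** * The sum of the inverse odd squares *)

Section Basel.
Variable R : realType.
Implicit Types (x t : R).
Local Notation pi := (@pi R).

Lemma sin_le_id t : 0 < t -> sin t <= t.
Proof.
move=> t0.
have [c _] : exists2 c, c \in `]0, t[%R & sin t - sin 0 = cos c * (t - 0).
  apply: (@MVT R sin cos 0 t t0).
  by apply: continuous_subspaceT => x; apply: continuous_sin.
rewrite sin0 !subr0 => ->; rewrite ler_piMl ?cos_le1 // ltW //.
Qed.

Lemma id_le_tan t : 0 < t < pi / 2 -> t <= tan t.
Proof.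
move=> /andP[t0 tp].
have cp x : 0 <= x <= t -> 0 < cos x.
  move=> /andP[x0 xt]; apply: cos_gt0_pihalf; rewrite (le_lt_trans xt tp) andbT.
  by have := pi_gt0 R; lra.
have [c ct] : exists2 c, c \in `]0, t[%R & tan t - tan 0 = (cos c)^-2 * (t - 0).
  apply: (@MVT R tan (fun x => (cos x)^-2) 0 t t0) => [x|].
    rewrite in_itv /= => /andP[x0 xt]; apply: is_derive_tan.
    by rewrite gt_eqF // cp // !ltW.
  apply: continuous_in_subspaceT => x; rewrite inE /= in_itv /= => xt.
  by apply: continuous_tan; rewrite gt_eqF // cp.
rewrite tan0 !subr0 => ->; rewrite ler_peMl ?(ltW t0) //.
move: ct; rewrite in_itv /= => /andP[c0 ct].
have cc : 0 < cos c by apply: cp; rewrite !ltW.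
by rewrite invf_ge1 ?exprn_gt0 // exprn_ile1 ?cos_le1 // ltW.
Qed.

(** From sin t <= t <= tan t and 1/sin^2 = 1/tan^2 + 1. *)
Lemma sinV2_bounds t : 0 < t < pi / 2 ->
  (t ^+ 2)^-1 <= (sin t ^+ 2)^-1 <= (t ^+ 2)^-1 + 1.
Proof.
move=> ht; have /andP[t0 tp] := ht.
have s0 := sin_gt0_pihalf ht.
have c0 : 0 < cos t by apply: cos_gt0_pihalf; have := pi_gt0 R; lra.
apply/andP; split.
  rewrite lef_pV2 ?posrE ?exprn_gt0 //.
  by apply: lerXn2r; [rewrite nnegrE ltW|rewrite nnegrE ltW|exact: sin_le_id].
have e : (sin t ^+ 2)^-1 = (tan t ^+ 2)^-1 + 1.
  rewrite /tan expr_div_n invf_div -[cos t ^+ 2]/(cos t ^+ 2) cos2sin2.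
  by field; rewrite gt_eqF.
rewrite e lerD2r lef_pV2 ?posrE ?exprn_gt0 //; last by rewrite divr_gt0.
by apply: lerXn2r; [rewrite nnegrE ltW|rewrite nnegrE ltW ?divr_gt0|exact: id_le_tan].
Qed.

(** The duplication formula for 1/sin^2, which drives [hofbauer]. *)
Lemma sin2_split t : sin t != 0 -> cos t != 0 ->
  (sin t ^+ 2)^-1 + (sin (t + pi / 2) ^+ 2)^-1 = 4 * (sin (t *+ 2) ^+ 2)^-1.
Proof.
move=> s0 c0; rewrite sinDpihalf sin_mulr2n.
have -> : (sin t ^+ 2)^-1 + (cos t ^+ 2)^-1 = (cos t ^+ 2 + sin t ^+ 2) / (sin t ^+ 2 * cos t ^+ 2).
  by field; rewrite s0 c0.
by rewrite cos2Dsin2; field; rewrite s0 c0.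
Qed.

(** The angles (2 k + 1) pi / 2^(n+1): they are the preimages of pi/2, modulo pi,
    under repeated doubling. *)
Definition odd_angle n (k : nat) : R := k.*2.+1%:R * (pi / (2 * 2 ^+ n)).

Lemma odd_angle_bound n k : (k < 2 ^ n)%N -> 0 < odd_angle n k < pi.
Proof.
move=> k2; have p0 := pi_gt0 R; have e0 : 0 < 2 ^+ n :> R by rewrite exprn_gt0.
apply/andP; split; first by rewrite /odd_angle mulr_gt0 ?divr_gt0 ?mulr_gt0 // ltr0n.
rewrite /odd_angle mulrCA gtr_pMr // ltr_pdivrMr ?mulr_gt0 // mul1r.
by rewrite -natrX -natrM ltr_nat; lia.
Qed.

Lemma odd_angle_halfbound n k : (k < 2 ^ n)%N -> 0 < odd_angle n.+1 k < pi / 2.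
Proof.
move=> k2; have -> : odd_angle n.+1 k = odd_angle n k / 2.
  rewrite /odd_angle exprS; have e0 : 2 ^+ n != 0 :> R by rewrite expf_neq0.
  by field.
have /andP[t0 tp] := odd_angle_bound k2; apply/andP; split; lra.
Qed.

Lemma odd_angle_double n k : odd_angle n.+1 k *+ 2 = odd_angle n k.
Proof.
rewrite /odd_angle exprS -mulr_natl; have e0 : 2 ^+ n != 0 :> R by rewrite expf_neq0.
by field.
Qed.

Lemma odd_angle_shift n k : odd_angle n.+1 (k + 2 ^ n) = odd_angle n.+1 k + pi / 2.
Proof.
rewrite /odd_angle doubleD -addSn natrD mulrDl; congr (_ + _).
rewrite -mul2n natrM natrX exprS; have e0 : 2 ^+ n != 0 :> R by rewrite expf_neq0.
by field.
Qed.

(** Each term is split by the duplication formula, and the two halves are the angles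
    of the next level; the sum is multiplied by 4. This is Hofbauer's proof of the
    identity of Euler, in finite form. *)
Lemma hofbauer n : \sum_(k < 2 ^ n) (sin (odd_angle n k) ^+ 2)^-1 = 4 ^+ n.
Proof.
elim: n => [|n IH].
  rewrite big_ord1 /odd_angle expr0 mulr1 mul1r sin_pihalf expr1n invr1 //.
rewrite exprS -IH mulr_sumr.
rewrite -(big_mkord xpredT (fun k => (sin (odd_angle n.+1 k) ^+ 2)^-1)).
rewrite (@big_cat_nat _ _ _ (2 ^ n)) //=; last by rewrite leq_exp2l.
rewrite -{2}[(2 ^ n)%N]add0n big_addn expnS mul2n -addnn addnK !big_mkord -big_split /=.
apply: eq_bigr => k _; rewrite odd_angle_shift.
have /andP[t0 tp] := odd_angle_halfbound (ltn_ord k).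
rewrite sin2_split ?odd_angle_double //.
  by rewrite gt_eqF // sin_gt0_pihalf // t0 tp.
by rewrite gt_eqF // cos_gt0_pihalf // tp andbT; lra.
Qed.

Lemma odd_angle_sym n k : (k < 2 ^ n.+1)%N -> odd_angle n.+1 (2 ^ n.+1 - k.+1) =
    pi - odd_angle n.+1 k.
Proof.
move=> k2; rewrite /odd_angle.
have -> : (2 ^ n.+1 - k.+1).*2.+1%:R = 2 * 2 ^+ n.+1 - k.*2.+1%:R :> R.
  apply/eqP; rewrite -subr_eq0 opprB addrA subr_eq0 -natrX -natrM -natrD eqr_nat; apply/eqP; lia.
have e0 : 2 ^+ n.+1 != 0 :> R by rewrite expf_neq0.
by field.
Qed.

(** The angles are symmetric with respect to pi/2, and only those below pi/2 fall
    under [sinV2_bounds]. *)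
Lemma hofbauer_half n : 2 * \sum_(k < 2 ^ n) (sin (odd_angle n.+1 k) ^+ 2)^-1 = 4 ^+ n.+1.
Proof.
rewrite -hofbauer -(big_mkord xpredT (fun k => (sin (odd_angle n.+1 k) ^+ 2)^-1)).
rewrite -[RHS](big_mkord xpredT (fun k => (sin (odd_angle n.+1 k) ^+ 2)^-1)).
rewrite [RHS](@big_cat_nat _ _ _ (2 ^ n)) //=; last by rewrite leq_exp2l.
rewrite big_mkord mulr_natl mulr2n; congr (_ + _).
rewrite -[X in index_iota X _]add0n big_addn expnS mul2n -addnn addnK big_mkord.
rewrite [RHS](reindex_inj rev_ord_inj); apply: eq_bigr => k _ /=.
have kn := ltn_ord k.
have -> : (2 ^ n - k.+1 + 2 ^ n = 2 ^ n.+1 - k.+1)%N by rewrite expnS; lia.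
rewrite odd_angle_sym; last by rewrite expnS; lia.
by rewrite sinB sinpi cospi mul0r sub0r mulN1r opprK.
Qed.

Lemma odd_sum_odd_angle n : \sum_(k < 2 ^ n) (odd_angle n.+1 k ^+ 2)^-1 =
    16 * 4 ^+ n / pi ^+ 2 * odd_sum R (2 ^ n).
Proof.
rewrite /odd_sum mulr_sumr; apply: eq_bigr => k _.
rewrite /odd_angle exprMn invfM mulrC; congr (_ * _).
have p0 : pi != 0 by rewrite gt_eqF // pi_gt0.
have -> : (4 : R) ^+ n = (2 ^+ n) ^+ 2 by rewrite -exprM mulnC exprM; congr (_ ^+ _);
    rewrite -natrX.
have t0 : 2 ^+ n != 0 :> R by rewrite expf_neq0.
by rewrite (exprS 2 n); move: pi (2 ^+ n : R) p0 t0 => p t p0 t0; field; rewrite p0.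
Qed.

(** Comparing 1/sin^2 with 1/t^2 costs at most 1 per angle, hence 2^n in total against
    the main term of order 4^n. *)
Lemma odd_sum_bounds n : pi ^+ 2 / 8 - pi ^+ 2 / (16 * 2 ^+ n) <= odd_sum R (2 ^ n) <= pi ^+ 2 / 8.
Proof.
have h1 : \sum_(k < 2 ^ n) (odd_angle n.+1 k ^+ 2)^-1 <= \sum_(k < 2 ^ n) (sin (odd_angle n.+1
    k) ^+ 2)^-1.
  by apply: ler_sum => k _; have /andP[] := sinV2_bounds (odd_angle_halfbound (ltn_ord k)).
(* The error term 1 of the upper bound is counted once for each of the 2^n angles. *)
have h2 : \sum_(k < 2 ^ n) (sin (odd_angle n.+1 k) ^+ 2)^-1 <= \sum_(k < 2 ^ n) (odd_angle n.+1
    k ^+ 2)^-1 + 2 ^+ n.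
  have -> : 2 ^+ n = \sum_(k < 2 ^ n) 1 :> R by rewrite sumr_const card_ord natrX.
  rewrite -big_split /=.
  by apply: ler_sum => k _; have /andP[] := sinV2_bounds (odd_angle_halfbound (ltn_ord k)).
have h3 := hofbauer_half n; rewrite odd_sum_odd_angle in h1 h2.
set S := \sum_(k < 2 ^ n) _ in h1 h2 h3; set B := odd_sum _ _ in h1 h2 *.
have p0 : 0 < pi ^+ 2 by rewrite exprn_gt0 // pi_gt0.
have e4 : 4 ^+ n = (2 ^+ n) ^+ 2 :> R by rewrite -exprM mulnC exprM; congr (_ ^+ _); rewrite -natrX.
have SE : S = 2 * (2 ^+ n) ^+ 2 by move: h3; rewrite exprS e4; lra.
have t0 : 0 < 2 ^+ n :> R by rewrite exprn_gt0.
move: h1 h2; rewrite SE e4; move: (2 ^+ n : R) (pi ^+ 2) p0 t0 => t p p0 t0 h1 h2.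
have t2 : 0 < 16 * t ^+ 2 by rewrite mulr_gt0 // exprn_gt0.
have BE : B = p / (16 * t ^+ 2) * (16 * t ^+ 2 / p * B) by field; rewrite !gt_eqF.
have c0 : 0 < p / (16 * t ^+ 2) by rewrite divr_gt0.
apply/andP; split; rewrite BE.
  have -> : p / 8 - p / (16 * t) = p / (16 * t ^+ 2) * (2 * t ^+ 2 - t) by field; rewrite gt_eqF.
  by rewrite ler_pM2l //; lra.
have -> : p / 8 = p / (16 * t ^+ 2) * (2 * t ^+ 2) by field; rewrite gt_eqF.
by rewrite ler_pM2l.
Qed.

End Basel.

(** * Indices of ones and conclusion *)

Section Main.
Variable R : realType.
Local Notation C := R[i].
Local Notation nrm := (@nrm R).
Local Notation pi := (@pi R).
Implicit Types (k : seq nat) (s T : C).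

Lemma odd_sum_arith (p t B u : R) : 0 <= p * t -> 0 <= u -> u <= t ->
  p / 8 - p / 16 * t <= B -> B <= p / 8 ->
  `|4 * (B + u + B) - p| <= p / 2 * t + 4 * t.
Proof. by move=> *; rewrite ler_norml; apply/andP; split; lra. Qed.

Lemma half_dist_arith (d e x y : R) : x < d / 2 -> y <= e -> e < d / 2 -> d <= x + y -> False.
Proof. by move=> *; lra. Qed.

(** The terms of the power sum at 1/2 are 4 / (2 k + 1)^2, each odd number occurring
    twice, except for the last one. *)
Lemma monotangent2_half : monotangent 2 (one_half R) = (pi ^+ 2)%:C%C.
Proof.
set l := monotangent _ _; apply/eqP; rewrite -subr_eq0 -nrm_eq0; apply/negPn/negP => d0.
have {}d0 : 0 < nrm (l - (pi ^+ 2)%:C%C) by rewrite lt_def d0 nrm_ge0.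
set d := nrm _ in d0; have d2 : 0 < d / 2 by lra.
have [N hN] := log_small_lim (power_sum_asymp (@noninteger_half R) (isT : 0 < 2)%N) d2.
have p0 : 0 < pi ^+ 2 by rewrite exprn_gt0 // pi_gt0.
(* c / 2^n bounds the distance of the truncation at 2^n from pi^2: pi^2/2 stems from the bounds
   on the two partial sums and 4 from their difference. *)
pose c := pi ^+ 2 / 2 + 4; have c0 : 0 < c by rewrite /c; lra.
pose n := maxn N (Num.bound (c / (d / 2))).
have n2 : (n < 2 ^ n)%N by rewrite ltn_expl.
have nN : (N <= 2 ^ n)%N by apply: leq_trans (ltnW n2); rewrite leq_maxl.
have := hN _ nN; rewrite power_sum_half2 -/l => h1.
have t0 : 0 < 2 ^+ n :> R by rewrite exprn_gt0.
have h2 : c / 2 ^+ n < d / 2.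
  rewrite ltr_pdivrMr // mulrC -ltr_pdivrMr //.
  apply: lt_le_trans (archi_boundP _) _; first by rewrite divr_ge0 // ltW.
  by rewrite -natrX ler_nat (leq_trans _ (ltnW n2)) // leq_maxr.
have /andP[b1 b2] := odd_sum_bounds R n.
have oS : odd_sum R (2 ^ n).+1 = odd_sum R (2 ^ n) + ((2 ^ n).*2.+1%:R ^+ 2)^-1.
  by rewrite /odd_sum big_ord_recr.
have o1 : ((2 ^ n).*2.+1%:R ^+ 2)^-1 <= (2 ^+ n)^-1 :> R.
  rewrite lef_pV2 ?posrE ?exprn_gt0 ?ltr0n // -!natrX ler_nat.
  by apply: leq_trans (leq_pexp2l _ (isT : 1 <= 2)%N); rewrite ?expn1 //; lia.
have o0 : 0 <= ((2 ^ n).*2.+1%:R ^+ 2)^-1 :> R by rewrite invr_ge0 exprn_ge0.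
have h3 : nrm ((4 * (odd_sum R (2 ^ n).+1 + odd_sum R (2 ^ n)))%:C%C - (pi ^+ 2)%:C%C) <=
    c / 2 ^+ n.
  rewrite -rmorphB nrm_real oS.
  have e1 : pi ^+ 2 / (16 * 2 ^+ n) = pi ^+ 2 / 16 * (2 ^+ n)^-1 by rewrite invfM mulrA.
  have e2 : c / 2 ^+ n = pi ^+ 2 / 2 * (2 ^+ n)^-1 + 4 * (2 ^+ n)^-1 by rewrite /c mulrDl.
  have pt : 0 <= pi ^+ 2 * (2 ^+ n)^-1 by rewrite mulr_ge0 ?invr_ge0 // ltW.
  by rewrite e2; apply: odd_sum_arith => //; rewrite -e1.
have := nrm_dist l (pi ^+ 2)%:C%C (4 * (odd_sum R (2 ^ n).+1 + odd_sum R (2 ^ n)))%:C%C.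
by rewrite -/d (nrmBC l); apply: half_dist_arith h1 h3 h2.
Qed.

(** By independence of s it suffices to take s = 1/2, where p_1 tends to 0 and p_2 to
    pi^2. *)
Lemma pair_series_asymp s : noninteger s -> asymp (pair_series s 0) (fun=> - (pi ^+ 2)%:C%C).
Proof.
move=> hs; have hh := @noninteger_half R.
apply: asymp_trans (pair_series_indep hs hh) _.
have -> : pair_series (one_half R) 0 = (fun M => power_sum (one_half R) 1 M ^+ 2 - power_sum
    (one_half R) 2 M).
  by apply/funext => M; rewrite pair_series_power_sum.
have -> : - (pi ^+ 2)%:C%C = 0 ^+ 2 - (pi ^+ 2)%:C%C :> C by rewrite expr0n sub0r.
apply: asympB; last by rewrite -monotangent2_half; apply: power_sum_asymp.
by apply: asympX; [exact: power_sum_half1|exact: log_bounded_cst].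
Qed.

Definition ones_value s r : C := coef_c0 R (nseq r 1%N) + coef_c1 R (nseq r 1%N) * monotangent 1 s.

Lemma ones_value_odd s r : odd r ->
  ones_value s r = (-1) ^+ (r.-1)./2 * (pi%:C%C) ^+ r.-1 / r`!%:R * monotangent 1 s.
Proof.
by move=> ro; rewrite /ones_value /coef_c0 /coef_c1 !size_nseq !eqxx ro add0r.
Qed.
Lemma ones_value_even s r : ~~ odd r -> ones_value s r = ('i%C * pi%:C%C) ^+ r / r`!%:R.
Proof.
move=> ro; rewrite /ones_value /coef_c0 /coef_c1 !size_nseq !eqxx ro /=.
by rewrite (negbTE ro) mul0r addr0.
Qed.

Lemma fact_div (u v : C) r : u * v / (r.+2)`!%:R = u / (r.+2 * r.+1)%N%:R * (v / r`!%:R).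
Proof. by rewrite !factS mulnA natrM invfM mulrACA. Qed.

(** The constants of the theorem satisfy the recurrence that the differential equation
    imposes on the limits. *)
Lemma ones_value_rec s r : ones_value s r.+2 = - (pi ^+ 2)%:C%C / (r.+2 * r.+1)%N%:R *
    ones_value s r.
Proof.
have [ro|ro] := boolP (odd r).
  rewrite !ones_value_odd //=; last by rewrite ro.
  rewrite [RHS]mulrA; congr (_ * _); rewrite -fact_div; congr (_ / _).
  case: r ro => // r _ /=.
  rewrite rmorphXn exprS -[r.+2]addn2 exprD mulN1r !mulNr; congr (- _).
  by rewrite mulrA mulrC.
rewrite !ones_value_even //=; last by rewrite negbK.
rewrite -fact_div; congr (_ / _).
have i2 : ('i%C : C) ^+ 2 = -1 by exact: sqr_i.
by rewrite -[r.+2]addn2 exprD mulrC; congr (_ * _); rewrite exprMn i2 mulN1r rmorphXn.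
Qed.

(** Coefficients of E'' = V E: in the limit only the constant coefficient -pi^2 of V
    is left. *)
Lemma ones_asymp s r : noninteger s -> asymp (multitangent_trunc s (nseq r 1%N)) (fun=>
    ones_value s r).
Proof.
move=> hs; elim/ltn_ind: r => -[|[|r]] IH.
- apply: eq_log_small (log_small0 R) => M; rewrite /multitangent_trunc qsym_nil /ones_value
    /coef_c0 /coef_c1 /=.
  by rewrite expr0 invr1 mulr1 mul0r addr0 subrr.
- have := power_sum_asymp hs (isT : 0 < 1)%N; apply: eq_log_small => M.
  rewrite /ones_value /coef_c0 /coef_c1 /= !expr0 !mul1r invr1 mul1r add0r; congr (_ - _).
  by rewrite -multitangent_trunc_single.
rewrite ones_value_rec.
have -> : multitangent_trunc s (nseq r.+2 1%N) = (fun M => ((r.+2 * r.+1)%N%:R)^-1 *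
    \sum_(q < r.+1) pair_series s q M * multitangent_trunc s (nseq (r - q) 1%N) M).
  apply/funext => M.
  have := elem_sym_rec r (shifted_pts_neq0 (M := M) hs); rewrite elem_sym_multitangent_trunc.
  under eq_bigr => q _ do rewrite elem_sym_multitangent_trunc -/(pair_series s q M).
  by move=> <-; rewrite -[multitangent_trunc _ _ M *+ _]mulr_natl mulKf // pnatr_eq0.
rewrite mulrAC mulrC mulrA [X in asymp _ (fun=> X)](_ : _ = (r.+2 * r.+1)%N%:R^-1 *
   \sum_(q < r.+1) (if q == 0 :> nat then - (pi ^+ 2)%:C%C else 0) * ones_value s (r - q));
       last first.
  rewrite big_ord_recl subn0 big1 ?addr0; last by move=> i _; rewrite mul0r.
  by rewrite -mulrA.
apply: asympZ; apply: asymp_sum => q _; apply: asympM.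
- by case: (nat_of_ord q) => [|q'] /=; [exact: pair_series_asymp|exact: pair_series_asymp0].
- by apply: IH; rewrite ltnS (leq_trans (leq_subr _ _)).
- exact: log_bounded_cst.
- exact: log_bounded_cst.
Qed.

Lemma theorem_ones r (T s : C) : noninteger s ->
  multitangent_reg T (nseq r 1%N) s = ones_value s r.
Proof.
move=> hs; pose f X := multitangent_reg X (nseq r 1%N) s.
apply: (@poly_identity R f (fun=> ones_value s r)).
- exact: is_poly_multitangent.
- exact: is_poly_cst.
apply: asymp_trans (asymp_sym (multitangent_trunc_asymp hs _)) (ones_asymp r hs).
by rewrite /is_index all_nseq orbT.
Qed.

End Main.

Theorem theorem1p1 (R : realType) (k : seq nat) (T s : R[i])
    (hk : is_index k) (hs : forall n : int, s <> n%:~R) :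
  multitangent_reg T k s =
    coef_c0 R k + coef_c1 R k * monotangent 1 s +
    \sum_(1 <= j < (size k).+1)
      \sum_(0 <= m < (nth 0%N k j.-1).-1)
        coef_C T k j m * monotangent (nth 0%N k j.-1 - m) s.
Proof.
have [ek|k1] := eqVneq k (nseq (size k) 1%N).
  rewrite {1}ek theorem_ones // /ones_value -ek.
  rewrite big_nat_cond big1 ?addr0 // => j /andP[/andP[j1 jk] _].
  by rewrite ek nth_nseq ifT ?big_geq //; lia.
rewrite theorem_not_ones // /coef_c0 /coef_c1 (negbTE k1) /=.
by rewrite mul0r !add0r.
Qed.
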